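(* Let $k$ be a field of characteristic $\ell>0$, $q$ a prime power, $n\geq 1$, and let $\kappa$ be the $\ell$-adic valuation of $|GL_n(\mathbb F_q)/B|$, where $B$ is the subgroup of upper triangular matrices. The restriction of the Jantzen filtration $$\Delta_{\{0\},k}=(\Delta_{\{0\},k})^0\supseteq(\Delta_{\{0\},k})^1\supseteq\cdots$$ of the standard $S_k(PG(n-1,q))$-module $\Delta_{\{0\},k}$ to the $\mathbb F_q^n$-weight space $\Delta^{\mathbb F_q^n}_{\{0\},k}\cong \mathrm{St}^k(\mathbb F_q^n)^*$ is dual to Gow's Jantzen filtration $$\mathrm{St}^k(\mathbb F_q^n)=I(0)\supseteq I(1)\supseteq I(2)\supseteq\cdots$$ in the sense that $I(i)^\perp=(\Delta^{\mathbb F_q^n}_{\{0\},k})^{\kappa+1-i}$ for every $i\ge 0$, where $\perp$ is the annihilator under the identification of $\Delta^{\mathbb F_q^n}_{\{0\},k}$ with $\mathrm{St}^k(\mathbb F_q^n)^*$.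
   Context: Algebra. For subspaces of $\mathbb{F}_q^n$ write $V\lessdot W$ (or $W\gtrdot V$) if $V\subset W$ and $\dim W=\dim V+1$. A flag path is a finite nonempty sequence $(V_1,\dots,V_l)$ of subspaces such that for each $i<l$ either $V_i\lessdot V_{i+1}$ or $V_i\gtrdot V_{i+1}$. The free $\mathbb{Z}$-module on flag paths is an algebra under concatenation ($(K_1,\dots,K_l)\cdot(L_1,\dots,L_{l'})=(K_1,\dots,K_l=L_1,L_2,\dots,L_{l'})$ if $K_l=L_1$, else $0$). $S(PG(n-1,q))$ is its quotient by the two-sided ideal generated by: (FS) for $V\subset W$ with $\dim W=\dim V+2$: $\sum_X (V\lessdot X\lessdot W)=0=\sum_X (W\gtrdot X\gtrdot V)$, sums over $X$ with $V\lessdot X\lessdot W$; ($\bigwedge$) for $V\lessdot W\gtrdot V'$: $(V\lessdot W\gtrdot V')=q^{\dim V}(V)$ if $V=V'$, and $=-(V\gtrdot V\cap V'\lessdot V')$ if $V\ne V'$. $S_k=S\otimes_{\mathbb Z}k$; the $W$-weight space of a left module $X$ is $X^W=(W)X$. Standard module and Jantzen filtration. $\Delta_{\{0\}}\subset S(PG(n-1,q))$ is the left ideal spanned by flags $(V_m\gtrdot\dots\gtrdot V_1\gtrdot\{0\})$; it is the free $\mathbb Z$-module on such flags modulo the (FS) relations. The symmetric form $\langle\,,\rangle:\Delta_{\{0\}}\times\Delta_{\{0\}}\to\mathbb Z$ is defined on flags $V_\bullet=(V_l\gtrdot\dots\gtrdot V_1\gtrdot\{0\})$, $W_\bullet=(W_m\gtrdot\dots\gtrdot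 W_1\gtrdot\{0\})$ by $\langle V_\bullet,W_\bullet\rangle(\{0\})=(\{0\},W_1,\dots,W_m)\cdot(V_l,\dots,V_1,\{0\})$ in $S(PG(n-1,q))$ (always an integer multiple of the idempotent $(\{0\})$). Put $\Delta_{\{0\}}^i=\{x:\langle x,v\rangle\in\ell^i\mathbb Z\ \forall v\in\Delta_{\{0\}}\}$, $\Delta_{\{0\},k}=\Delta_{\{0\}}\otimes k$, and let $(\Delta_{\{0\},k})^i$ be the image of $\Delta^i_{\{0\}}\otimes k$ in $\Delta_{\{0\},k}$; $(\Delta^{\mathbb F_q^n}_{\{0\},k})^i$ is its $\mathbb F_q^n$-weight space. For negative $i$ the filtration term is the whole space. Steinberg module and Gow's filtration. $G=GL_n(\mathbb F_q)$, $U\subset B$ the upper unitriangular matrices, $\mathfrak S_n\subset G$ permutation matrices, $\mathfrak e=(\sum_{\sigma\in\mathfrak S_n}\mathrm{sgn}(\sigma)\sigma)\sum_{b\in B}b$. For a commutative ring $R$, $\mathrm{St}^R(\mathbb F_q^n)=RG\,\mathfrak e$, with $R$-basis $\{u\mathfrak e\}_{u\in U}$. Let $f$ be the symmetric $\mathbb Z$-bilinear form on $\mathrm{St}^{\mathbb Z}(\mathbb F_q^n)$ with $f(u_1\mathfrak e,u_2\mathfrak e)=c_W(u_1^{-1}u_2)$, $c_W(u)=|\{w\in\mathfrak S_n: wuw^{-1}\in U\}|$. $I(i)\subseteq\mathrm{St}^k(\mathbb F_q^n)$ is the image of $\{x\in\mathrm{St}^{\mathbb Z}(\mathbb F_q^n):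 f(x,y)\in\ell^i\mathbb Z\ \forall y\}\otimes k$. Identification. Let $\mathscr F\ell_n$ be the $k$-vector space on full flags $(\mathbb F_q^n\gtrdot\dots\gtrdot\{0\})$. There is a $kG$-isomorphism $kG(\sum_{b\in B}b)\cong\mathscr F\ell_n$ sending $\sum_b b$ to the standard flag $(\mathbb F_q^n\gtrdot\dots\gtrdot\langle e_1,e_2\rangle\gtrdot\langle e_1\rangle\gtrdot\{0\})$, which restricts to an embedding $\mathrm{St}^k(\mathbb F_q^n)\subset\mathscr F\ell_n$. Making full flags orthonormal gives a form on $\mathscr F\ell_n$, which induces a perfect $G$-invariant pairing between $\Delta^{\mathbb F_q^n}_{\{0\},k}=\mathscr F\ell_n/(\mathrm{FS})$ and $\mathrm{St}^k(\mathbb F_q^n)$, i.e. the identification $\Delta^{\mathbb F_q^n}_{\{0\},k}\cong\mathrm{St}^k(\mathbb F_q^n)^*$. *)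

(* Defs.v *)
From HB Require Import structures.
From mathcomp Require Import all_boot all_order all_algebra all_fingroup.
From mathcomp Require Import finmap.
From mathcomp Require Import boolp classical_sets.
From mathcomp.multinomials Require Import monalg.

Set Implicit Arguments.
Unset Strict Implicit.
Unset Printing Implicit Defensive.

Import GRing.Theory.

Local Open Scope classical_set_scope.
Local Open Scope ring_scope.

Section FiniteVspace.
Import VectorInternalTheory.
Variables (F : finFieldType) (vT : vectType F).
HB.instance Definition _ := [Countable of {vspace vT} by <:].
HB.instance Definition _ := [Finite of {vspace vT} by <:].
End FiniteVspace.

Definition lspan (R : nzRingType) (V : lmodType R) (A : set V) : set V :=
  [set x | exists m (c : 'I_m -> R) (a : 'I_m -> V),
     (forall i, A (a i)) /\ x = \sum_i c i *: a i].

(* Change of coefficients from Z[K] to R[K]. *)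
Definition reduce (R : nzRingType) (K : choiceType) (x : {malg int[K]}) :
    {malg R[K]} :=
  \sum_(p <- msupp x) << (x@_p)%:~R *g p >>.

(* For a submodule A of Z[K], the image of A (x) k in k[K]. *)
Definition image_tensor (k : nzRingType) (K : choiceType)
    (A : set {malg int[K]}) : set {malg k[K]} :=
  lspan (@reduce k K @` A).
Arguments image_tensor k {K} A.

Section FlagPaths.
Variables (F : finFieldType) (n : nat).

Local Notation subsp := {vspace 'cV[F]_n}.

Definition covers (V W : subsp) := (V <= W)%VS && (\dim W == (\dim V).+1).

Definition is_flag_path (s : seq subsp) :=
  (s != [::]) && sorted (fun V W => covers V W || covers W V) s.

Definition flag_path := {s : seq subsp | is_flag_path s}.
HB.instance Definition _ := Choice.on flag_path.

(* Flags (V_m, ..., V_1, 0), with every term covering the next one. *)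
Definition is_flag (s : seq subsp) :=
  [&& s != [::], sorted (fun V W => covers W V) s & last 0%VS s == 0%VS].

Definition is_full_flag (s : seq subsp) :=
  is_flag s && (head 0%VS s == fullv).

End FlagPaths.

Section PathAlgebra.
Variables (F : finFieldType) (n : nat) (R : comNzRingType).

Local Notation subsp := {vspace 'cV[F]_n}.
Local Notation q := #|F|.

(* The path algebra: the free R-module on flag paths, with the product pmul. *)
Definition path_alg := {malg R[flag_path F n]}.

(* The basis element of a flag path; the value 0 on sequences which are not
   flag paths is junk. *)
Definition bpath (s : seq subsp) : path_alg :=
  if insub s is Some p then << p >> else 0.

Definition concat (p r : flag_path F n) : path_alg :=
  if last 0%VS (val p) == head 0%VS (val r)
  then bpath (val p ++ behead (val r)) else 0.

Definition pmul (x y : path_alg) : path_alg :=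
  \sum_(p <- msupp x) \sum_(r <- msupp y) (x@_p * y@_r) *: concat p r.

Definition preverse (x : path_alg) : path_alg :=
  \sum_(p <- msupp x) x@_p *: bpath (rev (val p)).

Inductive relator : path_alg -> Prop :=
| RelFSup (V W : subsp) : (V <= W)%VS -> \dim W = (\dim V).+2 ->
    relator (\sum_(X | covers V X && covers X W) bpath [:: V; X; W])
| RelFSdown (V W : subsp) : (V <= W)%VS -> \dim W = (\dim V).+2 ->
    relator (\sum_(X | covers V X && covers X W) bpath [:: W; X; V])
| RelWedgeEq (V W : subsp) : covers V W ->
    relator (bpath [:: V; W; V] - (q ^ \dim V)%:R *: bpath [:: V])
| RelWedgeNeq (V W V' : subsp) : covers V W -> covers V' W -> V != V' ->
    relator (bpath [:: V; W; V'] + bpath [:: V; (V :&: V')%VS; V']).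

(* The two-sided ideal generated by the relators. *)
Inductive rel_ideal : path_alg -> Prop :=
| RIgen x : relator x -> rel_ideal x
| RI0 : rel_ideal 0
| RID x y : rel_ideal x -> rel_ideal y -> rel_ideal (x + y)
| RIZ a x : rel_ideal x -> rel_ideal (a *: x)
| RIMl y x : rel_ideal x -> rel_ideal (pmul y x)
| RIMr y x : rel_ideal x -> rel_ideal (pmul x y).

(* Equality in S_R = S(PG(n-1,q)) (x) R.  Elements of S_R are represented by
   elements of the path algebra, and subsets of S_R by their full preimages,
   i.e. by subsets of the path algebra saturated for eqS. *)
Definition eqS (x y : path_alg) := rel_ideal (x - y).

Definition saturate (A : set path_alg) : set path_alg :=
  [set x | exists2 y, A y & eqS x y].

Definition weight_space (W : subsp) (X : set path_alg) : set path_alg :=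
  saturate (pmul (bpath [:: W]) @` X).

(* The left ideal Delta_{0} (x) R of S_R. *)
Definition Delta : set path_alg :=
  saturate (lspan [set bpath s | s in [set s | is_flag s]]).

(* F\ell_n, as a submodule of the path algebra. *)
Definition full_flags : set path_alg :=
  lspan [set bpath s | s in [set s | is_full_flag s]].

(* The form for which the flag paths are orthonormal. *)
Definition pdot (x y : path_alg) : R := \sum_(p <- msupp x) x@_p * y@_p.

End PathAlgebra.

Arguments Delta F n R : clear implicits.
Arguments full_flags F n R : clear implicits.

Section JantzenFiltration.
Variables (F : finFieldType) (n ell : nat).

(* <x, v>: since path reversal is extended linearly and (0) S (0) = Z (0), the
   equation below is the bilinear extension of the formula on flags. *)
Definition jform (x v : path_alg F n int) : int :=
  xget 0 [set c : int |
    eqS (pmul (preverse v) x) (c *: bpath int [:: 0%VS])].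

Definition Delta_fil (i : nat) : set (path_alg F n int) :=
  [set x | Delta F n int x /\ forall v, Delta F n int v ->
     ((ell ^ i)%:Z %| jform x v)%Z].

Definition Deltak_fil (k : fieldType) (i : int) : set (path_alg F n k) :=
  match i with
  | Posz j => saturate (image_tensor k (Delta_fil j))
  | Negz _ => Delta F n k
  end.

End JantzenFiltration.

Arguments Deltak_fil F n ell k i : clear implicits.

(* The dimension is n.+1. *)
Section Steinberg.
Variables (F : finFieldType) (n : nat).

Local Notation GL := {'GL_n.+1[F]}.

Definition borel : {set GL} :=
  [set g : GL | [forall i : 'I_n.+1, forall j : 'I_n.+1, (j < i)%N ==>
                   (GLval g i j == 0)]].

Definition unitri : {set GL} :=
  [set g : GL | [forall i : 'I_n.+1, forall j : 'I_n.+1, (j <= i)%N ==>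
                   (GLval g i j == (i == j)%:R)]].

Definition perm_GL (s : 'S_n.+1) : GL :=
  FinRing.unit 'M[F]_n.+1 (unitmx_perm F s).

Definition cW (u : GL) : nat :=
  #|[pred w : 'S_n.+1 | (perm_GL w * u * (perm_GL w)^-1)%g \in unitri]|.

Definition kappa (ell : nat) : nat :=
  logn ell #|lcosets borel ('GL_n.+1[F])%g|.

(* GL acts on columns, so borel is the stabiliser of the standard flag. *)
Definition act (g : GL) (V : {vspace 'cV[F]_n.+1}) : {vspace 'cV[F]_n.+1} :=
  (linfun (mulmx (GLval g : 'M[F]_n.+1)) @: V)%VS.

Definition std_flag : seq {vspace 'cV[F]_n.+1} :=
  [seq <<[seq (delta_mx i 0%R : 'cV[F]_n.+1)
           | i : 'I_n.+1 <- enum 'I_n.+1 & (i < j)%N]>>%VS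
     | j <- rev (iota 0 n.+2)].

Section GroupAlgebra.
Variable R : comNzRingType.

(* The group algebra RG, with the product gmul. *)
Definition grp_alg := {malg R[GL]}.

Definition gmul (x y : grp_alg) : grp_alg :=
  \sum_(g <- msupp x) \sum_(h <- msupp y) << x@_g * y@_h *g (g * h)%g >>.

Definition borel_sum : grp_alg := \sum_(b in borel) << b >>.

Definition st_e : grp_alg :=
  gmul (\sum_(s : 'S_n.+1) (-1) ^+ s *: << perm_GL s >>) borel_sum.

Definition St : set grp_alg := [set gmul x st_e | x in [set: grp_alg]].

Definition st_vec (a : GL -> R) : grp_alg :=
  \sum_(u in unitri) a u *: gmul << u >> st_e.

(* The graph of the isomorphism RG (\sum_b b) -> F\ell_n. *)
Definition flag_iso (y : grp_alg) (z : path_alg F n.+1 R) : Prop :=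
  exists2 x : grp_alg, y = gmul x borel_sum &
    z = \sum_(g <- msupp x) x@_g *: bpath R (map (act g) std_flag).

End GroupAlgebra.

Arguments St R : clear implicits.

(* The bilinear form f on St^Z, in coordinates in the basis u e. *)
Definition gow_form (x y : grp_alg int) : int :=
  xget 0 [set c : int | exists a b : GL -> int,
    [/\ x = st_vec a, y = st_vec b &
        c = \sum_(u in unitri) \sum_(v in unitri)
              a u * b v * (cW (u^-1 * v)%g)%:Z]].

Definition gow_fil (ell : nat) (k : fieldType) (i : nat) : set (grp_alg k) :=
  image_tensor k
    [set x | St int x /\ forall y, St int y ->
       ((ell ^ i)%:Z %| gow_form x y)%Z].

Variable k : fieldType.

(* The pairing between the fullv-weight space of Delta (x) k and St^k. *)
Definition st_pairing (x : path_alg F n.+1 k) (y : grp_alg k) : k :=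
  xget 0 [set c : k | exists v z,
    [/\ full_flags F n.+1 k v, eqS x v, flag_iso y z & c = pdot v z]].

Definition annihilator (I : set (grp_alg k)) : set (path_alg F n.+1 k) :=
  [set x | weight_space fullv (Delta F n.+1 k) x /\
     forall y, I y -> st_pairing x y = 0].

End Steinberg.

Arguments gow_fil F n ell k i : clear implicits.

(* Main.v *)
(* Paths act on functions on flags: a flag times a path is, by the wedge
   relations, an integer times a single flag (dstep).  The functions whose sums
   over panels vanish (stein) form a right module over S; evaluating it shows
   that the relations impose nothing more than (FS) on flags, and gives the
   Jantzen form in closed form: tau s t.  On the other hand every full flag is
   a combination of the flags opposite to the standard one, and these are dual,
   up to a sign, to the basis u e of the Steinberg module seen inside
   functions on flags.

   In the dual bases so obtained Gow's form is the restriction of the standard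
   form, since both count the w with w u w^-1 in B.  Summing tau against a
   function phi with vanishing panel sums multiplies phi by [n]_q! = |G/B|.
   Hence the Gram matrices A of Gow's form and D of the Jantzen form satisfy
   A D = |G/B|, and the Smith normal form of A turns this into the duality of
   the two filtrations. *)
From HB Require Import structures.
From mathcomp Require Import all_boot all_order all_algebra all_fingroup.
From mathcomp Require Import finmap.
From mathcomp Require Import boolp classical_sets.
From mathcomp.multinomials Require Import monalg.
From mathcomp Require Import zify.
Require Import Defs.

Set Implicit Arguments.
Unset Strict Implicit.
Unset Printing Implicit Defensive.

Import GRing.Theory.
Local Open Scope ring_scope.

#[local] Arguments head : simpl nomatch.

(** The Jantzen form is the integer c for which a product equals c times the idempotent (0) modulo
    an ideal given by generators. The wedge relations show that such a c exists, but not that it is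
    unique: for that, S has to act on something on which the integer multiples of (0) stay distinct.
    Functions with vanishing panel sums provide this without any quotient: they are cut out of a
    function space, and it only remains to check that each relator acts by zero. The factor [n]_q!
    is built up one dimension at a time: going down to a hyperplane of W and back up, summed over
    all hyperplanes, multiplies by 1 + q + ... + q^(dim W - 1), and these factors multiply along a
    flag. The shift kappa + 1 - i comes from diagonalising: in Smith bases A and D are diagonal, and
    the valuations of corresponding entries add up to kappa. Modulo ell, I(i) is spanned by the
    directions where the entry of A has valuation at least i. Its annihilator is spanned by the dual
    directions where that valuation is at most i - 1, that is, where the entry of D has valuation at
    least kappa + 1 - i. *)

Lemma mcoeff_sum (G : zmodType) (K : choiceType) I (r : seq I) (P : pred I)
    (f : I -> {malg G[K]}) k :
  (\sum_(i <- r | P i) f i)@_k = \sum_(i <- r | P i) (f i)@_k.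
Proof. exact: (raddf_sum (mcoeff k)). Qed.

(** * Linear maps out of free modules, and spans *)

Section LinearExtension.
Variables (R : comNzRingType) (K : choiceType).
Implicit Types (x y : {malg R[K]}).

Definition lext (V : lmodType R) (f : K -> V) x : V :=
  \sum_(p <- msupp x) x@_p *: f p.

Lemma lextEw (V : lmodType R) (f : K -> V) x (d : {fset K}) :
  (msupp x `<=` d)%fset -> lext f x = \sum_(p <- d) x@_p *: f p.
Proof.
move=> le; rewrite /lext (big_fset_incl _ le) // => p _ Np.
by rewrite mcoeff_outdom // scale0r.
Qed.

Lemma lext_is_linear (V : lmodType R) (f : K -> V) : linear (lext f).
Proof.
move=> a x y; set d := (msupp x `|` msupp y)%fset.
have le : (msupp (a *: x + y) `<=` d)%fset.
  apply: (fsubset_trans (msuppD_le _ _)).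
  by rewrite fsetSU // msuppZ_le.
rewrite (lextEw _ le) (@lextEw _ _ x d) ?fsubsetUl //.
rewrite (@lextEw _ _ y d) ?fsubsetUr // scaler_sumr -big_split /=.
by apply: eq_bigr => p _; rewrite mcoeffD mcoeffZ scalerDl scalerA.
Qed.

HB.instance Definition _ (V : lmodType R) (f : K -> V) :=
  GRing.isLinear.Build R {malg R[K]} V *:%R (lext f) (lext_is_linear f).

Lemma lextU (V : lmodType R) (f : K -> V) p : lext f << p >> = f p.
Proof.
rewrite (@lextEw _ _ _ [fset p]%fset) ?msuppU_le //.
by rewrite big_seq_fset1 mcoeffUU scale1r.
Qed.

Lemma eq_lext (V : lmodType R) (f g : K -> V) : f =1 g -> lext f =1 lext g.
Proof. by move=> fg x; apply: eq_bigr => p _; rewrite fg. Qed.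

Lemma lext_id x : lext (fun p => << p >>) x = x.
Proof.
rewrite [RHS]monalgE; apply: eq_bigr => p _; apply/malgP => r.
by rewrite mcoeffZ !mcoeffU mulr_natr.
Qed.

Lemma malg_ind (P : {malg R[K]} -> Prop) :
  P 0 -> (forall a x y, P x -> P y -> P (a *: x + y)) ->
  (forall p, P << p >>) -> forall x, P x.
Proof.
move=> P0 PD PU x; rewrite -[x]lext_id /lext.
elim: (enum_fset _) => [|p s IH]; rewrite ?big_nil ?big_cons //.
exact: PD.
Qed.

End LinearExtension.

Section Span.
Variables (R : nzRingType) (V : lmodType R).

Lemma lspan_linear (A : set V) a (x y : V) : lspan A x -> lspan A y ->
  lspan A (a *: x + y).
Proof.
move=> [m [c [f [Af ->]]]] [m' [c' [f' [Af' ->]]]].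
exists (m + m')%N, (fun i => match split i with inl j => a * c j | inr j =>
  c' j end),
  (fun i => match split i with inl j => f j | inr j => f' j end); split.
  by move=> i; case: split.
rewrite big_split_ord /= scaler_sumr; congr (_ + _); apply: eq_bigr => i _.
  by rewrite (unsplitK (inl i)) scalerA.
by rewrite (unsplitK (inr i)).
Qed.

Lemma lspan0 (A : set V) : lspan A 0.
Proof.
exists 0%N, (fun=> 0), (fun=> 0); split; first by case.
by rewrite big_ord0.
Qed.

Lemma lspan_gen (A : set V) (x : V) : A x -> lspan A x.
Proof.
move=> Ax; exists 1%N, (fun=> 1), (fun=> x); split=> //.
by rewrite big_ord1 scale1r.
Qed.

Lemma lspan_ind (A : set V) (Q : V -> Prop) : Q 0 ->
  (forall a x y, Q x -> Q y -> Q (a *: x + y)) ->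
  (forall x, A x -> Q x) -> forall x, lspan A x -> Q x.
Proof.
move=> Q0 QD QA x [m [c [f [Af ->]]]].
by elim/big_rec: _ => [//|i y _ Qy]; apply: QD => //; apply: QA.
Qed.

End Span.

(** * Intervals in the lattice of subspaces *)

Section Covers.
Variables (F : finFieldType) (n : nat).
Local Notation subsp := {vspace 'cV[F]_n}.
Local Notation q := #|F|.
Implicit Types (U V W X Y : subsp).

Lemma dim_fullv : \dim (fullv : subsp) = n.
Proof. by rewrite dimvf; apply: muln1. Qed.

Lemma coversP V W : reflect ((V <= W)%VS /\ \dim W = (\dim V).+1) (covers V W).
Proof. by apply: (iffP andP) => -[? /eqP]. Qed.

Lemma covers_sub V W : covers V W -> (V <= W)%VS.
Proof. by case/andP. Qed.

Lemma covers_dim V W : covers V W -> \dim W = (\dim V).+1.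
Proof. by case/andP => _ /eqP. Qed.

Lemma covers0 V : covers V 0%VS = false.
Proof. by apply/coversP => -[_]; rewrite dimv0. Qed.

Lemma covers_asym V W : covers V W -> covers W V -> False.
Proof. move=> /covers_dim d1 /covers_dim; lia. Qed.

Lemma covers_eq U V W : covers V W -> (V <= U)%VS -> (U <= W)%VS ->
  U = V \/ U = W.
Proof.
move=> c VU UW; have := dimvS VU; have := dimvS UW; rewrite (covers_dim c).
case: (ltngtP (\dim V) (\dim U)) => [lt le _|//|e _ _].
  by right; apply/eqP; rewrite eqEdim UW (covers_dim c).
by left; apply/esym/eqP; rewrite eqEdim VU e /=.
Qed.

Lemma covers_eq_sub V V' W : covers V W -> covers V' W -> (V' <= V)%VS ->
  V' = V.
Proof.
move=> /covers_dim d /covers_dim d' s; apply/eqP; rewrite eqEdim s /=; lia.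
Qed.

Lemma covers_addv V W U : covers V W -> (U <= W)%VS -> ~~ (U <= V)%VS ->
  (V + U)%VS = W.
Proof.
move=> c UW NU; have VW := covers_sub c.
have s : (V + U <= W)%VS by rewrite subv_add VW.
case: (covers_eq c (addvSl V U) s) => // e.
by case/negP: NU; rewrite -e addvSr.
Qed.

Lemma covers_cap V W U : covers V W -> (U <= W)%VS -> ~~ (U <= V)%VS ->
  covers (V :&: U)%VS U.
Proof.
move=> c UW NU; apply/coversP; split; first exact: capvSr.
have := dimv_sum_cap V U; rewrite (covers_addv c) // (covers_dim c); lia.
Qed.

Lemma covers_cap_neq V V' W : covers V W -> covers V' W -> V != V' ->
  covers (V :&: V')%VS V'.
Proof.
move=> c c' ne; apply: (covers_cap c (covers_sub c')).
by apply: contra ne => s; rewrite (covers_eq_sub c c' s).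
Qed.

Definition between V W X := covers V X && covers X W.

Lemma between_sub V W X : between V W X ->
  (V <= W)%VS /\ \dim W = (\dim V).+2.
Proof.
case/andP => /coversP[s d] /coversP[s' d']; split; last by rewrite d' d.
exact: subv_trans s'.
Qed.

Lemma betweenE V W X : \dim W = (\dim V).+2 ->
  between V W X = [&& (V <= X)%VS, (X <= W)%VS & \dim X == (\dim V).+1].
Proof.
move=> d; rewrite /between /covers d eqSS.
by case: (eqVneq (\dim X) (\dim V).+1) => _; rewrite ?eqxx ?andbT ?andbF.
Qed.

(* Projection along the hyperplane V: the interval from U to W is carried to
   the interval from V /\ U to V, with inverse Y |-> Y + U. *)
Lemma sum_between_cap (A : nmodType) V W U (f : subsp -> A) :
  covers V W -> (U <= W)%VS -> \dim W = (\dim U).+2 -> ~~ (U <= V)%VS ->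
  \sum_(X | between U W X) f (V :&: X)%VS =
  \sum_(Y | between (V :&: U) V Y) f Y.
Proof.
move=> c UW d NU; have cU := covers_cap c UW NU.
have dV : \dim V = (\dim (V :&: U)%VS).+2.
  by have := covers_dim c; have := covers_dim cU; lia.
rewrite [RHS](reindex_onto (fun X => V :&: X)%VS (fun Y => Y + U)%VS) /=.
  apply: eq_bigl => X; rewrite !betweenE //.
  apply/idP/idP.
    case/and3P => UX XW /eqP dX; rewrite capvS //= capvSl /=.
    have NX : ~~ (X <= V)%VS by apply: contra NU; apply: subv_trans.
    have cX := covers_cap c XW NX.
    have dVX : \dim (V :&: X)%VS = (\dim (V :&: U)%VS).+1.
      by have := covers_dim cX; have := covers_dim cU; lia.
    rewrite dVX eqxx /= eqEdim subv_add capvSr UX /=.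
    have /dimvS := addvSl (V :&: X)%VS U.
    rewrite leq_eqVlt => /orP[/eqP e|]; last by have := covers_dim cU; lia.
    case/negP: NU; have : (V :&: X)%VS == (V :&: X + U)%VS.
      by rewrite eqEdim addvSl -e /=.
    by move/eqP => e'; apply: (subv_trans (addvSr (V :&: X)%VS U));
      rewrite -e' capvSl.
  case/andP => /and3P[s1 _ /eqP dVX] /eqP e.
  have UX : (U <= X)%VS by rewrite -e addvSr.
  have XW : (X <= W)%VS.
    by rewrite -e subv_add UW (subv_trans (capvSl _ _) (covers_sub c)).
  have NX : ~~ (X <= V)%VS by apply: contra NU; apply: subv_trans.
  have cX := covers_cap c XW NX.
  by rewrite UX XW (covers_dim cX) dVX (covers_dim cU) eqxx.
move=> Y; rewrite betweenE // => /and3P[s1 s2 /eqP dY].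
apply/esym/eqP; rewrite eqEdim subv_cap s2 addvSl /=.
have NX : ~~ (Y + U <= V)%VS by apply: contra NU;
  apply: subv_trans (addvSr _ _).
have XW : (Y + U <= W)%VS by rewrite subv_add UW (subv_trans s2 (covers_sub c)).
have /covers_dim := covers_cap c XW NX.
have := dimv_sum_cap Y U; have : (\dim (V :&: U) <= \dim (Y :&: U))%N.
  by apply: dimvS; rewrite subv_cap s1 capvSr.
have := covers_dim cU; lia.
Qed.

Lemma covers_line V (a : 'cV[F]_n) : a \notin V -> covers V (V + <[a]>)%VS.
Proof.
move=> Na; apply/coversP; split; first exact: addvSl.
have a0 : a != 0 by apply: contraNneq Na => ->; rewrite mem0v.
have := dimv_sum_cap V <[a]>; rewrite dim_vline a0.
have /dimvS := capvSr V <[a]>%VS; rewrite dim_vline a0.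
case: (posnP (\dim (V :&: <[a]>))) => [->|gt]; first by lia.
move=> le; have : (V :&: <[a]>)%VS == <[a]>%VS.
  by rewrite eqEdim capvSr dim_vline a0.
move/eqP => e; case/negP: Na; rewrite memvE -e; exact: capvSl.
Qed.

Lemma exists_notin V W : (V <= W)%VS -> (\dim V < \dim W)%N ->
  exists2 a, a \in W & a \notin V.
Proof.
move=> VW lt; have : ~~ (W <= V)%VS.
  by apply/negP => /dimvS; rewrite leqNgt lt.
by case/subvPn => a aW aV; exists a.
Qed.

Lemma covers_lineE V W a : covers V W -> a \in W -> a \notin V ->
  W = (V + <[a]>)%VS.
Proof.
by move=> c aW aV; rewrite (covers_addv c) -?memvE.
Qed.

(** The interval consists of the q + 1 lines of the plane W / V. With X0 = V + <a> removed and b in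
    W outside X0, the remaining ones are V + <b + c a> for c in the field. This count is the source
    of every factor q in the cancellations below. *)
Lemma card_between V W X0 : between V W X0 ->
  #|[pred X | between V W X && (X != X0)]| = q.
Proof.
move=> b0; have [VW dW] := between_sub b0; case/andP: (b0) => c1 c2.
have [a aX0 aV] : exists2 a, a \in X0 & a \notin V.
  by apply: exists_notin; rewrite ?(covers_sub c1) // (covers_dim c1).
have [b bW bX0] : exists2 b, b \in W & b \notin X0.
  by apply: exists_notin; rewrite ?(covers_sub c2) // (covers_dim c2).
have aW : a \in W by apply: subvP aX0; exact: covers_sub.
have VX0 := covers_sub c1; have EX0 := covers_lineE c1 aX0 aV.
have Nba c : b + c *: a \notin X0.
  by rewrite rpredDr // rpredZ.
pose g c := (V + <[b + c *: a]>)%VS.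
have NV c : b + c *: a \notin V.
  by apply: contra (Nba c); apply: (subvP VX0).
have gb c : between V W (g c).
  rewrite betweenE // addvSl subv_add VW -memvE rpredD ?rpredZ //=.
  by rewrite (covers_dim (covers_line (NV c))).
have gX0 c : g c != X0.
  apply: contraNneq (Nba c) => <-; apply: (subvP (addvSr _ _)).
  exact: memv_line.
have ginj : injective g.
  move=> c c' e; apply/eqP; rewrite -subr_eq0.
  have mc d : b + d *: a \in g d by apply: (subvP (addvSr V _));
    exact: memv_line.
  have : (c - c') *: a \in g c.
    have -> : (c - c') *: a = (b + c *: a) - (b + c' *: a).
      by rewrite scalerBl opprD addrACA subrr add0r.
    by rewrite rpredB ?mc // e mc.
  apply: contraTT => nz; rewrite rpredZeq (negbTE nz) /=.
  apply: contra (gX0 c) => ag; have : (X0 <= g c)%VS.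
    by rewrite EX0 subv_add addvSl -memvE.
  case/andP: (gb c) => c3 _.
  by move=> s; rewrite eq_sym eqEdim s (covers_dim c3) (covers_dim c1) /=.
rewrite -(card_codom ginj); apply: eq_card => X; rewrite [LHS]inE.
apply/idP/codomP => [/andP[bX XX0]|[c ->]]; last by rewrite gb gX0.
case/andP: bX => c3 c4.
have [x xX xV] : exists2 x, x \in X & x \notin V.
  by apply: exists_notin; rewrite ?(covers_sub c3) // (covers_dim c3).
have xX0 : x \notin X0.
  apply: contra XX0 => xX0.
  by rewrite (covers_lineE c3 xX xV) [X in _ == X](covers_lineE c1 xX0 xV).
have : x \in W by apply: (subvP (covers_sub c4)).
rewrite (covers_lineE c2 bW bX0) => /memv_addP[y yX0 [z /vlineP[t ->] ex]].
move: yX0; rewrite EX0 => /memv_addP[v vV [z' /vlineP[s es] ey]].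
have t0 : t != 0.
  apply: contraNneq xX0 => t0; rewrite ex t0 scale0r addr0 EX0 ey es.
  by apply: memv_add => //; apply/vlineP; exists s.
exists (t^-1 * s); rewrite /g.
apply/eqP; rewrite eq_sym eqEdim subv_add (covers_sub c3) -memvE.
rewrite (covers_dim c3) (covers_dim (covers_line (NV _))) leqnn andbT /=.
have -> : b + (t^-1 * s) *: a = t^-1 *: (x - v).
  rewrite ex ey es -[v + _ + _]addrA [v + _]addrC addrK scalerDr !scalerA.
  by rewrite mulVf // scale1r addrC.
by rewrite rpredZ // rpredB // (subvP (covers_sub c3)).
Qed.

End Covers.

(** * Functions on flags with vanishing panel sums *)

Section Descent.
Variables (F : finFieldType) (n : nat).
Local Notation subsp := {vspace 'cV[F]_n}.
Local Notation q := #|F|.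
Implicit Types (U V W X Y : subsp) (s t : seq subsp).

Lemma flag_cons W t : is_flag (W :: t) =
  (if t is V :: _ then covers V W && is_flag t else W == 0%VS).
Proof. by case: t => [|V t]; rewrite /is_flag //= -andbA. Qed.

Lemma flag_cons2 W V t :
  is_flag [:: W, V & t] = covers V W && is_flag (V :: t).
Proof. by rewrite flag_cons. Qed.

(* The product (V, W) * t in the standard module, for a flag t of W covering V:
   unwinding the wedge relations it is an integer times a single flag of V,
   obtained by intersecting t with V. *)
Fixpoint dstep V t : int * seq subsp :=
  match t with
  | _ :: ((W' :: _) as t') =>
    if W' == V then ((q ^ \dim V)%:Z, t')
    else let r := dstep (V :&: W')%VS t' in (- r.1, V :: r.2)
  | _ => (0, [::])
  end.

Arguments dstep : simpl never.

Lemma dstepE V W W' t : dstep V [:: W, W' & t] =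
  if W' == V then ((q ^ \dim V)%:Z, W' :: t)
  else (- (dstep (V :&: W')%VS (W' :: t)).1,
        V :: (dstep (V :&: W')%VS (W' :: t)).2).
Proof. by []. Qed.

Lemma dstep_flag V t : is_flag t -> covers V (head 0%VS t) ->
  is_flag (dstep V t).2 /\ head 0%VS (dstep V t).2 = V.
Proof.
elim: t V => [//|W [|W' t] IH] V.
  by rewrite flag_cons => /eqP -> /=; rewrite covers0.
rewrite flag_cons2 dstepE => /andP[cW' fl] /= cV.
case: eqVneq => [<- //|ne] /=; rewrite eq_sym in ne.
have c1 := covers_cap_neq cV cW' ne.
have c2 : covers (V :&: W')%VS V.
  by rewrite capvC; apply: (covers_cap_neq cW' cV); rewrite eq_sym.
have [fr hr] := IH _ fl c1; split=> //.
by case: (dstep _ _).2 fr hr => // U u fu /= hU; rewrite flag_cons2 fu hU c2.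
Qed.

End Descent.
Arguments dstep : simpl never.

Section Steinberg.
Variables (F : finFieldType) (n : nat) (R : comNzRingType).
Local Notation subsp := {vspace 'cV[F]_n}.
Local Notation q := #|F|.
Implicit Types (U V W X Y : subsp) (s t : seq subsp) (phi psi : seq subsp -> R).

(* The dual of the V-weight space of the standard module: functions on the
   flags of V that vanish on the relations (FS). *)
Inductive stein : subsp -> (seq subsp -> R) -> Prop :=
| Stein V phi :
    (forall U s, is_flag (U :: s) -> (U <= V)%VS -> \dim V = (\dim U).+2 ->
       \sum_(X | between U V X) phi [:: V, X, U & s] = 0) ->
    (forall V', covers V' V -> stein V' (fun t => phi (V :: t))) ->
    stein V phi.

Lemma stein_panel V phi U s : stein V phi -> is_flag (U :: s) -> (U <= V)%VS ->
  \dim V = (\dim U).+2 -> \sum_(X | between U V X) phi [:: V, X, U & s] = 0.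
Proof. by case=> {}V {}phi H _; apply: H. Qed.

Lemma stein_cons V phi V' : stein V phi -> covers V' V ->
  stein V' (fun t => phi (V :: t)).
Proof. by case=> {}V {}phi _ H; apply: H. Qed.

Lemma stein_ext V phi psi : (forall t, is_flag t -> head 0%VS t = V ->
  phi t = psi t) -> stein V phi -> stein V psi.
Proof.
move=> e st; elim: st psi e => {}V {}phi H1 H2 IH psi e; constructor.
  move=> U s fl UV d; rewrite -[RHS](H1 U s) //; apply: eq_bigr => X bX.
  by apply/esym/e => //; case/andP: bX => c1 c2; rewrite !flag_cons2 c1 c2.
move=> V' c; apply: (IH _ c) => -[//|W t] fl /= h; apply: e => //.
by rewrite flag_cons2 h c -h.
Qed.

Lemma stein_linear V a phi psi : stein V phi -> stein V psi ->
  stein V (fun t => a * phi t + psi t).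
Proof.
move=> st; elim: st psi => {}V {}phi H1 H2 IH psi st'; constructor.
  move=> U s fl UV d; rewrite big_split -mulr_sumr /= H1 // mulr0 add0r.
  exact: (stein_panel st').
by move=> V' c; apply: (IH _ c); apply: stein_cons c.
Qed.

Lemma stein0 V : stein V (fun=> 0).
Proof.
elim: {V}(\dim V) {-2}V (leqnn (\dim V)) => [|d IH] V le; constructor.
- by move=> *; rewrite big1.
- by move=> V' /covers_dim; lia.
- by move=> *; rewrite big1.
- by move=> V' /covers_dim e; apply: IH; lia.
Qed.

Lemma steinZ V a phi : stein V phi -> stein V (fun t => a * phi t).
Proof.
move=> st; apply: stein_ext (stein_linear a st (stein0 V)) => t _ _.
by rewrite addr0.
Qed.

Lemma stein_sum V I (r : seq I) (P : pred I) (phi : I -> seq subsp -> R) :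
  (forall i, P i -> stein V (phi i)) ->
  stein V (fun t => \sum_(i <- r | P i) phi i t).
Proof.
move=> H; elim: r => [|i r IH].
  by apply: stein_ext (stein0 V) => t _ _; rewrite big_nil.
case Pi: (P i); last first.
  by apply: stein_ext IH => t _ _; rewrite big_cons Pi.
apply: stein_ext (stein_linear 1 (H _ Pi) IH) => t _ _.
by rewrite big_cons Pi mul1r.
Qed.

(** The transpose of left multiplication by the ascent (V, W), where W is the head of t: a function
    on flags of V becomes one on flags of W. *)
Definition up V phi t : R := (dstep V t).1%:~R * phi (dstep V t).2.

Lemma upE V phi W W' t : up V phi [:: W, W' & t] =
  if W' == V then (q ^ \dim V)%:R * phi (V :: t)
  else - up (V :&: W')%VS (fun u => phi (V :: u)) (W' :: t).
Proof.
rewrite /up dstepE; case: eqVneq => [->|_] //=.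
by rewrite mulrNz mulNr.
Qed.

Lemma eq_up V phi psi t : is_flag t -> covers V (head 0%VS t) ->
  (forall u, is_flag u -> head 0%VS u = V -> phi u = psi u) ->
  up V phi t = up V psi t.
Proof. by move=> fl c e; have [? ?] := dstep_flag fl c; rewrite /up e. Qed.

Lemma up_sum V I (r : seq I) (P : pred I) (phi : I -> seq subsp -> R) t :
  \sum_(i <- r | P i) up V (phi i) t =
  up V (fun u => \sum_(i <- r | P i) phi i u) t.
Proof. by rewrite /up mulr_sumr. Qed.

Lemma upN V phi t : up V (fun u => - phi u) t = - up V phi t.
Proof. by rewrite /up mulrN. Qed.

Lemma upZ V a phi t : up V (fun u => a * phi u) t = a * up V phi t.
Proof. by rewrite /up mulrCA. Qed.

Lemma cap_between U V W X : \dim W = (\dim U).+2 -> between U W V ->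
  between U W X -> X != V -> (V :&: X)%VS = U.
Proof.
move=> d /andP[c1 c2] /andP[c3 c4] ne.
have c := covers_cap_neq c2 c4 (_ : V != X); rewrite eq_sym in ne.
apply/esym/eqP; rewrite eqEdim subv_cap (covers_sub c1) (covers_sub c3) /=.
by have := covers_dim (c ne); have := covers_dim c3; lia.
Qed.

Lemma dim_covers2 V W U : covers V W -> \dim W = (\dim U).+2 -> (U <= V)%VS ->
  between U W V.
Proof.
by move=> c d s; rewrite betweenE // s (covers_sub c) /=;
  have := covers_dim c; lia.
Qed.

(** This is the dual form of the fact that multiplying flags by an ascent is compatible with (FS).
    Restricting to a hyperplane W' of W gives a multiple of phi if W' = V, and otherwise a raise
    from V /\ W' to W', which the induction covers. *)
Lemma stein_up V W phi : stein V phi -> covers V W -> stein W (up V phi).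
Proof.
move=> st; elim: st W => {}V {}phi H1 H2 IH W c; constructor; last first.
  move=> W' c'; case: (eqVneq W' V) => [->|ne].
    apply: (@stein_ext _ (fun t => (q ^ \dim V)%:R * phi t)).
      by move=> [//|U t] fl /= ->; rewrite upE eqxx.
    by apply: steinZ; constructor.
  have c1 : covers (V :&: W')%VS W'.
    by apply: covers_cap_neq c c' _; rewrite eq_sym.
  have c2 : covers (V :&: W')%VS V by rewrite capvC;
    apply: covers_cap_neq c' c _.
  apply: stein_ext (steinZ (-1) (IH _ c2 _ c1)) => -[//|U t] fl /= hU.
  by rewrite upE hU (negbTE ne) mulN1r.
(* If U lies in V, then V belongs to the panel. Its term has the factor q^(dim V), and the q other
   members meet V in U and contribute -q^(dim U) each, so the sum cancels. Otherwise two wedge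
   steps, whose signs cancel, turn the term of X into a fixed multiple of phi at a flag through V
   and V /\ X, and these spaces run over a panel below V. *)
move=> U s fl UW d; have [UV|NU] := boolP (U <= V)%VS.
  have bV := dim_covers2 c d UV.
  rewrite (bigD1 V) //= upE eqxx.
  rewrite (eq_bigr (fun=> - ((q ^ \dim U)%:R * phi [:: V, U & s]))); last first.
    move=> X /andP[bX ne]; rewrite upE (negbTE ne) upE.
    by rewrite (cap_between d bV bX ne) eqxx.
  rewrite sumr_const card_between // mulNrn; apply/eqP; rewrite subr_eq0.
  case/andP: bV => /covers_dim -> _.
  by rewrite expnS natrM -(mulr_natl (_ * _)) mulrA.
have cU := covers_cap c UW NU.
set r := dstep (V :&: U)%VS (U :: s).
have fr : is_flag r.2 /\ head 0%VS r.2 = (V :&: U)%VS by apply: dstep_flag.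
pose f Y := r.1%:~R * phi [:: V, Y & r.2].
transitivity (\sum_(X | between U W X) f (V :&: X)%VS).
  apply: eq_bigr => X bX; case/andP: (bX) => c1 c2.
  have NX : X != V by apply: contraNneq NU => <-; apply: covers_sub.
  have NX' : ~~ (X <= V)%VS.
    by apply: contra NU; apply: subv_trans; apply: covers_sub.
  have NVX : U != (V :&: X)%VS by apply: contraNneq NU => ->; apply: capvSl.
  rewrite upE (negbTE NX) upE (negbTE NVX) opprK.
  by rewrite -capvA (capv_idPr (covers_sub c1)).
rewrite (sum_between_cap f c UW d NU) -mulr_sumr.
case: r.2 fr => [[]//|Z z [fz /= eZ]].
rewrite -eZ H1 ?mulr0 ?eZ ?capvSl // -?eZ //.
by rewrite eZ; have := covers_dim c; have := covers_dim cU; lia.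
Qed.

(** The dichotomy is that of [stein_up], now relative to the second entry W' of t. If V lies in W',
    the term of W' has the factor q^(dim W') and balances the q other members, with factor q^(dim V)
    each. Otherwise intersecting with W' carries the sum to a sum of the same kind one place further
    down t, whence the induction on t with V, W and phi general. *)
Lemma up_up V W phi t : stein V phi -> (V <= W)%VS -> \dim W = (\dim V).+2 ->
  is_flag t -> head 0%VS t = W ->
  \sum_(X | between V W X) up X (up V phi) t = 0.
Proof.
elim: t V W phi => [//|W0 [|W' t] IH] V W phi st VW d.
  by rewrite flag_cons => /eqP -> /= e; rewrite -e dimv0 in d.
rewrite flag_cons2 => /andP[c fl] /= e; subst W0.
have [VW'|NV] := boolP (V <= W')%VS.
  have bW' := dim_covers2 c d VW'; case/andP: (bW') => cV _.
  rewrite (bigD1 W') //= upE eqxx.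
  rewrite (eq_bigr (fun=> - ((q ^ \dim V)%:R * up V phi (W' :: t))));
    last first.
    move=> X /andP[bX ne]; rewrite upE eq_sym (negbTE ne).
    rewrite capvC (cap_between d bW' bX ne) -upZ; congr (- _).
    apply: eq_up => // -[//|Z z] _ /= ->.
    by rewrite upE eqxx.
  rewrite sumr_const card_between // mulNrn; apply/eqP; rewrite subr_eq0.
  by rewrite (covers_dim cV) expnS natrM -(mulr_natl (_ * _)) mulrA.
have c1 := covers_cap c VW NV.
pose f Y := up Y (up (W' :&: V)%VS (fun u => phi (V :: u))) (W' :: t).
transitivity (\sum_(X | between V W X) f (W' :&: X)%VS).
  apply: eq_bigr => X bX; case/andP: (bX) => c2 c3.
  have NX : W' != X by apply: contraNneq NV => ->; apply: covers_sub.
  rewrite upE (negbTE NX) -upN capvC; apply: eq_up => //=.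
    by rewrite capvC; apply: (covers_cap_neq c3 c); rewrite eq_sym.
  case=> [//|Z z] _ /= ->.
  have NV' : (W' :&: X)%VS != V.
    by apply: contraNneq NV => <-; apply: capvSl.
  by rewrite upE (negbTE NV') opprK capvC -capvA (capv_idPr (covers_sub c2)).
rewrite (sum_between_cap f c VW d NV).
have dW : \dim W' = (\dim (W' :&: V)%VS).+2.
  by have := covers_dim c; have := covers_dim c1; lia.
rewrite /f; apply: (IH (W' :&: V)%VS W' (fun u => phi (V :: u))
  _ (capvSl _ _) dW fl _) => [|//].
exact: (stein_cons st c1).
Qed.

Definition qint m : nat := \sum_(i < m) q ^ i.

(** The hyperplane V = W' contributes q^(dim W') phi(t). The others are grouped by Y = V /\ W'.
    Within a group the vanishing panel sum replaces all V other than W' by minus the term of W', so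
    what remains is the same sum for W', equal to [dim W']_q phi(t) by induction. The total is
    [dim W]_q. *)
Lemma sum_up_cons W phi t : stein W phi -> is_flag t -> head 0%VS t = W ->
  \sum_(V | covers V W) up V (fun u => phi (W :: u)) t =
  (qint (\dim W))%:R * phi t.
Proof.
elim: t W phi => [//|W0 [|W' t] IH] W phi st.
  rewrite flag_cons => /eqP -> /= <-.
  by rewrite dimv0 /qint big_ord0 mul0r big1 // => V; rewrite covers0.
rewrite flag_cons2 => /andP[c fl] /= e; subst W0.
rewrite (bigD1 W') //= upE eqxx.
have -> : \sum_(V | covers V W && (V != W'))
    up V (fun u => phi (W :: u)) [:: W, W' & t]
  = \sum_(V | covers V W && (V != W'))
      - up (W' :&: V)%VS (fun u => phi [:: W, V & u]) (W' :: t).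
  by apply: eq_bigr => V /andP[cV ne]; rewrite upE eq_sym (negbTE ne) capvC.
rewrite (partition_big (fun V => W' :&: V)%VS (fun Y => covers Y W')) /=;
  last first.
  by move=> V /andP[cV ne]; rewrite capvC; apply: covers_cap_neq cV c ne.
have -> : \sum_(Y | covers Y W')
    \sum_(V | covers V W && (V != W') && ((W' :&: V)%VS == Y))
      - up (W' :&: V)%VS (fun u => phi [:: W, V & u]) (W' :: t) =
  \sum_(Y | covers Y W') up Y (fun u => phi [:: W, W' & u]) (W' :: t).
  apply: eq_bigr => Y cY.
  have d : \dim W = (\dim Y).+2 by rewrite (covers_dim c) (covers_dim cY).
  have bW' : between Y W W' by rewrite /between cY c.
  rewrite (eq_big (fun V => between Y W V && (V != W'))
     (fun V => up Y (fun u => - phi [:: W, V & u]) (W' :: t))); first last.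
  - by move=> V /andP[_ /eqP ->]; rewrite upN.
  - move=> V; rewrite [RHS]andbC andbAC andbC; case: eqVneq => //= ne.
    apply/idP/idP => [/andP[cV /eqP <-]|bV].
      apply/andP; split => //; apply: covers_cap_neq c cV _; by rewrite eq_sym.
    case/andP: (bV) => _ ->.
    by rewrite (cap_between d bW' bV ne) eqxx.
  rewrite up_sum; apply: eq_up => // -[//|Z z] fz /= eZ.
  rewrite eZ in fz *.
  have /eqP := stein_panel st fz (subv_trans (covers_sub cY) (covers_sub c)) d.
  rewrite (bigD1 W') //= addr_eq0 => /eqP ->.
  by rewrite sumrN.
have e := IH W' (fun u => phi (W :: u)) (stein_cons st c) fl erefl.
cbv beta in e; rewrite e {e}.
rewrite (covers_dim c) /qint big_ord_recr /= natrD mulrDl addrC.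
by rewrite -/(qint _).
Qed.

End Steinberg.

(** * The path algebra and its action on such functions *)

(* Sealed copies: unification must not unfold products of path algebra
   elements. *)
HB.lock Definition bp (F : finFieldType) (n : nat) (R : comNzRingType) s :=
  @bpath F n R s.
HB.lock Definition smul (F : finFieldType) (n : nat) (R : comNzRingType)
  (x y : path_alg F n R) := pmul x y.
HB.lock Definition srev (F : finFieldType) (n : nat) (R : comNzRingType)
  (x : path_alg F n R) := preverse x.

Section PathAlgebraTheory.
Variables (F : finFieldType) (n : nat) (R : comNzRingType).
Local Notation subsp := {vspace 'cV[F]_n}.
Local Notation q := #|F|.
Local Notation PA := (path_alg F n R).
Local Notation bp := (@bp F n R).
Implicit Types (U V W X Y : subsp) (s t : seq subsp) (x y z : PA).

Lemma bpathE s : bpath R s = bp s.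
Proof. by rewrite bp.unlock. Qed.

Lemma pmulE x y : pmul x y = smul x y.
Proof. by rewrite smul.unlock. Qed.

Lemma preverseE x : preverse x = srev x.
Proof. by rewrite srev.unlock. Qed.

Lemma bpE s (p : is_flag_path s) : bp s = << exist _ s p : flag_path F n >>.
Proof.
rewrite bp.unlock /bpath; case: insubP => [u _ e|]; last by rewrite p.
by congr (<< _ >>); apply: val_inj.
Qed.

Lemma bp_val (p : flag_path F n) : bp (val p) = << p >>.
Proof. by rewrite bp.unlock /bpath valK. Qed.

Lemma bp_junk s : ~~ is_flag_path s -> bp s = 0.
Proof. by move=> h; rewrite bp.unlock /bpath insubF //; apply: negbTE. Qed.

Lemma smulE x y : smul x y = lext (fun p => lext (concat R p) y) x.
Proof.
rewrite smul.unlock /pmul /lext; apply: eq_bigr => p _; rewrite scaler_sumr.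
by apply: eq_bigr => r _; rewrite scalerA.
Qed.

Lemma smul_is_linear x : linear (smul x).
Proof.
move=> a y z; rewrite !smulE /lext !scaler_sumr -big_split /=.
apply: eq_bigr => p _; rewrite -!/(lext _ _) linearP scalerDr !scalerA.
by rewrite mulrC.
Qed.
HB.instance Definition _ x :=
  GRing.isLinear.Build R PA PA *:%R (smul x) (smul_is_linear x).

Definition smulr y x := smul x y.

Lemma smulr_is_linear y : linear (smulr y).
Proof. by move=> a x z; rewrite /smulr !smulE linearP. Qed.
HB.instance Definition _ y :=
  GRing.isLinear.Build R PA PA *:%R (smulr y) (smulr_is_linear y).

Lemma srevE x : srev x = lext (fun p => bp (rev (val p))) x.
Proof. by rewrite srev.unlock bp.unlock. Qed.

Lemma srev_is_linear : linear (@srev F n R).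
Proof. by move=> a x y; rewrite !srevE linearP. Qed.
HB.instance Definition _ :=
  GRing.isLinear.Build R PA PA *:%R (@srev F n R) srev_is_linear.

Lemma smulPl a x y z : smul (a *: x + y) z = a *: smul x z + smul y z.
Proof. exact: (linearP (smulr z)). Qed.

Lemma smulPr a x y z : smul z (a *: x + y) = a *: smul z x + smul z y.
Proof. exact: (linearP (smul z)). Qed.

Lemma smul0l x : smul 0 x = 0.
Proof. exact: (linear0 (smulr x)). Qed.

Lemma smul0r x : smul x 0 = 0.
Proof. exact: (linear0 (smul x)). Qed.

Lemma smulZl a x y : smul (a *: x) y = a *: smul x y.
Proof. by rewrite -[a *: x]addr0 smulPl smul0l addr0. Qed.

Lemma smulZr a x y : smul y (a *: x) = a *: smul y x.
Proof. by rewrite -[a *: x]addr0 smulPr smul0r addr0. Qed.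

Lemma smulNl x y : smul (- x) y = - smul x y.
Proof. exact: (linearN (smulr y)). Qed.

Lemma smulBl x y z : smul (x - y) z = smul x z - smul y z.
Proof. exact: (linearB (smulr z)). Qed.

Lemma smulBr x y z : smul z (x - y) = smul z x - smul z y.
Proof. exact: (linearB (smul z)). Qed.

Lemma smul_suml I (r : seq I) (P : pred I) (f : I -> PA) x :
  smul (\sum_(i <- r | P i) f i) x = \sum_(i <- r | P i) smul (f i) x.
Proof. exact: (linear_sum (smulr x)). Qed.

Lemma smul_sumr I (r : seq I) (P : pred I) (f : I -> PA) x :
  smul x (\sum_(i <- r | P i) f i) = \sum_(i <- r | P i) smul x (f i).
Proof. exact: (linear_sum (smul x)). Qed.

Lemma srevP a x y : srev (a *: x + y) = a *: srev x + srev y.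
Proof. exact: (linearP (@srev F n R)). Qed.

Lemma srev0 : srev (0 : PA) = 0.
Proof. exact: (linear0 (@srev F n R)). Qed.

Lemma is_flag_path_rev s : is_flag_path (rev s) = is_flag_path s.
Proof.
rewrite /is_flag_path rev_sorted -size_eq0 size_rev size_eq0; congr (_ && _).
by apply: eq_sorted => V W; rewrite orbC.
Qed.

Lemma is_flag_path_cat V s t : is_flag_path (s ++ V :: t) =
  is_flag_path (rcons s V) && is_flag_path (V :: t).
Proof.
rewrite /is_flag_path; case: s => [|U s] //=.
by rewrite cat_path rcons_path /= andbA.
Qed.

Lemma bp_mul V s t : is_flag_path (rcons s V) -> is_flag_path (V :: t) ->
  smul (bp (rcons s V)) (bp (V :: t)) = bp (s ++ V :: t).
Proof.
move=> p1 p2; rewrite (bpE p1) (bpE p2) smulE !lextU /concat /=.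
by rewrite last_rcons eqxx /= cat_rcons bp.unlock.
Qed.

Lemma bp_mul0 s t : last 0%VS s != head 0%VS t ->
  smul (bp s) (bp t) = 0.
Proof.
move=> ne; case p1: (is_flag_path s); last first.
  by rewrite (@bp_junk s) ?p1 // smul0l.
case p2: (is_flag_path t); last by rewrite (@bp_junk t) ?p2 // smul0r.
by rewrite (bpE p1) (bpE p2) smulE !lextU /concat /= (negbTE ne).
Qed.

Lemma srev_bp s : srev (bp s) = bp (rev s).
Proof.
case p: (is_flag_path s); first by rewrite {1}(bpE p) srevE lextU.
by rewrite !bp_junk ?is_flag_path_rev ?p // linear0.
Qed.

Lemma srev_mul x y : srev (smul x y) = smul (srev y) (srev x).
Proof.
elim/malg_ind: x => [|a x x' IH IH'|p].
- by rewrite smul0l !srev0 smul0r.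
- by rewrite smulPl !srevP smulPr IH IH'.
elim/malg_ind: y => [|a y y' IH IH'|r].
- by rewrite smul0r !srev0 smul0l.
- by rewrite smulPr !srevP smulPl IH IH'.
rewrite -!bp_val !srev_bp.
case: (eqVneq (last 0%VS (val p)) (head 0%VS (val r))) => [e|ne]; last first.
  rewrite !bp_mul0 ?srev0 //.
  case: (val r) ne => [|V t]; case: (lastP (val p)) => [|s W];
    rewrite ?rev_cons ?rev_rcons ?last_rcons //= eq_sym //.
case: (lastP (val p)) (valP p) e => [//|s V] p1; rewrite last_rcons.
case: (val r) (valP r) => [//|W t] p2 /= e; rewrite -e in p2 *.
rewrite bp_mul // srev_bp rev_rcons rev_cons bp_mul.
- by rewrite rev_cat rev_cons cat_rcons.
- by rewrite -rev_cons is_flag_path_rev.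
- by rewrite -rev_rcons is_flag_path_rev.
Qed.

Lemma rel_up V W : (V <= W)%VS -> \dim W = (\dim V).+2 ->
  rel_ideal (\sum_(X | between V W X) bp [:: V; X; W]).
Proof. by move=> s d; rewrite bp.unlock; apply/RIgen/RelFSup. Qed.

Lemma rel_down V W : (V <= W)%VS -> \dim W = (\dim V).+2 ->
  rel_ideal (\sum_(X | between V W X) bp [:: W; X; V]).
Proof. by move=> s d; rewrite bp.unlock; apply/RIgen/RelFSdown. Qed.

Lemma rel_wedge_eq V W : covers V W ->
  rel_ideal (bp [:: V; W; V] - (q ^ \dim V)%:R *: bp [:: V]).
Proof. by move=> c; rewrite bp.unlock; apply/RIgen/RelWedgeEq. Qed.

Lemma rel_wedge_neq V W V' : covers V W -> covers V' W -> V != V' ->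
  rel_ideal (bp [:: V; W; V'] + bp [:: V; (V :&: V')%VS; V']).
Proof. by move=> c c' ne; rewrite bp.unlock; apply/RIgen/RelWedgeNeq. Qed.

Lemma rel_ideal_mull y x : rel_ideal x -> rel_ideal (smul y x).
Proof. by rewrite smul.unlock; apply: RIMl. Qed.

Lemma rel_ideal_mulr y x : rel_ideal x -> rel_ideal (smul x y).
Proof. by rewrite smul.unlock; apply: RIMr. Qed.

(** Reversal exchanges the two (FS) relations and preserves the shape of the wedge relations, so it
    descends to an anti-involution of S. The Jantzen form needs this to be well defined in the
    argument that is reversed. *)
Lemma srev_ideal x : rel_ideal x -> rel_ideal (srev x).
Proof.
elim=> {x} [x rx||x y _ IH _ IH'|a x _ IH|y x _ IH|y x _ IH].
- case: rx.
  + move=> V W VW d; rewrite -/(between V W) linear_sum /=.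
    rewrite (eq_bigr (fun X => bp [:: W; X; V])); first exact: rel_down.
    by move=> X _; rewrite bpathE srev_bp.
  + move=> V W VW d; rewrite -/(between V W) linear_sum /=.
    rewrite (eq_bigr (fun X => bp [:: V; X; W])); first exact: rel_up.
    by move=> X _; rewrite bpathE srev_bp.
  + move=> V W c; rewrite !bpathE linearB linearZ /= !srev_bp.
    exact: rel_wedge_eq.
  + move=> V W V' c c' ne.
    rewrite !bpathE linearD /= !srev_bp capvC.
    by apply: (rel_wedge_neq c' c); rewrite eq_sym.
- rewrite linear0; exact: RI0.
- rewrite linearD; exact: RID.
- rewrite linearZ; exact: RIZ.
- have := rel_ideal_mulr (srev y) IH; by rewrite -srev_mul pmulE.
- have := rel_ideal_mull (srev y) IH; by rewrite -srev_mul pmulE.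
Qed.

Lemma RIN x : rel_ideal x -> rel_ideal (- x).
Proof. by rewrite -scaleN1r; apply: RIZ. Qed.

Lemma eqS_refl x : eqS x x.
Proof. by rewrite /eqS subrr; apply: RI0. Qed.

Lemma eqS_sym x y : eqS x y -> eqS y x.
Proof. by rewrite /eqS => /RIN; rewrite opprB. Qed.

Lemma eqS_trans y x z : eqS x y -> eqS y z -> eqS x z.
Proof. by rewrite /eqS => h /(RID h); rewrite addrA subrK. Qed.

Lemma eqS_linear a x x' y y' : eqS x x' -> eqS y y' ->
  eqS (a *: x + y) (a *: x' + y').
Proof.
rewrite /eqS => h h'; rewrite opprD addrACA -scalerBr.
by apply: RID => //; apply: RIZ.
Qed.

Lemma eqSZ a x x' : eqS x x' -> eqS (a *: x) (a *: x').
Proof. by rewrite /eqS -scalerBr; apply: RIZ. Qed.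

Lemma eqSMl y x x' : eqS x x' -> eqS (smul y x) (smul y x').
Proof. by rewrite /eqS -smulBr; apply: rel_ideal_mull. Qed.

Lemma eqSMr y x x' : eqS x x' -> eqS (smul x y) (smul x' y).
Proof. by rewrite /eqS -smulBl; apply: rel_ideal_mulr. Qed.

Lemma eqS_rev x x' : eqS x x' -> eqS (srev x) (srev x').
Proof. by rewrite /eqS -linearB; apply: srev_ideal. Qed.

Lemma flag_is_path t : is_flag t -> is_flag_path t.
Proof.
case/and3P => t0 st _; rewrite /is_flag_path t0 /=.
by apply: sub_sorted st => V W c; rewrite c orbT.
Qed.

Lemma bp_panel s W U t : is_flag_path (rcons s W) -> is_flag_path (U :: t) ->
  (U <= W)%VS -> \dim W = (\dim U).+2 ->
  rel_ideal (\sum_(X | between U W X) bp (s ++ [:: W, X, U & t])).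
Proof.
move=> p1 p2 UW d; have h := rel_down UW d.
have := rel_ideal_mulr (bp (U :: t)) (rel_ideal_mull (bp (rcons s W)) h).
rewrite smul_sumr smul_suml.
congr rel_ideal; apply: eq_bigr => X /andP[c1 c2].
have p3 : is_flag_path [:: W; X; U].
  by rewrite /is_flag_path /= c1 c2 !orbT.
rewrite bp_mul //.
have -> : s ++ [:: W; X; U] = rcons (s ++ [:: W; X]) U by rewrite rcons_cat.
rewrite bp_mul //; first by rewrite -catA.
by rewrite rcons_cat is_flag_path_cat p1.
Qed.

(** Every step of [dstep] is one wedge relation: it pushes the ascent one place down the flag, until
    ascent and descent return to the same subspace and collapse to a power of q. Since the flag ends
    at 0, this happens at the latest there. *)
Lemma smul_dstep V t : is_flag t -> covers V (head 0%VS t) ->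
  eqS (bp (V :: t)) ((dstep V t).1%:~R *: bp (dstep V t).2).
Proof.
elim: t V => [//|W [|W' t] IH] V.
  by rewrite flag_cons => /eqP -> /=; rewrite covers0.
rewrite flag_cons2 dstepE => /andP[c fl] cV; rewrite /= in cV.
have pt := flag_is_path fl.
have p3 : is_flag_path [:: V; W; W'].
  by rewrite /is_flag_path /= cV c !orbT.
have -> : bp [:: V, W, W' & t] = smul (bp [:: V; W; W']) (bp (W' :: t)).
  by rewrite -[[:: V; W; W']]/(rcons [:: V; W] W') bp_mul.
case: eqVneq => [e|ne].
  subst W'; have p1 : is_flag_path [:: V] by [].
  rewrite /fst /snd -[X in _ *: X](@bp_mul V [::] t) //.
  rewrite -smulZl.
  by apply: eqSMr; exact: rel_wedge_eq.
have c1 : covers (V :&: W')%VS W'.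
  by apply: covers_cap_neq cV c _; rewrite eq_sym.
have c2 : covers (V :&: W')%VS V by rewrite capvC;
  apply: covers_cap_neq c cV ne.
rewrite eq_sym in ne.
have h : eqS (bp [:: V; W; W']) (- bp [:: V; (V :&: W')%VS; W']).
  by rewrite /eqS opprK; apply: rel_wedge_neq.
apply: (eqS_trans (eqSMr _ h)).
have [fr hr] := dstep_flag fl c1; have h' := IH _ fl c1.
move: (dstep (V :&: W')%VS (W' :: t)) fr hr h' => [d [|U u]] fr.
  by case: (notF fr).
rewrite /= in fr * => eU; subst U => h'.
have p4 : is_flag_path [:: V;
  (V :&: W')%VS] by rewrite /is_flag_path /= c2 orbT.
have p5 : is_flag_path [:: (V :&: W')%VS, W' & t].
  by rewrite /is_flag_path /= c1.
have p6 : is_flag_path [:: V; (V :&: W')%VS; W'].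
  by rewrite /is_flag_path /= c1 c2 orbT.
rewrite smulNl.
have -> : smul (bp [:: V; (V :&: W')%VS; W']) (bp (W' :: t)) =
          smul (bp [:: V; (V :&: W')%VS]) (bp [:: (V :&: W')%VS, W' & t]).
  rewrite -[[:: V; _; W']]/(rcons [:: V; _] W') bp_mul //.
  by rewrite -[[:: V; (V :&: W')%VS]]/(rcons [:: V] _) bp_mul.
rewrite -scaleN1r.
apply: (eqS_trans (eqSZ (-1) (eqSMl _ h'))).
rewrite smulZr scalerA -[[:: V; (V :&: W')%VS]]/(rcons [:: V] _).
rewrite bp_mul; [|exact: p4|exact: flag_is_path].
rewrite mulrNz mulN1r; exact: eqS_refl.
Qed.

End PathAlgebraTheory.

(** * Action of paths on flags and on functions of flags *)

Section Action.
Variables (F : finFieldType) (n : nat).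
Local Notation subsp := {vspace 'cV[F]_n}.
Local Notation q := #|F|.
Implicit Types (U V W X Y : subsp) (s t : seq subsp).

Definition lstep V (r : int * seq subsp) : int * seq subsp :=
  if covers (head 0%VS r.2) V then (r.1, V :: r.2)
  else (r.1 * (dstep V r.2).1, (dstep V r.2).2).

Fixpoint lact s t : int * seq subsp :=
  match s with
  | V :: ((_ :: _) as s') => lstep V (lact s' t)
  | _ => (1, t)
  end.

Arguments lact : simpl never.

Lemma lactE V W s t : lact [:: V, W & s] t = lstep V (lact (W :: s) t).
Proof. by []. Qed.

Lemma lact_flag s t : is_flag_path s -> is_flag t ->
  last 0%VS s = head 0%VS t ->
  is_flag (lact s t).2 /\ head 0%VS (lact s t).2 = head 0%VS s.
Proof.
elim: s => [//|V [|W s] IH]; first by move=> _ fl /= ->.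
rewrite lactE => /andP[_ /= /andP[/orP cVW ps]] fl e.
have [] := IH _ fl e; first by rewrite /is_flag_path.
case: (lact (W :: s) t) => c [//|U u] /= fu eU; subst U.
rewrite /lstep /=; case: ifP => cWV; first by rewrite flag_cons2 cWV fu.
by case: cVW => [cVW|]; [apply: dstep_flag|rewrite cWV].
Qed.

Lemma lstepM V a c u :
  lstep V (a * c, u) = (a * (lstep V (c, u)).1, (lstep V (c, u)).2).
Proof. by rewrite /lstep /=; case: ifP => _ //=; rewrite mulrA. Qed.

Lemma lact_cat s V r t : lact (s ++ V :: r) t =
  ((lact (V :: r) t).1 * (lact (rcons s V) (lact (V :: r) t).2).1,
   (lact (rcons s V) (lact (V :: r) t).2).2).
Proof.
elim: s => [|U [|W s] IH].
- by rewrite mulr1; case: (lact (V :: r) t).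
- rewrite [rcons _ _]/= [lact ([:: U] ++ _) t]lactE [lact [:: U; V] _]lactE.
  by rewrite -lstepM mulr1; case: (lact (V :: r) t).
by rewrite /= !lactE -lstepM -IH.
Qed.

End Action.

Definition pact (F : finFieldType) (n : nat) (R : comNzRingType)
    (phi : seq {vspace 'cV[F]_n} -> R) s t : R :=
  if last 0%VS s == head 0%VS t then (lact s t).1%:~R * phi (lact s t).2 else 0.

HB.lock Definition ract (F : finFieldType) (n : nat) (R : comNzRingType)
    (phi : seq {vspace 'cV[F]_n} -> R) (x : path_alg F n R) t : R :=
  lext (V := R^o) (fun p => pact phi (val p) t) x.

Section ActionTheory.
Variables (F : finFieldType) (n : nat) (R : comNzRingType).
Local Notation subsp := {vspace 'cV[F]_n}.
Local Notation PA := (path_alg F n R).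
Local Notation bp := (@bp F n R).
Implicit Types (U V W X Y : subsp) (s t : seq subsp).
Implicit Types (phi psi : seq subsp -> R) (x y : PA).

Lemma ractE phi x t : ract phi x t =
  lext (V := R^o) (fun p => pact phi (val p) t) x.
Proof. by rewrite ract.unlock. Qed.

Lemma ractP a phi x y t : ract phi (a *: x + y) t = a * ract phi x t + ract phi y t.
Proof. by rewrite !ractE linearP. Qed.

Lemma ract0 phi t : ract phi 0 t = 0.
Proof. by rewrite !ractE linear0. Qed.

Lemma ractZ a phi x t : ract phi (a *: x) t = a * ract phi x t.
Proof. by rewrite !ractE linearZ. Qed.

Lemma ractD phi x y t : ract phi (x + y) t = ract phi x t + ract phi y t.
Proof. by rewrite !ractE linearD. Qed.

Lemma ractB phi x y t : ract phi (x - y) t = ract phi x t - ract phi y t.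
Proof. by rewrite !ractE linearB. Qed.

Lemma ract_sum phi I (r : seq I) (P : pred I) (f : I -> PA) t :
  ract phi (\sum_(i <- r | P i) f i) t = \sum_(i <- r | P i) ract phi (f i) t.
Proof. by rewrite ractE linear_sum; apply: eq_bigr => i _; rewrite ractE. Qed.

Lemma ract_bp phi s t : is_flag_path s -> ract phi (bp s) t = pact phi s t.
Proof. by move=> p; rewrite (bpE R p) ractE lextU. Qed.

Lemma ract_linear_l a phi psi x t :
  ract (fun u => a * phi u + psi u) x t = a * ract phi x t + ract psi x t.
Proof.
elim/malg_ind: x => [|b x y IH IH'|p]; first by rewrite !ract0 mulr0 addr0.
  by rewrite !ractP IH IH' !mulrDr !mulrA !(mulrC a) addrACA.
rewrite -!bp_val !ract_bp ?(valP p) // /pact; case: ifP => _.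
  by rewrite mulrDr mulrCA.
by rewrite mulr0 addr0.
Qed.

Lemma ract0l x t : ract (fun=> 0) x t = 0.
Proof.
rewrite !ractE /lext big1 // => p _.
by rewrite /pact mulr0 if_same scaler0.
Qed.

Lemma eq_ract phi psi x t : is_flag t ->
  (forall u, is_flag u -> phi u = psi u) -> ract phi x t = ract psi x t.
Proof.
move=> fl e; rewrite !ractE; apply: (@eq_lext _ _ R^o) => p; rewrite /pact;
  case: eqP => // h.
by have [fu _] := lact_flag (valP p) fl h; rewrite e.
Qed.

Lemma ract_mul phi x y t : is_flag t ->
  ract phi (smul x y) t = ract (ract phi x) y t.
Proof.
move=> fl; elim/malg_ind: x => [|a x x' IH IH'|p].
- rewrite smul0l ract0 (@eq_ract _ (fun=> 0)) ?ract0l // => u _.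
  by rewrite ract0.
- rewrite smulPl ractP IH IH' -ract_linear_l.
  by apply: eq_ract => // u _; rewrite ractP.
elim/malg_ind: y => [|a y y' IH IH'|r].
- by rewrite smul0r !ract0.
- by rewrite smulPr !ractP IH IH'.
rewrite -!bp_val ract_bp ?(valP r) //.
case: (eqVneq (last 0%VS (val p)) (head 0%VS (val r))) => [e|ne]; last first.
  rewrite bp_mul0 // ract0 /pact; case: eqP => // h.
  have [fu hu] := lact_flag (valP r) fl h.
  by rewrite ract_bp ?(valP p) // /pact hu (negbTE ne) mulr0.
case: (lastP (val p)) (valP p) e => [//|s V] p1; rewrite last_rcons.
case: (val r) (valP r) => [//|W u] p2 /= e; rewrite -e in p2 *.
rewrite bp_mul // ract_bp ?is_flag_path_cat ?p1 // /pact last_cat /=.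
case: eqP => // h; have [fu hu] := lact_flag p2 fl h.
rewrite ract_bp // /pact last_rcons hu eqxx lact_cat /=.
by rewrite rmorphM mulrA.
Qed.

Lemma pact_id phi V t : head 0%VS t = V -> pact phi [:: V] t = phi t.
Proof. by move=> h; rewrite /pact h eqxx mul1r. Qed.

Lemma pact_up phi V W t : covers V W -> head 0%VS t = W ->
  pact phi [:: V; W] t = up V phi t.
Proof.
move=> c h; rewrite /pact h eqxx lactE /lstep h.
by case: ifP => [c'|_]; [case: (covers_asym c c')|rewrite mul1r].
Qed.

Lemma pact_down phi V W t : covers V W -> head 0%VS t = V ->
  pact phi [:: W; V] t = phi (W :: t).
Proof. by move=> c h; rewrite /pact h eqxx lactE /lstep h c mul1r. Qed.

Lemma pact_cat phi s V r t : is_flag_path (V :: r) -> is_flag t ->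
  pact phi (s ++ V :: r) t = pact (pact phi (rcons s V)) (V :: r) t.
Proof.
move=> p fl; rewrite [LHS]/pact [RHS]/pact last_cat /=.
case: eqP => [h|//]; have [fu hu] := lact_flag p fl h.
by rewrite /pact last_rcons hu eqxx lact_cat /= rmorphM mulrA.
Qed.

Definition steinf phi := forall V, stein V phi.

(** A path is a product of single steps: an ascent is treated by [stein_up], and a descent by the
    second clause of [stein]. On flags whose head is not the end of the path the new function is
    zero. *)
Lemma stein_pact phi s : steinf phi -> is_flag_path s -> steinf (pact phi s).
Proof.
move=> st; elim/last_ind: s => [//|s V IH] p W.
case: (eqVneq V W) => [e|ne]; last first.
  apply: stein_ext (stein0 _ W) => t fl h.
  by rewrite /pact last_rcons h (negbTE ne).
subst W; case: (lastP s) p IH => [|r U] p IH.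
  by apply: stein_ext (st V) => t fl h; rewrite pact_id.
have p1 : is_flag_path (r ++ [:: U; V]) by rewrite -cat_rcons cats1.
move: p1; rewrite is_flag_path_cat => /andP[p1 p2].
have {}IH := IH p1;
  apply: (@stein_ext _ _ _ _ (pact (pact phi (rcons r U)) [:: U; V])).
  by move=> t fl h; rewrite -pact_cat // -cat_rcons cats1.
case/andP: p2 => _ /=; rewrite andbT => /orP[c|c].
  by apply: stein_ext (stein_up (IH U) c) => t fl h; rewrite pact_up.
by apply: stein_ext (stein_cons (IH U) c) => t fl h; rewrite pact_down.
Qed.

Lemma stein_ract phi x : steinf phi -> steinf (ract phi x).
Proof.
move=> st V; elim/malg_ind: x => [|a x y IH IH'|p].
- by apply: stein_ext (stein0 _ V) => t _ _; rewrite ract0.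
- by apply: stein_ext (stein_linear a IH IH') => t _ _; rewrite ractP.
apply: stein_ext (stein_pact st (valP p) V) => t _ _.
by rewrite -bp_val ract_bp ?(valP p).
Qed.

(** The upward (FS) relation is [up_up], the downward one is the vanishing of panel sums, and the
    two wedge relations are the two branches in the definition of [dstep]. *)
Lemma ract_relator phi x t : steinf phi -> relator x -> is_flag t ->
  ract phi x t = 0.
Proof.
move=> st rx fl; case: rx.
- move=> V W VW d; rewrite ract_sum.
  have [h|ne] := eqVneq (head 0%VS t) W.
    rewrite -[RHS](up_up (st V) VW d fl h); apply: eq_bigr => X /andP[c1 c2].
    rewrite bpathE ract_bp; last by rewrite /is_flag_path /= c1 c2.
    rewrite (@pact_cat _ [:: V] X [:: W]) //;
      last by rewrite /is_flag_path /= c2.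
    rewrite pact_up //; apply: eq_up; rewrite ?h // => u fu hu.
    by rewrite pact_up.
  rewrite big1 // => X /andP[c1 c2].
  rewrite bpathE ract_bp; last by rewrite /is_flag_path /= c1 c2.
  by rewrite /pact /= eq_sym (negbTE ne).
- move=> V W VW d; rewrite ract_sum.
  have [h|ne] := eqVneq (head 0%VS t) V.
    case: t fl h => [//|V0 t] fl /= h; subst V0.
    rewrite -[RHS](stein_panel (st W) fl VW d);
      apply: eq_bigr => X /andP[c1 c2].
    rewrite bpathE ract_bp; last by rewrite /is_flag_path /= c1 c2 !orbT.
    rewrite (@pact_cat _ [:: W] X [:: V]) //;
      last by rewrite /is_flag_path /= c1 orbT.
    by rewrite pact_down // pact_down.
  rewrite big1 // => X /andP[c1 c2].
  rewrite bpathE ract_bp; last by rewrite /is_flag_path /= c1 c2 !orbT.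
  by rewrite /pact /= eq_sym (negbTE ne).
- move=> V W c; rewrite !bpathE ractB ractZ !ract_bp //; last first.
    by rewrite /is_flag_path /= c orbT.
  rewrite (@pact_cat _ [:: V] W [:: V]) //;
    last by rewrite /is_flag_path /= c orbT.
  have [h|ne] := eqVneq (head 0%VS t) V; last first.
    by rewrite /pact /= eq_sym (negbTE ne) mulr0 subrr.
  case: t fl h => [//|V0 t] fl /= h; subst V0.
  rewrite pact_down // pact_up // pact_id //.
  by rewrite upE eqxx subrr.
move=> V W V' c c' ne; rewrite !bpathE ractD.
have c1 := covers_cap_neq c c' ne.
have c2 : covers (V :&: V')%VS V.
  by rewrite capvC; apply: covers_cap_neq c' c _; rewrite eq_sym.
rewrite !ract_bp; try by rewrite /is_flag_path /= ?c ?c' ?c1 ?c2 ?orbT.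
rewrite (@pact_cat _ [:: V] W [:: V']) //;
  last by rewrite /is_flag_path /= c' orbT.
rewrite (@pact_cat _ [:: V] (V :&: V')%VS [:: V']) //;
  last by rewrite /is_flag_path /= c1.
have [h|ne'] := eqVneq (head 0%VS t) V'; last first.
  by rewrite /pact /= eq_sym (negbTE ne') addr0.
case: t fl h => [//|V0 t] fl /= h; subst V0.
rewrite pact_down // pact_up // pact_up // upE eq_sym (negbTE ne).
have -> : up (V :&: V')%VS (pact phi [:: V; (V :&: V')%VS]) (V' :: t) =
          up (V :&: V')%VS (fun u => phi (V :: u)) (V' :: t).
  by apply: eq_up => // u fu hu; rewrite pact_down.
by rewrite addNr.
Qed.

Lemma ract_ideal phi x t : steinf phi -> rel_ideal x -> is_flag t ->
  ract phi x t = 0.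
Proof.
(* The function must be general: a left factor y replaces phi by [ract phi y], which again has
   vanishing panel sums, while a right factor evaluates a function that is already zero on all
   flags. *)
move=> st rx; elim: rx phi t st => {x}.
- by move=> x rx phi t st; apply: ract_relator.
- by move=> phi t _ _; rewrite ract0.
- by move=> x y _ IH _ IH' phi t st fl; rewrite ractD IH ?IH' ?addr0.
- by move=> a x _ IH phi t st fl; rewrite ractZ IH // mulr0.
- move=> y x _ IH phi t st fl; rewrite pmulE (ract_mul _ _ _ fl).
  exact: (IH _ _ (stein_ract y st) fl).
move=> y x _ IH phi t st fl; rewrite pmulE (ract_mul _ _ _ fl).
rewrite (@eq_ract _ (fun=> 0) _ _ fl) ?ract0l // => u fu.
exact: (IH _ _ st fu).
Qed.

End ActionTheory.

(** * Flags spanning the standard module *)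

Section Flags.
Variables (F : finFieldType) (n : nat).
Local Notation subsp := {vspace 'cV[F]_n}.
Local Notation q := #|F|.
Implicit Types (U V W X Y : subsp) (s t : seq subsp).

Lemma exists_covers W : W != 0%VS -> exists V, covers V W.
Proof.
move=> W0; set a := vpick W; have aW : a \in W := memv_pick W.
have a0 : a != 0 by rewrite vpick0.
exists (W :\: <[a]>)%VS; apply/coversP; split; first exact: diffvSl.
have := dimv_cap_compl W <[a]>%VS.
by rewrite (capv_idPr _) ?dim_vline ?a0 -?memvE // => <-.
Qed.

Lemma qintS m : qint F m.+1 = (1 + q * qint F m)%N.
Proof.
rewrite /qint big_ord_recl big_distrr /=; congr (_ + _)%N.
by apply: eq_bigr => i _; rewrite expnS.
Qed.

(** Besides a chosen hyperplane W', each other one meets W' in a hyperplane Y of W', and by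
    [card_between] exactly q of them meet it in a given Y. Hence the recursion [m + 1]_q = 1 + q
    [m]_q. *)
Lemma card_covers W : #|[pred V | covers V W]| = qint F (\dim W).
Proof.
elim: {W}(\dim W) {-2}W (erefl (\dim W)) => [|m IH] W dW.
  have -> : W = 0%VS by apply/eqP; rewrite -dimv_eq0 dW.
  by rewrite dimv0 /qint big_ord0 eq_card0 // => V; rewrite inE covers0.
have [W' c] : exists V, covers V W.
  by apply: exists_covers; rewrite -dimv_eq0 dW.
have dW' : \dim W' = m by have := covers_dim c; rewrite dW; lia.
rewrite -sum1_card (bigD1 W') /=; last by rewrite inE.
rewrite dW qintS; congr (_ + _)%N.
rewrite (partition_big (fun V => W' :&: V)%VS (fun Y => covers Y W')) /=;
  last first.
  by move=> V; rewrite inE => /andP[cV ne]; rewrite capvC;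
    apply: covers_cap_neq cV c ne.
rewrite -dW' -(IH W' dW') mulnC -sum_nat_const; apply: eq_big => [Y|Y cY];
  first by rewrite inE.
have d : \dim W = (\dim Y).+2 by rewrite (covers_dim c) (covers_dim cY).
have bW' : between Y W W' by rewrite /between cY c.
rewrite -(card_between bW') -sum1_card; apply: eq_bigl => V; rewrite !inE.
rewrite [RHS]andbC andbAC andbC; case: eqVneq => //= ne.
apply/idP/idP => [/andP[cV /eqP <-]|bV].
  by apply/andP; split => //; apply: covers_cap_neq c cV _; rewrite eq_sym.
by case/andP: (bV) => _ ->; rewrite (cap_between d bW' bV ne) eqxx.
Qed.

Fixpoint flags m W : seq (seq subsp) :=
  if m is m'.+1 then
    [seq W :: t | V <- enum [pred V | covers V W], t <- flags m' V]
  else [:: [:: W]].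

Lemma flagsP m W t : \dim W = m ->
  (t \in flags m W) = is_flag t && (head 0%VS t == W).
Proof.
elim: m W t => [|m IH] W t dW.
  have W0 : W = 0%VS by apply/eqP; rewrite -dimv_eq0 dW.
  rewrite /= inE; case: t => [//|V [|V' t]]; rewrite /= ?flag_cons ?W0.
    by rewrite eqseq_cons andbT andbb.
  rewrite eqseq_cons andbF.
  by case: (eqVneq V 0%VS) => [->|_]; rewrite ?covers0 ?andbF.
apply/allpairsPdep/andP => [[V [u [cV fu ->]]]|[ft /eqP hW]].
  rewrite mem_enum inE in cV; have dV : \dim V = m.
    by have := covers_dim cV; lia.
  move: fu; rewrite IH // => /andP[fu /eqP hu].
  case: u fu hu => [//|V0 u] fu /= hu; subst V0.
  by rewrite flag_cons2 cV fu eqxx.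
case: t ft hW => [//|W0 [|V t]] ft /= hW; subst W0.
  by move: ft; rewrite flag_cons -dimv_eq0 dW.
move: ft; rewrite flag_cons2 => /andP[c ft].
exists V, (V :: t); rewrite mem_enum inE; split=> //.
by rewrite IH ?ft ?eqxx //; have := covers_dim c; lia.
Qed.

Lemma flags_uniq m W : \dim W = m -> uniq (flags m W).
Proof.
elim: m W => [//|m IH] W dW /=; apply: allpairs_uniq_dep.
- exact: enum_uniq.
- move=> V; rewrite mem_enum inE => c; apply: IH.
  by have := covers_dim c; lia.
move=> _ _ /allpairsPdep[V [t [cV ft ->]]] /allpairsPdep[V' [t' [cV' ft' ->]]] /=.
move=> -[e]; subst t'; rewrite !mem_enum !inE in cV cV'.
have d : \dim V = m by have := covers_dim cV; lia.
have d' : \dim V' = m by have := covers_dim cV'; lia.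
move: ft ft'; rewrite !flagsP // => /andP[_ /eqP <-] /andP[_ /eqP e].
by rewrite -e.
Qed.

Definition qfact m : nat := \prod_(i < m) qint F i.+1.

Lemma size_flags m W : \dim W = m -> size (flags m W) = qfact m.
Proof.
elim: m W => [|m IH] W dW; first by rewrite /qfact big_ord0.
rewrite /= size_allpairs_dep /qfact big_ord_recr /= -/(qfact m) -dW.
rewrite -card_covers cardE sumnE big_map (eq_big_seq (fun=> qfact m)).
  by rewrite big_const_seq count_predT iter_addn_0.
by move=> V; rewrite mem_enum inE => c; rewrite IH //; have := covers_dim c;
  lia.
Qed.

Variable R : comNzRingType.
Local Notation PA := (path_alg F n R).
Local Notation bp := (@bp F n R).
Implicit Types (phi psi : seq subsp -> R) (x y : PA).

Lemma big_flags (A : nmodType) m W (f : seq subsp -> A) :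
  \sum_(t <- flags m.+1 W) f t =
  \sum_(V | covers V W) \sum_(t <- flags m V) f (W :: t).
Proof.
rewrite /= big_allpairs_dep /= big_enum_cond /=; apply: eq_bigl => V.
by rewrite inE andbT.
Qed.

(** The functional that reads off the coefficient of the idempotent (0). Every function entering the
    Jantzen form is a right translate of it. *)
Definition delta0 (t : seq subsp) : R := (t == [:: 0%VS])%:R.

Lemma stein_delta0 : steinf delta0.
Proof.
move=> V; constructor.
  by move=> *; rewrite big1 // => X _; rewrite /delta0 eqseq_cons andbF.
move=> V' c; apply: stein_ext (stein0 _ V') => -[//|W t] _ _.
by rewrite /delta0 eqseq_cons andbF.
Qed.

(* tau s is the linear form <bp s, _> on the standard module. *)
Definition tau s t : R := pact delta0 (rev s) t.

Lemma steinf_tau s : is_flag s -> steinf (tau s).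
Proof.
move=> fl; apply: stein_pact; first exact: stein_delta0.
by rewrite is_flag_path_rev flag_is_path.
Qed.

Lemma tau_cons W W' s t : is_flag [:: W, W' & s] -> is_flag t ->
  head 0%VS t = W -> tau [:: W, W' & s] t = up W' (tau (W' :: s)) t.
Proof.
move=> fl ft h; move: (fl); rewrite flag_cons2 => /andP[c _].
rewrite /tau !rev_cons -!cats1 -catA cats1 /= pact_cat //; last first.
  by rewrite /is_flag_path /= c.
by rewrite pact_up // cats1.
Qed.

Lemma eq_flag0 t : is_flag t -> head 0%VS t = 0%VS -> t = [:: 0%VS].
Proof.
case: t => [//|W [|V t]] fl /= h; subst W => //.
by move: fl; rewrite flag_cons2 covers0.
Qed.

(** Removing the top space W from s turns [tau] into a raise of a shorter [tau]. By induction the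
    inner sum is [m]_q! times phi with W prepended, and [sum_up_cons] supplies the last factor
    [m + 1]_q. *)
Lemma sum_tau m W phi t : \dim W = m -> stein W phi -> is_flag t ->
  head 0%VS t = W ->
  \sum_(s <- flags m W) phi s * tau s t = (qfact m)%:R * phi t.
Proof.
elim: m W phi t => [|m IH] W phi t dW st ft h.
  have W0 : W = 0%VS by apply/eqP; rewrite -dimv_eq0 dW.
  rewrite W0 in h *; rewrite (eq_flag0 ft h) big_seq1 /qfact big_ord0.
  by rewrite mul1r /tau pact_id // /delta0 eqxx mulr1.
rewrite big_flags.
transitivity (\sum_(V | covers V W)
    up V (fun u => \sum_(s <- flags m V) phi (W :: s) * tau s u) t).
  apply: eq_bigr => V c; rewrite -up_sum big_seq [RHS]big_seq.
  have dV : \dim V = m by have := covers_dim c; lia.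
  apply: eq_bigr => s; rewrite flagsP // => /andP[fs /eqP hs].
  case: s fs hs => [//|V0 s] fs /= hs; subst V0.
  by rewrite upZ tau_cons // flag_cons2 c.
transitivity (\sum_(V | covers V W)
    (qfact m)%:R * up V (fun u => phi (W :: u)) t).
  apply: eq_bigr => V c; have dV : \dim V = m by have := covers_dim c; lia.
  rewrite -upZ; apply: eq_up; rewrite ?h // => u fu hu.
  exact: (IH V (fun u => phi (W :: u)) u dV (stein_cons st c) fu hu).
rewrite -mulr_sumr sum_up_cons // mulrA -natrM dW.
by rewrite /qfact big_ord_recr.
Qed.

(* Submodules of S, represented by saturated subsets of the path algebra. *)
Definition submod (Q : PA -> Prop) :=
  [/\ Q 0, forall a x y, Q x -> Q y -> Q (a *: x + y) &
      forall x y, eqS x y -> Q y -> Q x].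

Lemma submod_sum Q I (r : seq I) (P : pred I) (c : I -> R) (f : I -> PA) :
  submod Q -> (forall i, P i -> Q (f i)) -> Q (\sum_(i <- r | P i) c i *: f i).
Proof.
by case=> Q0 QD _ H; elim/big_rec: _ => [//|i x /H]; apply: QD.
Qed.

Lemma submod_lspan (Q A : PA -> Prop) : submod Q -> (forall x, A x -> Q x) ->
  forall x, lspan A x -> Q x.
Proof.
by case=> Q0 QD _ H; apply: lspan_ind.
Qed.

Lemma submod_saturate (Q A : PA -> Prop) : submod Q -> (forall x, A x -> Q x) ->
  forall x, saturate A x -> Q x.
Proof. by case=> _ _ QE H x [y /H Qy e]; apply: QE Qy. Qed.

Lemma submod_span (A : PA -> Prop) : submod (saturate (lspan A)).
Proof.
split.
- by exists 0; [apply: lspan0|apply: eqS_refl].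
- move=> a x y [x' Ax' ex] [y' Ay' ey]; exists (a *: x' + y').
    exact: lspan_linear.
  exact: eqS_linear.
- by move=> x y e [z Az e']; exists z => //; apply: eqS_trans e'.
Qed.

Lemma Delta_flag t : is_flag t -> Delta F n R (bp t).
Proof.
move=> fl; exists (bp t); last exact: eqS_refl.
by apply: lspan_gen; exists t => //; rewrite bpathE.
Qed.

Lemma Delta_ind Q : submod Q -> (forall t, is_flag t -> Q (bp t)) ->
  forall x, Delta F n R x -> Q x.
Proof.
move=> sQ H; apply: submod_saturate => //;
  apply: submod_lspan => // x [t fl <-].
by rewrite bpathE; apply: H.
Qed.

(** Ties the combinatorial action to multiplication modulo the relations, one step of the path at a
    time: a descent only prepends a subspace, and an ascent is [smul_dstep]. *)
Lemma bp_lact s t : is_flag_path s -> is_flag t -> last 0%VS s = head 0%VS t ->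
  eqS (smul (bp s) (bp t)) ((lact s t).1%:~R *: bp (lact s t).2).
Proof.
elim: s => [//|V [|W s] IH] ps ft h.
  clear IH; case: t ft h => [//|V0 t] ft /= h; subst V0.
  rewrite (@bp_mul _ _ _ V [::]) ?scale1r; [exact: eqS_refl|by []|].
  exact: flag_is_path.
have p2 : is_flag_path (W :: s).
  by move: ps => /andP[_ /= /andP[_ p]]; rewrite /is_flag_path.
have p1 : is_flag_path [:: V; W].
  by move: ps => /andP[_ /= /andP[p _]]; rewrite /is_flag_path /= p.
have -> : smul (bp [:: V, W & s]) (bp t) = smul (bp [:: V;
  W]) (smul (bp (W :: s)) (bp t)).
  clear IH; case: t ft h => [//|U t] ft h.
  have pt := flag_is_path ft.
  case: (lastP s) ps p2 h => [|s' U'] ps p2; rewrite ?last_cons ?last_rcons /=.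
    move=> e; subst U; rewrite (@bp_mul _ _ _ W [:: V]) //.
    by rewrite (@bp_mul _ _ _ W [::]) // (@bp_mul _ _ _ W [:: V]).
  move=> e; subst U'.
  rewrite -rcons_cons (@bp_mul _ _ _ U (W :: s')) // -!rcons_cons.
  rewrite (@bp_mul _ _ _ U [:: V, W & s']) //.
  rewrite /= (@bp_mul _ _ _ W [:: V]) //.
  by rewrite -[W :: _]/((W :: s') ++ _) is_flag_path_cat rcons_cons p2.
have [fr hr] := lact_flag p2 ft h.
apply: (eqS_trans (eqSMl _ (IH p2 ft h))); rewrite smulZr lactE.
case: (lact (W :: s) t) fr hr => c [|U u] fr; first by case: (notF fr).
rewrite /= in fr * => e; subst U.
rewrite (@bp_mul _ _ _ W [:: V]) ?(flag_is_path fr) // /lstep /=.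
case: ifP => [_|c1] /=; first exact: eqS_refl.
have c2 : covers V W by move: p1; rewrite /is_flag_path /= c1 orbF andbT.
by rewrite rmorphM -scalerA; apply/eqSZ/smul_dstep.
Qed.

(** Existence of the integer in the Jantzen form, with its value. For two flags, a reversed flag
    acting on the other leaves a flag of the zero space, which can only be (0) itself. Both sides
    are linear in each argument, so [Delta_ind] extends this to all of Delta. *)
Lemma smul_srev x v : Delta F n R x -> Delta F n R v ->
  eqS (smul (srev v) x)
      (ract delta0 (smul (srev v) x) [:: 0%VS] *: bp [:: 0%VS]).
Proof.
have f0 : is_flag ([:: 0%VS] : seq subsp) by rewrite flag_cons.
have ext x' y' : eqS x' y' -> ract delta0 x' [:: 0%VS] = ract delta0 y' [:: 0%VS].
  move=> e; apply/eqP; rewrite -subr_eq0 -ractB; apply/eqP.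
  exact: (ract_ideal stein_delta0 e f0).
pose Q z := eqS z (ract delta0 z [:: 0%VS] *: bp [:: 0%VS]).
have sQ : submod Q.
  split; first by rewrite /Q ract0 scale0r; apply: eqS_refl.
  - move=> a y z Qy Qz; rewrite /Q ractP scalerDl -scalerA.
    exact: (eqS_linear a Qy Qz).
  - move=> y z e Qz; rewrite /Q (ext _ _ e); exact: (eqS_trans e).
move=> Dx Dv; rewrite -/(Q _); move: v Dv; apply: Delta_ind.
  case: sQ => Q0 QD QE; split; first by rewrite srev0 smul0l.
  - by move=> a y z h h'; rewrite srevP smulPl; apply: QD.
  - by move=> y z /eqS_rev/(eqSMr x); apply: QE.
move=> s fs; move: x Dx; apply: Delta_ind.
  case: sQ => Q0 QD QE; split; first by rewrite smul0r.
  - by move=> a y z h h'; rewrite smulPr; apply: QD.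
  - by move=> y z /(eqSMl (srev (bp s))); apply: QE.
move=> t ft; case: sQ => Q0 _ QE; rewrite srev_bp.
case: (eqVneq (last 0%VS (rev s)) (head 0%VS t)) => [h|ne];
  last by rewrite bp_mul0.
have ps : is_flag_path (rev s) by rewrite is_flag_path_rev flag_is_path.
have [fu hu] := lact_flag ps ft h.
apply: (QE _ _ (bp_lact ps ft h)).
have h0 : head 0%VS (rev s) = 0%VS.
  case/and3P: fs => _ _ /eqP; case: (lastP s) => [//|s' U].
  by rewrite rev_rcons last_rcons.
have p0 : is_flag_path ([:: 0%VS] : seq subsp) by [].
have h00 : head 0%VS ([:: 0%VS] : seq subsp) = 0%VS by [].
rewrite (eq_flag0 fu (etrans hu h0)) /Q ractZ (ract_bp _ _ p0).
by rewrite (pact_id _ h00) /delta0 eqxx mulr1; apply: eqS_refl.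
Qed.

(** Uniqueness of that integer: [delta0] kills the ideal and takes the value 1 on (0), so (0) has no
    torsion in S. *)
Lemma eqS_scale_inj a b : eqS (a *: bp [:: 0%VS]) (b *: bp [:: 0%VS]) -> a = b.
Proof.
have f0 : is_flag ([:: 0%VS] : seq subsp) by rewrite flag_cons.
move=> e; apply/eqP; rewrite -subr_eq0; apply/eqP.
have := ract_ideal stein_delta0 e f0.
have p0 : is_flag_path ([:: 0%VS] : seq subsp) by [].
have h00 : head 0%VS ([:: 0%VS] : seq subsp) = 0%VS by [].
rewrite -scalerBl ractZ (ract_bp _ _ p0) (pact_id _ h00) /delta0 eqxx.
by rewrite mulr1.
Qed.

(* The panel of W' contains a single member through the line l, so a flag
   passing through it can be traded for flags that avoid l. *)
Lemma avoid_line (Q : PA -> Prop) (l W : subsp) s t :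
  submod Q -> \dim l = 1%N -> (l <= W)%VS -> is_flag_path (rcons s W) ->
  (forall W' u, is_flag [:: W, W' & u] -> ~~ (l <= W')%VS ->
     Q (bp (s ++ [:: W, W' & u]))) ->
  is_flag t -> head 0%VS t = W -> Q (bp (s ++ t)).
Proof.
move=> sQ dl; elim: t s W => [//|W0 [|W' t] IH] s W lW ps H ft /= hW; subst W0.
  move: ft; rewrite flag_cons => /eqP W0; move/dimvS: lW.
  by rewrite W0 dimv0 dl.
have [lW'|] := boolP (l <= W')%VS; last exact: H.
move: (ft); rewrite flag_cons2 => /andP[c ft'].
rewrite -cat_rcons; apply: (IH _ W') => //.
  rewrite -cats1 cat_rcons is_flag_path_cat ps.
  by rewrite /is_flag_path /= c orbT.
(* By induction inside W' the next term U may be assumed to avoid l. The panel relation between U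
   and W then trades W' for the other members X. These avoid l, because X /\ W' = U does not contain
   l. *)
move=> U u fu NU; rewrite cat_rcons.
move: (fu); rewrite flag_cons2 => /andP[cU fU].
have d : \dim W = (\dim U).+2 by rewrite (covers_dim c) (covers_dim cU).
have UW := subv_trans (covers_sub cU) (covers_sub c).
have bW' : between U W W' by rewrite /between cU c.
have := bp_panel R ps (flag_is_path fU) UW d; rewrite (bigD1 W') //=.
rewrite -[X in _ + X]opprK => e; case: (sQ) => _ _ QE; apply: (QE _ _ e).
rewrite -sumrN (eq_bigr (fun X => (-1) *: bp (s ++ [:: W, X, U & u])));
  last first.
  by move=> X _; rewrite scaleN1r.
apply: (@submod_sum Q _ _ _ (fun=> -1)
  (fun X => bp (s ++ [:: W, X, U & u])) sQ) => X /andP[bX ne]; apply: H.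
  by case/andP: bX => c1 c2; rewrite !flag_cons2 c1 c2.
apply: contra NU => lX; rewrite -(cap_between d bW' bX ne) subv_cap lX.
by rewrite lW'.
Qed.

Variable E : nat -> subsp.
Hypotheses (E0 : E 0 = 0%VS) (dE : forall i, (i <= n)%N -> \dim (E i) = i)
  (sE : forall i, (E i <= E i.+1)%VS).

Definition opposite s := all (fun V => V :&: E (n - \dim V) == 0)%VS s.

(** The flag is moved into general position from the top down. Once W is transversal to its partner
    in E, it meets the next member of E in a line l, and a hyperplane of W is transversal to that
    member exactly when it avoids l. [avoid_line] achieves this at the cost of changing only the
    terms below W. *)
Lemma span_opposite_aux (Q : PA -> Prop) m W s t : submod Q ->
  \dim W = m -> is_flag_path (rcons s W) -> (W :&: E (n - m) = 0)%VS ->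
  (forall u, is_flag u -> head 0%VS u = W -> opposite u -> Q (bp (s ++ u))) ->
  is_flag t -> head 0%VS t = W -> Q (bp (s ++ t)).
Proof.
move=> sQ; elim: m W s t => [|m IH] W s t dW ps WE H ft h.
  have W0 : W = 0%VS by apply/eqP; rewrite -dimv_eq0 dW.
  apply: H => //; rewrite (eq_flag0 ft) ?h //.
  by rewrite /opposite /= cap0v eqxx.
have mn : (m < n)%N.
  by rewrite -dW; have := dimvS (subvf W); rewrite dim_fullv.
have En : (n - m = (n - m.+1).+1)%N by lia.
pose l := (W :&: E (n - m))%VS.
(* At most 1, because l meets the hyperplane E (n - m.+1) of E (n - m) trivially; at least 1,
   because the dimensions of W and E (n - m) add up to n + 1. *)
have dl : \dim l = 1%N.
  apply/eqP; rewrite eqn_leq; apply/andP; split.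
    have l0 : (l :&: E (n - m.+1) = 0)%VS.
      apply/eqP; rewrite -subv0 -WE capvS ?capvSl //.
    have := dimv_disjoint_sum l0; rewrite dE; last by lia.
    have : (l + E (n - m.+1) <= E (n - m))%VS.
      by rewrite subv_add capvSr /= En sE.
    by move/dimvS; rewrite dE; lia.
  have := dimv_sum_cap W (E (n - m)); rewrite -/l dW dE; last by lia.
  have := dimvS (subvf (W + E (n - m))); rewrite dim_fullv; lia.
apply: (avoid_line sQ dl (capvSl _ _) ps _ ft h) => W' u fu Nl.
move: (fu); rewrite flag_cons2 => /andP[c fu'].
have dW' : \dim W' = m by have := covers_dim c; lia.
rewrite -cat_rcons; apply: (IH W') => //.
- rewrite -cats1 cat_rcons is_flag_path_cat ps.
  by rewrite /is_flag_path /= c orbT.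
- have s1 : (W' :&: E (n - m) <= l)%VS by rewrite capvS // covers_sub.
  apply/eqP; rewrite -dimv_eq0; have := dimvS s1;
    rewrite dl leq_eqVlt ltnS leqn0.
  case/orP => // /eqP e; case/negP: Nl.
  have -> : l = (W' :&: E (n - m))%VS by apply/esym/eqP; rewrite eqEdim s1 e dl.
  exact: capvSl.
move=> v fv hv ov; rewrite cat_rcons; apply: H => //.
  by case: v fv hv {ov} => [//|V0 v] fv /= e; subst V0; rewrite flag_cons2 c.
by rewrite /opposite /= dW WE eqxx.
Qed.

Lemma span_opposite (Q : PA -> Prop) : submod Q ->
  (forall u, is_full_flag u -> opposite u -> Q (bp u)) ->
  forall t, is_full_flag t -> Q (bp t).
Proof.
move=> sQ H t /andP[ft /eqP ht].
have d : \dim (fullv : subsp) = n by exact: dim_fullv.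
apply: (@span_opposite_aux Q n fullv [::] t sQ d) => //.
  by rewrite subnn E0 capv0.
by move=> u fu hu; apply: H; rewrite /is_full_flag fu hu eqxx.
Qed.

End Flags.

(** * The action of GL on the standard flag *)

Section LinearAction.
Variables (F : finFieldType) (n : nat).
Local Notation N := n.+1.
Local Notation subsp := {vspace 'cV[F]_N}.
Local Notation GL := {'GL_N[F]}.
Implicit Types (g h : GL) (V W X : subsp) (s t : seq subsp) (w : 'S_N).

Lemma memv_act g V x : (x \in act g V) = (GLval g^-1%g *m x \in V).
Proof.
have gK : GLval g *m GLval g^-1%g = 1%:M.
  by rewrite -[_ *m _]/(GLval (g * g^-1)%g) mulgV.
have gVK : GLval g^-1%g *m GLval g = 1%:M.
  by rewrite -[_ *m _]/(GLval (g^-1 * g)%g) mulVg.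
apply/memv_imgP/idP => [[y yV ->]|h].
  by rewrite lfunE /= mulmxA gVK mul1mx.
by exists (GLval g^-1%g *m x) => //; rewrite lfunE /= mulmxA gK mul1mx.
Qed.

Lemma act1 V : act 1%g V = V.
Proof. by apply/vspaceP => x; rewrite memv_act invg1 mul1mx. Qed.

Lemma actM g h V : act (g * h)%g V = act g (act h V).
Proof. by apply/vspaceP => x; rewrite !memv_act invMg mulmxA. Qed.

Lemma act_sub g V W : (act g V <= act g W)%VS = (V <= W)%VS.
Proof.
apply/idP/idP => [s|]; last exact: limgS.
by rewrite -[V]act1 -[W]act1 -(mulVg g) !actM; apply: limgS.
Qed.

Lemma dim_act g V : \dim (act g V) = \dim V.
Proof.
have le h U : (\dim (act h U) <= \dim U)%N.
  by rewrite -(limg_ker_dim (linfun (mulmx (GLval h))) U) leq_addl.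
by apply/eqP; rewrite eqn_leq le -{1}[V]act1 -(mulVg g) actM le.
Qed.

Lemma act_inj g : injective (act g).
Proof. by move=> V W e; rewrite -[V]act1 -[W]act1 -(mulVg g) !actM e. Qed.

Lemma act_fullv g : act g fullv = fullv.
Proof. by apply/eqP; rewrite eqEdim subvf dim_act leqnn. Qed.

Lemma act0 g : act g 0%VS = 0%VS.
Proof. exact: limg0. Qed.

Lemma covers_act g V W : covers (act g V) (act g W) = covers V W.
Proof. by rewrite /covers act_sub !dim_act. Qed.

Lemma is_flag_act g t : is_flag (map (act g) t) = is_flag t.
Proof.
elim: t => [//|W [|V t] IH].
  rewrite /= !flag_cons -[in RHS](inj_eq (@act_inj g)).
  by rewrite act0.
by rewrite /= in IH *; rewrite !flag_cons2 covers_act IH.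
Qed.

Lemma head_act g t : head 0%VS (map (act g) t) = act g (head 0%VS t).
Proof. by case: t => [|//]; rewrite /= act0. Qed.

Lemma is_full_flag_act g t : is_full_flag (map (act g) t) = is_full_flag t.
Proof.
rewrite /is_full_flag is_flag_act head_act.
by rewrite -{1}[fullv](act_fullv g) (inj_eq (@act_inj g)).
Qed.

Definition estd i : subsp :=
  <<[seq (delta_mx j 0%R : 'cV[F]_N) | j : 'I_N <- enum 'I_N & (j < i)%N]>>%VS.

Lemma mem_estd i (x : 'cV[F]_N) :
  reflect (forall j : 'I_N, (i <= j)%N -> x j 0 = 0) (x \in estd i).
Proof.
rewrite /estd; set s := [seq _ | _ <- _ & _].
apply: (iffP idP) => [|H].
  rewrite -[s]/(tval (in_tuple s)) => /coord_span -> j ij.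
  rewrite summxE big1 // => k _; rewrite mxE.
  have : s`_k \in s by apply: mem_nth.
  case/mapP => l; rewrite mem_filter => /andP[li _] ->.
  rewrite mxE; case: eqP => [e|_]; last by rewrite mulr0.
  by rewrite e leqNgt li in ij.
rewrite [x]matrix_sum_delta; apply: rpred_sum => j _; rewrite big_ord1.
have [ij|ji] := leqP i j; first by rewrite H // scale0r mem0v.
rewrite rpredZ // memv_span //; apply/mapP; exists j => //.
by rewrite mem_filter ji mem_enum.
Qed.

Lemma delta_estd i (j : 'I_N) : ((delta_mx j 0%R : 'cV[F]_N) \in estd i) = (j < i)%N.
Proof.
apply/mem_estd/idP => [H|ji k ik].
  rewrite ltnNge; apply/negP => /H; rewrite mxE !eqxx; apply/eqP.
  exact: oner_neq0.
rewrite mxE; case: eqP => // e; move: ik; rewrite e leqNgt ji //.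
Qed.

Lemma estd_sub i : (estd i <= estd i.+1)%VS.
Proof.
apply/subvP => x /mem_estd H; apply/mem_estd => j ij; apply: H; exact: ltnW.
Qed.

Lemma estdS (i : 'I_N) : estd i.+1 = (estd i + <[delta_mx i 0%R]>)%VS.
Proof.
apply/eqP; rewrite eqEsubv subv_add estd_sub -memvE delta_estd ltnS leqnn /= andbT.
apply/subvP => x /mem_estd H.
have -> : x = (x - x i 0 *: delta_mx i 0) + x i 0 *: delta_mx i 0 by rewrite subrK.
apply: memv_add; last by rewrite rpredZ // memv_line.
apply/mem_estd => j; rewrite leq_eqVlt => /orP[/eqP/val_inj <-|lt].
  by rewrite !mxE !eqxx mulr1 subrr.
rewrite !mxE H // sub0r; case: eqP => [e|_]; last by rewrite mulr0 oppr0.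
by rewrite e ltnn in lt.
Qed.

Lemma estd_covers i : (i < N)%N -> covers (estd i) (estd i.+1).
Proof.
move=> iN; rewrite -[i]/(val (Ordinal iN)) estdS.
by apply: covers_line; rewrite delta_estd ltnn.
Qed.

Lemma estd0 : estd 0 = 0%VS.
Proof.
apply/eqP; rewrite -subv0; apply/subvP => x /mem_estd H; rewrite memv0.
by apply/eqP/matrixP => i j; rewrite ord1 H // mxE.
Qed.

Lemma dim_estd i : (i <= N)%N -> \dim (estd i) = i.
Proof.
elim: i => [|i IH] iN; first by rewrite estd0 dimv0.
by rewrite (covers_dim (estd_covers iN)) IH // ltnW.
Qed.

Lemma estdN : estd N = fullv.
Proof. by apply/eqP; rewrite eqEdim subvf dim_fullv dim_estd ?leqnn. Qed.

Lemma std_flagE : std_flag F n = [seq estd i | i <- rev (iota 0 N.+1)].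
Proof. by []. Qed.

Lemma rev_iotaS k : rev (iota 0 k.+1) = k :: rev (iota 0 k).
Proof. by rewrite -[k.+1]addn1 iotaD rev_cat. Qed.

Lemma std_flag_full : is_full_flag (std_flag F n).
Proof.
have H m : (m <= N)%N -> is_flag [seq estd i | i <- rev (iota 0 m.+1)].
  elim: m => [_|m IH mN]; first by rewrite /= flag_cons estd0.
  move: (IH (ltnW mN)); rewrite !rev_iotaS !map_cons flag_cons2 => ->.
  by rewrite estd_covers.
apply/andP; split; first exact: H.
by rewrite std_flagE rev_iotaS /= estdN.
Qed.

Lemma size_std_flag : size (std_flag F n) = N.+1.
Proof. by rewrite std_flagE size_map size_rev size_iota. Qed.

Lemma nth_std_flag i : (i <= N)%N -> nth 0%VS (std_flag F n) (N - i) = estd i.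
Proof.
move=> iN; rewrite std_flagE (nth_map 0%N) ?size_rev ?size_iota; last by lia.
rewrite nth_rev size_iota ?nth_iota; try lia.
by congr estd; lia.
Qed.

Definition fl g : seq subsp := map (act g) (std_flag F n).

Lemma fl_full g : is_full_flag (fl g).
Proof. by rewrite is_full_flag_act std_flag_full. Qed.

Lemma flM g h : fl (g * h)%g = map (act g) (fl h).
Proof. by rewrite /fl -map_comp; apply: eq_map => V; rewrite /= actM. Qed.

Lemma borelP g : reflect (fl g = std_flag F n) (g \in borel F n).
Proof.
rewrite inE; apply: (iffP idP) => [/'forall_forallP H|e].
  rewrite -[RHS]map_id; apply/eq_in_map => V /mapP[i].
  rewrite mem_rev mem_iota => /andP[_ iN] ->; apply/eqP.
  rewrite eqEdim dim_act leqnn andbT;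
    apply/subvP => x /memv_imgP[y /mem_estd yE ->].
  rewrite lfunE /=; apply/mem_estd => j ij; rewrite mxE big1 // => k _.
  have [ik|ki] := leqP i k; first by rewrite yE // mulr0.
  have := H j k; rewrite (leq_trans ki ij) /= => /eqP ->.
  by rewrite mul0r.
apply/'forall_forallP => i j; apply/implyP => ji.
have ej : act g (estd j.+1) = estd j.+1.
  rewrite -nth_std_flag; last by have := ltn_ord j; lia.
  by rewrite -[in RHS]e (nth_map 0%VS) // size_std_flag; lia.
move/eqP: ej; rewrite eqEsubv => /andP[/subvP s _].
have : linfun (mulmx (GLval g)) (delta_mx j 0%R : 'cV[F]_N) \in estd j.+1.
  by apply: s; apply: memv_img; rewrite delta_estd.
rewrite lfunE /= -colE => /mem_estd /(_ i ji); rewrite mxE => ->.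
by rewrite eqxx.
Qed.

Lemma fl1 : fl 1%g = std_flag F n.
Proof. by rewrite /fl -[RHS]map_id; apply: eq_map => V; rewrite act1. Qed.

Lemma eq_flP g h : (fl g == fl h) = (h^-1 * g \in borel F n)%g.
Proof.
apply/eqP/borelP => [e|e]; first by rewrite flM e -flM mulVg fl1.
by rewrite -[g](mulKVg h) flM e.
Qed.

Lemma borel_group_set : group_set (borel F n).
Proof.
apply/group_setP; split; first by apply/borelP; rewrite fl1.
by move=> g h /borelP eg /borelP eh; apply/borelP; rewrite flM eh.
Qed.
Canonical borel_group := Group borel_group_set.

Lemma unitriP g : reflect
  ((forall i j : 'I_N, (j < i)%N -> GLval g i j = 0) /\ forall i, GLval g i i = 1)
  (g \in unitri F n).
Proof.
rewrite inE; apply: (iffP 'forall_forallP) => [H|[H0 H1] i j].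
  split=> [i j ji|i].
    have := H i j; rewrite (ltnW ji) => /eqP ->.
    by case: eqP => // e; rewrite e ltnn in ji.
  by have := H i i; rewrite leqnn eqxx => /eqP.
apply/implyP; rewrite leq_eqVlt => /orP[/eqP/val_inj ->|ji];
  first by rewrite H1 eqxx.
rewrite H0 //; case: (eqVneq i j) => [e|_]; last by rewrite eqxx.
by rewrite e ltnn in ji.
Qed.

Lemma unitri_borel g : g \in unitri F n -> g \in borel F n.
Proof.
case/unitriP => H _; rewrite inE; apply/'forall_forallP => i j.
by apply/implyP => /H ->.
Qed.

Lemma unitri_group_set : group_set (unitri F n).
Proof.
apply/group_setP; split.
  apply/unitriP; split=> [i j ji|i]; rewrite mxE ?eqxx //.
  by case: eqP => // e; rewrite e ltnn in ji.
move=> g h /unitriP[g0 g1] /unitriP[h0 h1].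
have E i j : GLval (g * h)%g i j = \sum_k GLval g i k * GLval h k j by rewrite mxE.
apply/unitriP; split=> [i j ji|i]; rewrite E.
  rewrite big1 // => k _; have [lt|le] := ltnP k i; first by rewrite g0 ?mul0r.
  by rewrite h0 ?mulr0 // (leq_trans ji).
rewrite (bigD1 i) //= g1 h1 mulr1 big1 ?addr0 // => k ne.
have [lt|le] := ltnP k i; first by rewrite g0 ?mul0r.
rewrite h0 ?mulr0 // ltn_neqAle le andbT.
by apply: contra ne => /eqP/val_inj ->.
Qed.
Canonical unitri_group := Group unitri_group_set.

Lemma perm_GLM w w' : perm_GL F (w * w')%g = (perm_GL F w * perm_GL F w')%g.
Proof. by apply/val_inj => /=; rewrite perm_mxM. Qed.

Lemma perm_GLV w : perm_GL F w^-1%g = (perm_GL F w)^-1%g.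
Proof.
apply: (mulIg (perm_GL F w)); rewrite -perm_GLM !mulVg.
by apply/val_inj => /=; rewrite perm_mx1.
Qed.

Lemma perm_conjE w w' g i j :
  GLval (perm_GL F w * g * (perm_GL F w')^-1)%g i j = GLval g (w i) (w' j).
Proof.
rewrite -perm_GLV -[GLval _]/(perm_mx w *m GLval g *m perm_mx w'^-1%g).
by rewrite -col_permE -row_permE !mxE.
Qed.

Lemma perm_le_id w : (forall i, (w i <= i)%N) -> w = 1%g.
Proof.
move=> H; apply/permP => i; rewrite perm1.
have [m] := ubnP (val i); elim: m i => // m IH i; rewrite ltnS => im.
have := H i; rewrite leq_eqVlt => /orP[/eqP/val_inj //|lt].
by have /perm_inj := IH (w i) (leq_trans lt im).
Qed.

(** For j with w(j) = w'(i), the entry (j, i) of the product is a diagonal entry of u, hence 1, so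
    triangularity gives j <= i. A permutation that raises no index is the identity. *)
Lemma bruhat_uniq w w' u : u \in unitri F n ->
  (perm_GL F w * u * (perm_GL F w')^-1)%g \in borel F n -> w = w'.
Proof.
case/unitriP => _ u1; rewrite inE => /'forall_forallP H.
suff e : (w' * w^-1 = 1)%g by rewrite -[w]mul1g -e mulgKV.
apply: perm_le_id => i; rewrite permM; set j := (w^-1)%g _.
rewrite leqNgt; apply/negP => ij.
have := H j i; rewrite ij /= perm_conjE /j permKV u1; apply/negP.
exact: oner_neq0.
Qed.

(** Conjugation by a permutation keeps the diagonal of u equal to 1, so lying in the unitriangular
    group and lying in B are the same condition. This turns Gow's count into a count of coinciding
    flags. *)
Lemma cWE u : u \in unitri F n -> cW u =
  #|[pred w : 'S_N | (perm_GL F w * u * (perm_GL F w)^-1)%g \in borel F n]|.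
Proof.
move=> /unitriP[_ u1]; apply: eq_card => w; rewrite -!topredE /=.
apply/idP/idP => [/unitri_borel//|]; rewrite inE => /'forall_forallP H.
apply/unitriP; split=> [i j ji|i]; last by rewrite perm_conjE u1.
by have := H i j; rewrite ji => /eqP.
Qed.

Definition w0 : 'S_N := perm (@rev_ord_inj N).

Lemma w0V i : (w0^-1)%g i = rev_ord i.
Proof. by apply: (@perm_inj _ w0); rewrite permKV permE rev_ordK. Qed.

Lemma unitri_opp u : u \in unitri F n ->
  ((perm_GL F w0)^-1 * u * perm_GL F w0 \in borel F n)%g -> u = 1%g.
Proof.
case/unitriP => u0 u1 h; apply/val_inj/(@matrixP _ N N) => i j; rewrite /= mxE.
case: (ltngtP i j) => [lt|lt|/val_inj ->]; last by rewrite eqxx u1.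
  have e : ((perm_GL F w0)^-1 * u * perm_GL F w0 =
            perm_GL F w0^-1 * u * (perm_GL F w0^-1)^-1)%g.
    by rewrite perm_GLV invgK.
  move: h; rewrite e inE => /'forall_forallP H.
  have lt' : (rev_ord j < rev_ord i)%N by have := ltn_ord j; rewrite /=; lia.
  have := H (rev_ord i) (rev_ord j); rewrite perm_conjE !w0V !rev_ordK lt' /=.
  by move=> /eqP ->; case: eqP => // ij; rewrite ij ltnn in lt.
by rewrite u0 //; case: eqP => // ij; rewrite ij ltnn in lt.
Qed.

(** The big cell: by [opposite_fl] every full flag opposite to the standard one has this form. *)
Definition opp_flag u := fl (u * perm_GL F w0)%g.

(* The function on flags attached to g times the alternating sum st_e. *)
Definition stfun g s : int :=
  \sum_(w : 'S_N) (-1) ^+ w * (s == fl (g * perm_GL F w)%g)%:R.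

(** If u w B = v w0 B, then [bruhat_uniq] forces w = w0, and then u^-1 v lies both in the
    unitriangular group and in its opposite, so u = v. Only one term of the alternating sum
    survives. *)
Lemma stfun_opp u v : u \in unitri F n -> v \in unitri F n ->
  stfun u (opp_flag v) = (-1) ^+ w0 * (u == v)%:R.
Proof.
move=> Uu Uv; rewrite /stfun (bigD1 w0) //= big1 ?addr0 => [|w ne].
  rewrite eq_flP invMg !mulgA; congr (_ * _%:R); case: (eqVneq u v) => [->|ne].
    by rewrite mulgKV mulVg group1.
  apply/eqP; rewrite eqb0; apply: contra ne => h; apply/eqP.
  have : (u^-1 * v)%g = 1%g.
    apply: unitri_opp; first by rewrite groupM ?groupV.
    by rewrite !mulgA.
  by move/(congr1 (fun z => u * z)%g); rewrite mulKVg mulg1.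
rewrite eq_flP invMg !mulgA; case: (boolP (_ \in _)) => [h|_];
  last by rewrite mulr0.
case/eqP: ne; apply: invg_inj.
apply: (@bruhat_uniq _ _ (u^-1 * v)%g); first by rewrite groupM ?groupV.
by rewrite !perm_GLV invgK !mulgA.
Qed.

(* The reflection that exchanges the two coordinates at the panel fixes every
   other member of the standard flag. *)
Lemma act_tperm (j k : nat) (a b : 'I_N) : val a = j -> val b = j.+1 ->
  k != j.+1 -> act (perm_GL F (tperm a b)) (estd k) = estd k.
Proof.
move=> ea eb kj; apply/eqP; rewrite eqEdim dim_act leqnn andbT.
apply/subvP => x /memv_imgP[y /mem_estd yE ->].
rewrite lfunE /=; apply/mem_estd => i ki.
rewrite -row_permE mxE; apply: yE.
case: tpermP => [e|e|_ _ //]; move: ki; rewrite e ?ea ?eb; lia.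
Qed.

Lemma flag_suffix s (W : subsp) t : is_flag (s ++ W :: t) -> is_flag (W :: t).
Proof.
elim: s => [//|V s IH]; rewrite cat_cons flag_cons.
by case: s IH => [|V' s] IH /andP[_ /IH].
Qed.

(** The place of index [size s] + 1 in f, the one occupied by X in a panel sum, is left free. *)
Definition agree_off s (W U : subsp) t f :=
  (take (size s).+1 f == rcons s W) && (drop (size s).+2 f == U :: t).

Lemma sum_panel s W U t f : is_flag f ->
  \sum_(X | between U W X) (s ++ [:: W, X, U & t] == f)%:R =
  (agree_off s W U t f)%:R :> int.
Proof.
move=> ff; case: (boolP (agree_off _ _ _ _ _)) => [/andP[/eqP e1 /eqP e2]|ne].
  have lt : (size s < (size f).-2)%N.
    have := congr1 size e2; rewrite size_drop /=; lia.
  set X0 := nth 0%VS f (size s).+1.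
  have ef : f = s ++ [:: W, X0, U & t].
    rewrite -cat_rcons -e1 -e2 -drop_nth ?cat_take_drop //; lia.
  have bX0 : between U W X0.
    by move: ff; rewrite ef => /flag_suffix;
      rewrite !flag_cons2 /between => /and3P[-> -> _].
  rewrite (bigD1 X0) //= -ef eqxx big1 ?addr0 // => X /andP[_ nX].
  rewrite ef; case: eqP => // /eqP; rewrite eqseq_cat // eqxx /= !eqseq_cons.
  by rewrite (negbTE nX) andbF.
rewrite big1 // => X _; case: eqP => // e; case/negP: ne; rewrite -e.
apply/andP; split; first by rewrite -cat_rcons take_size_cat ?size_rcons.
rewrite -[[:: W, X, U & t]]/([:: W; X] ++ U :: t) catA drop_size_cat //.
by rewrite size_cat addn2.
Qed.

End LinearAction.

(** * Alternating functions on apartments, opposite flags, and counting of flags *)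

Section SteinbergFunctions.
Variables (F : finFieldType) (n : nat).
Local Notation N := n.+1.
Local Notation subsp := {vspace 'cV[F]_N}.
Local Notation GL := {'GL_N[F]}.
Implicit Types (g h : GL) (V W X U : subsp) (s t : seq subsp) (w : 'S_N).

Lemma size_fl g : size (fl g) = N.+1.
Proof. by rewrite size_map size_std_flag. Qed.

Lemma nth_fl g i : (i <= N)%N -> nth 0%VS (fl g) i = act g (estd F n (N - i)).
Proof.
move=> iN; rewrite (nth_map 0%VS) ?size_std_flag //.
by rewrite -[in LHS](subKn iN) nth_std_flag // leq_subr.
Qed.

Lemma nth_fl_tperm g i j (a b : 'I_N) : val a = j -> val b = j.+1 ->
  (i <= N)%N -> (N - i != j.+1)%N ->
  nth 0%VS (fl (g * perm_GL F (tperm a b))%g) i = nth 0%VS (fl g) i.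
Proof. by move=> ea eb iN ne; rewrite !nth_fl // actM (act_tperm _ ea eb). Qed.

Lemma agree_off_tperm s W U t g (a b : 'I_N) :
  val b = (val a).+1 -> (val b + (size s).+1 = N)%N ->
  agree_off s W U t (fl (g * perm_GL F (tperm a b))%g) =
  agree_off s W U t (fl g).
Proof.
move=> eb eN; rewrite [LHS]/agree_off [RHS]/agree_off; suff [-> ->] :
    take (size s).+1 (fl (g * perm_GL F (tperm a b))%g) = take (size s).+1 (fl g) /\
    drop (size s).+2 (fl (g * perm_GL F (tperm a b))%g) = drop (size s).+2 (fl g).
  by [].
split.
  have le h : (size s < size (fl h))%N by rewrite size_fl; lia.
  apply: (@eq_from_nth _ 0%VS) => [|i]; rewrite !size_takel // => lt.
  by rewrite !nth_take // (nth_fl_tperm _ (erefl _) eb) //; lia.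
apply: (@eq_from_nth _ 0%VS) => [|i]; rewrite !size_drop !size_fl // => lt.
rewrite !nth_drop (nth_fl_tperm _ (erefl _) eb) //; lia.
Qed.

(** A sign-reversing involution: multiplying w on the right by an adjacent transposition changes
    only the member of the flag at the free place of the panel, so it preserves [agree_off] and
    changes the sign. The sum is an integer equal to its own negative. *)
Lemma stfun_panel g s W U t :
  \sum_(X | between U W X) stfun g (s ++ [:: W, X, U & t]) = 0.
Proof.
rewrite /stfun exchange_big /=.
rewrite (eq_bigr (fun w => (-1) ^+ w *
    (agree_off s W U t (fl (g * perm_GL F w)%g))%:R)); last first.
  by move=> w _; rewrite -mulr_sumr sum_panel //;
    case/andP: (fl_full (g * perm_GL F w)%g).
(* Here the free place is the last entry of a full flag or lies beyond it, so nothing remains to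
   match U :: t. *)
have [le|lt] := leqP N (size s).+1.
  rewrite big1 // => w _; rewrite /agree_off drop_oversize ?size_fl //.
  by rewrite andbF mulr0.
(* Entry i of the standard flag has dimension N - i. The free place has index [size s] + 1 and so
   holds [estd b] with b = a + 1, the one member that the transposition of a and b can move. *)
have bN : (N - (size s).+1 < N)%N by lia.
have aN : (N - (size s).+2 < N)%N by lia.
pose a := Ordinal aN; pose b := Ordinal bN.
have eb : val b = (val a).+1 by rewrite /=; lia.
have ab : a != b by rewrite -val_eqE /= ; lia.
set S := (X in X = 0).
have : S = - S.
  rewrite {1}/S (reindex_inj (mulIg (tperm a b))) /= -sumrN.
  apply: eq_bigr => w _; rewrite odd_permM odd_tperm ab addbT signrN mulNr.
  rewrite perm_GLM mulgA agree_off_tperm //.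
  by rewrite /=; lia.
lia.
Qed.

Lemma stein_panels (R : comNzRingType) (phi : seq subsp -> R) s V :
  (forall s W U t, \sum_(X | between U W X) phi (s ++ [:: W, X, U & t]) = 0) ->
  stein V (fun t => phi (s ++ t)).
Proof.
move=> H; elim: {V}(\dim V) {-2}V s (leqnn (\dim V)) => [|d IH] V s le.
  by constructor=> [*|V' /covers_dim]; [rewrite H|lia].
constructor=> [*|V' c]; first by rewrite H.
apply: stein_ext (IH V' (rcons s V) _) => [t _ _|]; first by rewrite cat_rcons.
by have := covers_dim c; lia.
Qed.

Lemma stein_intr (R : comNzRingType) V (phi : seq subsp -> int) :
  stein V phi -> stein V (fun t => (phi t)%:~R : R).
Proof.
elim=> {}V {}phi H1 H2 IH; constructor=> // U s fl UV d.
by rewrite -(rmorph_sum (intmul 1)) /= H1.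
Qed.

Lemma steinf_stfun (R : comNzRingType) g : steinf (fun t => (stfun g t)%:~R : R).
Proof.
move=> V; apply: stein_intr; apply: (@stein_panels _ (stfun g) [::]).
exact: stfun_panel.
Qed.

Lemma flag_size t : is_flag t -> size t = (\dim (head 0%VS t)).+1.
Proof.
elim: t => [//|W [|V t] IH]; first by rewrite flag_cons => /eqP ->;
  rewrite dimv0.
by rewrite flag_cons2 => /andP[c /IH /= ->]; rewrite (covers_dim c).
Qed.

Lemma flag_nth_covers t i : is_flag t -> (i.+1 < size t)%N ->
  covers (nth 0%VS t i.+1) (nth 0%VS t i).
Proof.
elim: t i => [//|W [|V t] IH] [|i] //; rewrite flag_cons2 => /andP[c ft] //.
by move=> lt; apply: IH.
Qed.

Lemma full_flag_size t : is_full_flag t -> size t = N.+1.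
Proof. by case/andP => /flag_size -> /eqP ->; rewrite dim_fullv. Qed.

Section Columns.
Variables (t : seq subsp) (v : 'I_N -> 'cV[F]_N).
Hypothesis full_t : is_full_flag t.
Let T i := nth 0%VS t (N - i).
Hypothesis v_in : forall j : 'I_N, v j \in T j.+1.
Hypothesis v_notin : forall j : 'I_N, v j \notin T j.

(** The matrix with columns [v j] carries each [estd i] onto T i, by induction on i. As T N is the
    full space, it is onto and hence invertible. *)
Lemma columns_flag : exists g : GL, fl g = t /\
  forall j, GLval g *m delta_mx j 0 = v j.
Proof.
have st := full_flag_size full_t; case/andP: (full_t) => ft /eqP ht.
have cT j : (j < N)%N -> covers (T j) (T j.+1).
  move=> jN; have := @flag_nth_covers t (N - j.+1) ft; rewrite st /T.
  have -> : (N - j.+1).+1 = (N - j)%N by lia.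
  by apply; lia.
have T0 : T 0 = 0%VS.
  case/and3P: ft => _ _; rewrite /T subn0 -nth_last st /= => /eqP <-.
  by apply: set_nth_default; rewrite st.
have TN : T N = fullv by rewrite /T subnn nth0.
pose M : 'M[F]_N := \matrix_(i, j) v j i 0.
have Mv j : M *m delta_mx j 0 = v j.
  by rewrite -colE; apply/matrixP => i k; rewrite !mxE ord1.
have MT i : (i <= N)%N -> (linfun (mulmx M) @: estd F n i = T i)%VS.
  elim: i => [_|i IH iN]; first by rewrite estd0 limg0 T0.
  rewrite -[i]/(val (Ordinal iN)) estdS limgD limg_line IH ?(ltnW iN) //.
  rewrite lfunE /= Mv; apply/esym/covers_lineE; first exact: (cT _ iN).
    exact: (v_in (Ordinal iN)).
  exact: (v_notin (Ordinal iN)).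
have surj (y : 'cV[F]_N) : exists x, M *m x = y.
  have : y \in (linfun (mulmx M) @: estd F n N)%VS by rewrite MT // TN memvf.
  by case/memv_imgP => x _ ->; exists x; rewrite lfunE.
have [X eX] := choice (fun j : 'I_N => surj (delta_mx j 0)).
have Mu : M \in unitmx.
  have e : M *m (\matrix_(i, j) X j i 0) = 1%:M.
    apply/matrixP => i j; rewrite [RHS]mxE;
      have := congr1 (fun A : 'cV[F]_N => A i 0) (eX j).
    rewrite !mxE eqxx andbT => <-; apply: eq_bigr => k _; rewrite !mxE //.
  by case: (mulmx1_unit e).
exists (FinRing.unit 'M[F]_N Mu); split; last exact: Mv.
apply: (@eq_from_nth _ 0%VS); rewrite size_fl ?st // => i iN.
by rewrite nth_fl // /act MT ?leq_subr // /T subKn.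
Qed.

End Columns.

Lemma full_flag_fl t : is_full_flag t -> exists g, fl g = t.
Proof.
move=> full; have st := full_flag_size full; case/andP: (full) => ft _.
have H (j : 'I_N) : exists x,
    (x \in nth 0%VS t (N - j.+1)) && (x \notin nth 0%VS t (N - j)).
  have jN := ltn_ord j; have := @flag_nth_covers t (N - j.+1) ft; rewrite st.
  have -> : (N - j.+1).+1 = (N - j)%N by lia.
  case/(_ _)/coversP => [|s d]; first by lia.
  have [|x x1 x2] := exists_notin s; first by rewrite d.
  by exists x; rewrite x1.
have [g [e _]] := @columns_flag t (fun j => xchoose (H j)) full
  (fun j => proj1 (andP (xchooseP (H j)))) (fun j => proj2 (andP (xchooseP (H j)))).
by exists g.
Qed.

(** T (j + 1) meets E (N - j) but not E (N - j - 1), so it contains a vector of E (N - j) whose last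
    possible coordinate, at [rev_ord j], can be scaled to 1. These vectors are adapted to t, and as
    columns in reversed order they form a unitriangular matrix. *)
Lemma opposite_fl t : is_full_flag t -> opposite (estd F n) t ->
  exists2 u, u \in unitri F n & t = opp_flag u.
Proof.
move=> full opp; have st := full_flag_size full;
  case/andP: (full) => ft /eqP ht.
pose T i := nth 0%VS t (N - i).
have dT i : (i <= N)%N -> \dim (T i) = i.
  move=> iN; elim: i iN => [|i IH] iN.
    case/and3P: ft => _ _ /eqP; rewrite /T subn0 -nth_last st /= => e.
    by rewrite e dimv0.
  have := @flag_nth_covers t (N - i.+1) ft; rewrite st /T.
  have -> : (N - i.+1).+1 = (N - i)%N by lia.
  by case/(_ _)/coversP => [|_ ->]; [lia|rewrite IH // ltnW].
have oT i : (i <= N)%N -> (T i :&: estd F n (N - i) = 0)%VS.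
  move=> iN; apply/eqP; move/allP: opp => /(_ (T i)); rewrite dT //; apply.
  by rewrite mem_nth // st; lia.
have H (j : 'I_N) : exists x : 'cV[F]_N,
    [&& x \in T j.+1, x \in estd F n (N - j) & x (rev_ord j) 0 == 1].
  have jN := ltn_ord j.
  have : (T j.+1 :&: estd F n (N - j) != 0)%VS.
    rewrite -dimv_eq0; have := dimv_sum_cap (T j.+1) (estd F n (N - j)).
    rewrite dT // dim_estd ?leq_subr //.
    have := dimvS (subvf (T j.+1 + estd F n (N - j))); rewrite dim_fullv; lia.
  set L := (_ :&: _)%VS => L0; have := memv_pick L.
  rewrite memv_cap => /andP[x1 x2]; set x := vpick L in x1 x2.
  have x0 : x != 0 by rewrite vpick0.
  have xr : x (rev_ord j) 0 != 0.
    apply: contra x0 => /eqP e;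
      have : x \in (T j.+1 :&: estd F n (N - j.+1))%VS.
      rewrite memv_cap x1; apply/mem_estd => i;
        rewrite leq_eqVlt => /orP[/eqP ei|lt].
        by rewrite -e; congr (x _ _); apply/val_inj.
      by move/mem_estd: x2; apply; lia.
    by rewrite oT // memv0.
  exists ((x (rev_ord j) 0)^-1 *: x); rewrite !rpredZ //.
  by rewrite mxE mulVf ?eqxx.
pose v j := xchoose (H j).
have vP j : [/\ v j \in T j.+1, v j \in estd F n (N - j) & v j (rev_ord j) 0 = 1].
  by have /and3P[? ? /eqP ?] := xchooseP (H j).
have v_in (j : 'I_N) : v j \in nth 0%VS t (N - j.+1) by case: (vP j).
have v_notin (j : 'I_N) : v j \notin nth 0%VS t (N - j).
  have [_ v2 v3] := vP j; apply/negP => v4.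
  have : v j \in (T j :&: estd F n (N - j))%VS by rewrite memv_cap v4.
  rewrite oT; last exact: ltnW.
  rewrite memv0 => /eqP e; move: v3; rewrite e mxE => /esym/eqP.
  by rewrite oner_eq0.
have [g [eg gv]] := columns_flag full v_in v_notin.
have gE i (j : 'I_N) : GLval g i j = v j i 0 by rewrite -gv -colE mxE.
exists (g * (perm_GL F (w0 n))^-1)%g; last by rewrite /opp_flag mulgKV eg.
have E i j : GLval (g * (perm_GL F (w0 n))^-1)%g i j = GLval g i (rev_ord j).
  rewrite -perm_GLV -[GLval _]/(GLval g *m perm_mx (w0 n)^-1%g).
  by rewrite -col_permE mxE permE.
apply/unitriP; split=> [i j ji|i]; rewrite E gE.
  have [_ v2 _] := vP (rev_ord j); move/mem_estd: v2; apply.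
  by rewrite /=; have := ltn_ord j; lia.
by have [_ _] := vP (rev_ord i); rewrite rev_ordK.
Qed.

Lemma opp_flag_full (u : GL) : is_full_flag (opp_flag u).
Proof. exact: fl_full. Qed.

Lemma span_opp (R : comNzRingType) (Q : path_alg F N R -> Prop) : submod Q ->
  (forall u, u \in unitri F n -> Q (bp R (opp_flag u))) ->
  forall t, is_full_flag t -> Q (bp R t).
Proof.
move=> sQ H t ft; apply: (span_opposite (E := estd F n) _ _ _ sQ _ ft).
- exact: estd0.
- exact: dim_estd.
- exact: estd_sub.
by move=> s fs /(opposite_fl fs)[u Uu ->]; apply: H.
Qed.

Local Notation flagsN := (flags N (fullv : subsp)).

Lemma mem_flagsN t : (t \in flagsN) = is_full_flag t.
Proof. by rewrite flagsP ?dim_fullv. Qed.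

Lemma sum_flagsN_eq (t : seq subsp) : is_full_flag t ->
  \sum_(s <- flagsN) (s == t)%:R = 1 :> int.
Proof.
move=> ft; rewrite (bigD1_seq t) ?mem_flagsN ?flags_uniq ?dim_fullv //=.
by rewrite eqxx big1 ?addr0 // => s /negbTE ->.
Qed.

(** The sum counts, with sign, the pairs (w, w') with u w B = v w' B. By [bruhat_uniq] such a pair
    has w = w', so all signs are +1. *)
Lemma stfun_gram u v : u \in unitri F n -> v \in unitri F n ->
  \sum_(t <- flagsN) stfun u t * stfun v t = (cW (u^-1 * v)%g)%:Z.
Proof.
move=> Uu Uv; have Ux : (u^-1 * v)%g \in unitri F n by rewrite groupM ?groupV.
transitivity (\sum_(w : 'S_N) \sum_(w' : 'S_N) (-1) ^+ w * (-1) ^+ w' *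
    (fl (u * perm_GL F w)%g == fl (v * perm_GL F w')%g)%:R : int).
  rewrite (eq_bigr (fun t => \sum_(w : 'S_N) \sum_(w' : 'S_N) (-1) ^+ w * (-1) ^+ w' *
     ((t == fl (u * perm_GL F w)%g)%:R * (t == fl (v * perm_GL F w')%g)%:R))).
    rewrite exchange_big; apply: eq_bigr => w _; rewrite exchange_big.
    apply: eq_bigr => w' _; rewrite -mulr_sumr; congr (_ * _).
    set f := fl _; set f' := fl _.
    rewrite (eq_bigr (fun t => (f == f')%:R * (t == f)%:R)).
      by rewrite -mulr_sumr sum_flagsN_eq ?mulr1 ?fl_full.
    move=> t _; case: (eqVneq t f) => [->|_]; first by rewrite mul1r mulr1.
    by rewrite mul0r mulr0.
  move=> t _; rewrite /stfun mulr_suml; apply: eq_bigr => w _.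
  by rewrite mulr_sumr; apply: eq_bigr => w' _; rewrite mulrACA.
(* Equality of flags puts w^-1 u^-1 v w in B, whereas [cW] conjugates by w on the other side, hence
   the passage to inverses. *)
rewrite cWE // -sum1_card -natz natr_sum (reindex_inj (@invg_inj _)) /=.
rewrite [RHS]big_mkcond /=.
apply: eq_bigr => w _; rewrite (bigD1 w^-1%g) //= big1 ?addr0.
  rewrite -signr_addb addbb mul1r eq_sym eq_flP invMg perm_GLV invgK !mulgA.
  by rewrite -topredE /= mulgA; case: (_ \in _).
move=> w' ne; rewrite eq_sym eq_flP invMg perm_GLV invgK !mulgA.
case: (boolP (_ \in _)) => [h|_]; last by rewrite mulr0.
case/eqP: ne; rewrite -[w']invgK; congr (_^-1)%g; apply/esym.
by apply: (bruhat_uniq Ux); rewrite perm_GLV invgK !mulgA.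
Qed.

(** Every full flag is [fl h] for some h, and the fibre of [fl] over it is the coset h B; comparing
    with Lagrange's theorem gives the index. *)
Lemma card_flags : size flagsN = #|lcosets (borel F n) [set: GL]|.
Proof.
have e : (#|[set: GL]| = size flagsN * #|borel F n|)%N.
  rewrite -sum1_card (eq_bigr (fun g =>
      \sum_(t <- flagsN) (t == fl g : nat)))%N; last first.
    move=> g _; rewrite (bigD1_seq (fl g)) ?mem_flagsN ?fl_full
      ?flags_uniq ?dim_fullv //=.
    by rewrite eqxx big1 // => s /negbTE ->.
  rewrite exchange_big /= big_seq (eq_bigr (fun=> #|borel F n|)) -?big_seq.
    by rewrite big_const_seq count_predT iter_addn_0 mulnC.
  move=> t; rewrite mem_flagsN => /full_flag_fl[h <-].
  rewrite -(card_lcoset (borel F n) h) -sum1_card big_mkcond [RHS]big_mkcond /=.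
  apply: eq_bigr => g _; rewrite inE mem_lcoset eq_sym eq_flP.
  by case: (_ \in _).
have := @Lagrange _ [group of [set: GL]] (borel_group F n) (finset.subsetT _).
rewrite -card_lcosets /= e mulnC.
by move/eqP; rewrite eqn_pmul2r ?cardG_gt0 // => /eqP.
Qed.

Lemma kappaE ell : kappa F n ell = logn ell (qfact F N).
Proof. by rewrite /kappa -card_flags size_flags ?dim_fullv. Qed.

End SteinbergFunctions.

(** * Duality of filtrations of integral lattices *)

Section IntegralDuality.
Variables (ell : nat) (k : fieldType) (m : nat).
Hypothesis ell_char : ell \in [pchar k].

Definition mxdvd p r (e : nat) (M : 'M[int]_(p, r)) :=
  forall i j, ((ell ^ e)%:Z %| M i j)%Z.

Lemma mxdvd_mull p r s e (M : 'M[int]_(p, r)) (M' : 'M[int]_(r, s)) :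
  mxdvd e M' -> mxdvd e (M *m M').
Proof.
move=> H i j; rewrite mxE; apply: rpred_sum => l _.
exact/dvdz_mull/H.
Qed.

Lemma mxdvd_mulr p r s e (M : 'M[int]_(p, r)) (M' : 'M[int]_(r, s)) :
  mxdvd e M -> mxdvd e (M *m M').
Proof.
move=> H i j; rewrite mxE; apply: rpred_sum => l _.
exact/dvdz_mulr/H.
Qed.

Local Notation red M := (map_mx (intmul (1 : k)) M).

Lemma logn_dvd_absz e (z : int) : z != 0 ->
  ((ell ^ e)%:Z %| z)%Z = (e <= logn ell `|z|)%N.
Proof.
move=> z0; rewrite dvdzE absz_nat pfactor_dvdn ?absz_gt0 //.
exact: pcharf_prime ell_char.
Qed.

(** c (a y) = (a A)(D y) is divisible by ell to the power v(c) + 1 or higher, also when the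
    subtraction is truncated, so a y keeps at least one factor ell. *)
Lemma jantzen_pairing0 (A D : 'M[int]_m) (c : nat) i (a : 'rV[int]_m)
    (y : 'cV[int]_m) : (0 < c)%N -> A *m D = c%:Z%:M ->
  mxdvd i (a *m A) -> mxdvd ((logn ell c).+1 - i) (D *m y) ->
  red a *m red y = 0.
Proof.
move=> c0 AD dA dD; rewrite -map_mxM; apply/matrixP => p r; rewrite !ord1 !mxE.
set z := \sum_i _; apply/eqP; rewrite -(dvdz_pcharf ell_char).
have zE : z = (a *m y) 0 0 by rewrite mxE.
have : (((ell ^ (i + ((logn ell c).+1 - i)))%N)%:Z %| c%:Z * z)%Z.
  have -> : c%:Z * z = (a *m A *m (D *m y)) 0 0.
    by rewrite mulmxA -(mulmxA a) AD mul_mx_scalar -scalemxAl mxE zE.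
  rewrite mxE expnD PoszM; apply: rpred_sum => l _; exact: dvdz_mul.
have [-> _|z0] := eqVneq z 0; first exact: dvdz0.
have c1 : c%:Z != 0 by lia.
have cz : c%:Z * z != 0 by rewrite mulf_neq0.
rewrite logn_dvd_absz // abszM lognM ?absz_gt0 // => le.
rewrite -[ell]expn1 logn_dvd_absz //; move: le; rewrite /=; lia.
Qed.

(** With A = P S Q, the matrix D' = Q D P is diagonal and complementary to S: d_r D'_rr = c. Being
    killed by all reductions of admissible rows a forces the coordinates of P^-1 b with v(d_r) >= i
    to vanish. The remaining columns of P are admissible for D, because v(D'_rr) = v(c) - v(d_r) >=
    v(c) + 1 - i. *)
Lemma jantzen_duality (A D : 'M[int]_m) (c : nat) i (b : 'cV[k]_m) :
  (0 < c)%N -> A *m D = c%:Z%:M ->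
  (forall a : 'rV[int]_m, mxdvd i (a *m A) -> red a *m b = 0) ->
  exists (w : 'I_m -> k) (y : 'I_m -> 'cV[int]_m),
    (forall r, mxdvd ((logn ell c).+1 - i) (D *m y r)) /\
    b = \sum_r w r *: red (y r).
Proof.
move=> c0 AD H.
have [P Pu [Q Qu [d _ eA]]] := int_Smith_normal_form A.
set S := \matrix_(i, j) _ in eA.
pose D' := Q *m D *m P.
have SD : S *m D' = c%:Z%:M.
  have : P *m (S *m (Q *m D)) = c%:Z%:M by rewrite -AD eA !mulmxA.
  move/(congr1 (fun M => invmx P *m M *m P)).
  by rewrite mulKmx // -!mulmxA -scalar_mxC mulKmx // /D' !mulmxA.
have SDE (r s : 'I_m) : d`_r * D' r s = c%:Z *+ (r == s).
  have := congr1 (fun M : 'M_m => M r s) SD.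
  rewrite [LHS]mxE [RHS]mxE => <-.
  rewrite (bigD1 r) //= [S _ _]mxE eqxx mulr1n big1 ?addr0 // => l ne.
  by rewrite [S _ _]mxE val_eqE eq_sym (negbTE ne) mul0r.
have dr0 (r : 'I_m) : d`_r != 0.
  apply/eqP => e; have := SDE r r; rewrite e mul0r eqxx => /esym/eqP.
  by rewrite eqz_nat; lia.
have D'r0 (r : 'I_m) : D' r r != 0.
  apply/eqP => e; have := SDE r r; rewrite e mulr0 eqxx => /esym/eqP.
  by rewrite eqz_nat; lia.
have D'E r s : r != s -> D' r s = 0.
  move=> ne; apply/eqP; have := SDE r s; rewrite (negbTE ne) => /eqP.
  by rewrite mulf_eq0 (negbTE (dr0 _)).
have val_d (r : 'I_m) : (logn ell `|(d`_r)%R| + logn ell `|D' r r| = logn ell c)%N.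
  rewrite -lognM ?absz_gt0 // -abszM; have := SDE r r; rewrite eqxx => ->.
  by rewrite mulr1n absz_nat.
pose b' := red (invmx P) *m b.
have eb : b = red P *m b'.
  by rewrite mulmxA -map_mxM mulmxV // map_mx1 mul1mx.
have b'0 (r : 'I_m) : (i <= logn ell `|(d`_r)%R|)%N -> b' r 0 = 0.
  (* The test vector is row r of P^-1; multiplied by A it becomes d_r times row r of Q. *)
  move=> ir; have h : mxdvd i ((delta_mx 0 r : 'rV_m) *m invmx P *m A).
    rewrite eA !mulmxA mulmxKV //; apply: mxdvd_mulr => p s.
    rewrite -rowE !mxE; case: (r == s :> nat); rewrite ?mulr1n ?dvdz0 //.
    by rewrite logn_dvd_absz.
  have := H _ h; rewrite map_mxM -mulmxA -/b' map_delta_mx -rowE.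
  by move/matrixP/(_ 0 0); rewrite !mxE.
exists (fun r => b' r 0).
exists (fun r : 'I_m => if (i <= logn ell `|(d`_r)%R|)%N then 0 else col r P);
  split.
  move=> r; case: leqP => [_|lt]; first by rewrite mulmx0 => p s;
    rewrite mxE dvdz0.
  rewrite colE;
    have -> : D *m (P *m delta_mx r 0) = invmx Q *m (D' *m (delta_mx r 0 : 'cV_m)).
    by rewrite /D' -!mulmxA mulKmx.
  apply: mxdvd_mull => p s; rewrite -colE mxE.
  case: (eqVneq p r) => [->|ne]; last by rewrite D'E // dvdz0.
  by rewrite logn_dvd_absz //; have := val_d r; lia.
apply/matrixP => p s; rewrite {1}eb mxE summxE ord1; apply: eq_bigr => r _.
rewrite [RHS]mxE; case: leqP => [/b'0 ->|_]; first by rewrite mulr0 mul0r.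
by rewrite mulrC; congr (_ * _); rewrite !mxE.
Qed.

End IntegralDuality.

(** * Change of coefficients and the group algebra *)

Section Reduction.
Variables (R : comNzRingType) (K : choiceType).
Implicit Types (x y : {malg int[K]}).

Lemma mcoeff_reduce x p : (reduce R x)@_p = (x@_p)%:~R.
Proof.
rewrite /reduce mcoeff_sum /=; case: (boolP (p \in msupp x)) => [Ip|Np];
  last first.
  rewrite mcoeff_outdom // big_seq big1 // => r Ir; rewrite mcoeffU.
  by case: eqP => // e; rewrite -e Ir in Np.
rewrite (bigD1_seq p) ?fset_uniq //= mcoeffUU big1 ?addr0 // => r ne.
by rewrite mcoeffU (negbTE ne).
Qed.

Lemma reduceP a x y :
  reduce R (a *: x + y) = a%:~R *: reduce R x + reduce R y.
Proof.
apply/malgP => p; rewrite mcoeff_reduce !mcoeffD !mcoeffZ !mcoeff_reduce.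
by rewrite rmorphD rmorphM.
Qed.

Lemma reduce0 : reduce R (0 : {malg int[K]}) = 0.
Proof. by apply/malgP => p; rewrite mcoeff_reduce !mcoeff0. Qed.

Lemma reduceU (p : K) : reduce R << p >> = << p >>.
Proof. by apply/malgP => r; rewrite mcoeff_reduce !mcoeffU rmorphMn. Qed.

Lemma reduce_sum I (r : seq I) (P : pred I) (a : I -> int)
    (f : I -> {malg int[K]}) :
  reduce R (\sum_(i <- r | P i) a i *: f i) =
  \sum_(i <- r | P i) (a i)%:~R *: reduce R (f i).
Proof.
elim/big_rec2: _ => [|i x y _ <-]; first exact: reduce0.
exact: reduceP.
Qed.

End Reduction.

HB.lock Definition red (F : finFieldType) (n : nat) (R : comNzRingType)
  (x : path_alg F n int) : path_alg F n R := reduce R x.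

Section PathReduction.
Variables (F : finFieldType) (n : nat) (R : comNzRingType).
Local Notation subsp := {vspace 'cV[F]_n}.
Local Notation PZ := (path_alg F n int).
Implicit Types (x y : PZ).

Lemma reduceE x : reduce R x = red R x.
Proof. by rewrite red.unlock. Qed.

Lemma redP a x y : red R (a *: x + y) = a%:~R *: red R x + red R y.
Proof. by rewrite red.unlock; apply: reduceP. Qed.

Lemma red0 : red R (0 : PZ) = 0.
Proof. by rewrite red.unlock; apply: reduce0. Qed.

Lemma red_sum I (r : seq I) (P : pred I) (a : I -> int) (f : I -> PZ) :
  red R (\sum_(i <- r | P i) a i *: f i) =
  \sum_(i <- r | P i) (a i)%:~R *: red R (f i).
Proof. by rewrite red.unlock; apply: reduce_sum. Qed.

Lemma red_bp s : red R (@bp F n int s) = bp R s.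
Proof.
case p: (is_flag_path s).
  by rewrite (bpE _ p) (bpE _ p) red.unlock reduceU.
by rewrite !bp_junk ?p ?red0.
Qed.

Lemma red_smul x y : red R (smul x y) = smul (red R x) (red R y).
Proof.
elim/malg_ind: x => [|a x x' IH IH'|p]; first by rewrite red0 !smul0l red0.
  by rewrite smulPl !redP smulPl IH IH'.
elim/malg_ind: y => [|a y y' IH IH'|r]; first by rewrite red0 !smul0r red0.
  by rewrite smulPr !redP smulPr IH IH'.
rewrite -!bp_val !red_bp.
case: (eqVneq (last 0%VS (val p)) (head 0%VS (val r))) => [e|ne]; last first.
  by rewrite !bp_mul0 ?red0.
case: (lastP (val p)) (valP p) e => [//|s V] p1; rewrite last_rcons.
case: (val r) (valP r) => [//|W u] p2 /= e; rewrite -e in p2 *.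
by rewrite !bp_mul // red_bp.
Qed.

Lemma red_ideal x : rel_ideal x -> rel_ideal (red R x).
Proof.
have redS I (r : seq I) (P : pred I) (f : I -> PZ) :
    red R (\sum_(i <- r | P i) f i) = \sum_(i <- r | P i) red R (f i).
  have := @red_sum I r P (fun=> 1) f.
  rewrite (eq_bigr f) => [->|i _]; last by rewrite scale1r.
  by apply: eq_bigr => i _; rewrite scale1r.
elim=> {x}.
- move=> _ [V W VW d|V W VW d|V W c|V W V' c c' ne].
  + rewrite redS (eq_bigr (fun X => bp R [:: V; X; W])).
      exact: rel_up.
    by move=> X _; rewrite bpathE red_bp.
  + rewrite redS (eq_bigr (fun X => bp R [:: W; X; V])).
      exact: rel_down.
    by move=> X _; rewrite bpathE red_bp.
  + rewrite !bpathE addrC -scaleNr redP !red_bp rmorphN rmorph_nat scaleNr addrC.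
    exact: rel_wedge_eq.
  rewrite !bpathE -[bp int _]scale1r redP !red_bp scale1r.
  exact: rel_wedge_neq.
- rewrite red0; exact: RI0.
- move=> x y _ IH _ IH'; rewrite -[x]scale1r redP scale1r; exact: RID.
- move=> a x _ IH; rewrite -[_ *: _]addr0 redP red0 addr0; exact: RIZ.
- move=> y x _ IH; rewrite pmulE red_smul; exact: rel_ideal_mull.
- move=> y x _ IH; rewrite pmulE red_smul; exact: rel_ideal_mulr.
Qed.

Lemma red_eqS x y : eqS x y -> eqS (red R x) (red R y).
Proof.
rewrite /eqS addrC -scaleN1r => /red_ideal.
by rewrite redP rmorphN scaleN1r addrC.
Qed.

Lemma red_Delta x : Delta F n int x -> Delta F n R (red R x).
Proof.
have [Q0 QD QE] := @submod_span F n R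
  [set bpath R s | s in [set s | is_flag s]]%classic.
apply: (@Delta_ind _ _ _ (fun x => Delta F n R (red R x))).
  split; first by rewrite red0; apply: Q0.
  - by move=> a u v hu hv; rewrite redP; apply: QD.
  - by move=> u v /red_eqS e; apply: QE.
by move=> t ft; rewrite red_bp; apply: Delta_flag.
Qed.

Lemma ract_red (phi : seq subsp -> int) x t :
  ract (fun s => (phi s)%:~R : R) (red R x) t = (ract phi x t)%:~R.
Proof.
elim/malg_ind: x => [|a x y IH IH'|p]; first by rewrite red0 !ract0.
  by rewrite redP !ractP IH IH' rmorphD rmorphM.
rewrite -bp_val red_bp !ract_bp ?(valP p) // /pact; case: ifP => // _.
by rewrite rmorphM /= intz.
Qed.

End PathReduction.

Section GroupAlgebra.
Variables (F : finFieldType) (n : nat) (R : comNzRingType).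
Local Notation N := n.+1.
Local Notation subsp := {vspace 'cV[F]_N}.
Local Notation GL := {'GL_N[F]}.
Local Notation RG := (grp_alg F n R).
Implicit Types (g h u : GL) (x y : RG) (s t : seq subsp).

Lemma mcoeff_gen g h : (<< g >> : RG)@_h = (g == h)%:R.
Proof. exact: mcoeffU. Qed.

Lemma mcoeff_genp (p r : flag_path F N) :
  (<< p >> : path_alg F N R)@_r = (p == r)%:R.
Proof. exact: mcoeffU. Qed.


Lemma sum_msupp (A : nmodType) (x : RG) (f : GL -> R -> A) :
  (forall g, f g 0 = 0) -> \sum_(g <- msupp x) f g x@_g = \sum_g f g x@_g.
Proof.
move=> f0; rewrite [RHS](bigID (fun g => g \in msupp x)) /=.
rewrite [X in _ + X]big1 ?addr0 => [|g Ng]; last by rewrite mcoeff_outdom.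
by rewrite big_uniq ?fset_uniq.
Qed.

Lemma mcoeff_gmul x y l : (gmul x y)@_l = \sum_g x@_g * y@_(g^-1 * l)%g.
Proof.
rewrite /gmul mcoeff_sum /=.
rewrite -(@sum_msupp _ x (fun g c => c * y@_(g^-1 * l)%g)) => [|g];
  last exact: mul0r.
apply: eq_bigr => g _; rewrite mcoeff_sum /=.
rewrite (eq_bigr (fun h => x@_g * (if h == (g^-1 * l)%g then y@_h else 0))).
  rewrite -mulr_sumr (@sum_msupp _ y (fun h c => if h == (g^-1 * l)%g then c else 0)).
    by rewrite -big_mkcond big_pred1_eq.
  by move=> h; rewrite if_same.
move=> h _; rewrite mcoeffU; have -> : ((g * h)%g == l) = (h == (g^-1 * l)%g).
  by rewrite -(inj_eq (mulgI g^-1%g)) mulKg.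
by case: eqP => _; rewrite ?mulr0.
Qed.

Lemma gmulA x y z : gmul x (gmul y z) = gmul (gmul x y) z.
Proof.
apply/malgP => l; rewrite [LHS]mcoeff_gmul [RHS]mcoeff_gmul.
rewrite (eq_bigr (fun g => \sum_h x@_g * (y@_h * z@_(h^-1 * (g^-1 * l))%g))).
  rewrite [RHS](eq_bigr (fun g => \sum_h x@_h * y@_(h^-1 * g)%g * z@_(g^-1 * l)%g)).
    rewrite [RHS]exchange_big /=; apply: eq_bigr => g _.
    rewrite [RHS](reindex_inj (mulgI g)) /=; apply: eq_bigr => h _.
    by rewrite mulKg invMg !mulgA mulrA.
  by move=> g _; rewrite [in LHS]mcoeff_gmul mulr_suml.
by move=> g _; rewrite [in LHS]mcoeff_gmul mulr_sumr.
Qed.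

Lemma mcoeff_borel_sum g : (borel_sum F n R)@_g = (g \in borel F n)%:R.
Proof.
rewrite /borel_sum mcoeff_sum (eq_bigr (fun b => (b == g)%:R)); last first.
  by move=> b _; exact: (mcoeff_gen b g).
case: (boolP (g \in _)) => [h|h].
  by rewrite (bigD1 g h) /= eqxx big1 ?addr0 // => b /andP[_ /negbTE ->].
by rewrite big1 // => b Bb; case: eqP => // e; rewrite -e Bb in h.
Qed.

Lemma mcoeff_mul_borel_sum x h :
  (gmul x (borel_sum F n R))@_h = \sum_g x@_g * (fl h == fl g)%:R.
Proof.
rewrite mcoeff_gmul; apply: eq_bigr => g _.
by rewrite mcoeff_borel_sum eq_flP.
Qed.

Definition alt_sum : RG := \sum_(s : 'S_N) (-1) ^+ s *: << perm_GL F s >>.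

Lemma mcoeff_alt_sum g :
  alt_sum@_g = \sum_(s : 'S_N) (-1) ^+ s * (perm_GL F s == g)%:R.
Proof.
rewrite /alt_sum mcoeff_sum; apply: eq_bigr => s _; rewrite mcoeffZ.
by congr (_ * _); exact: mcoeff_gen.
Qed.

Lemma mcoeff_mulU u y h : (gmul << u >> y)@_h = y@_(u^-1 * h)%g.
Proof.
rewrite mcoeff_gmul (eq_bigr (fun g => (u == g)%:R * y@_(g^-1 * h)%g));
  last first.
  by move=> g _; congr (_ * _); exact: mcoeff_gen.
rewrite (bigD1 u) //= eqxx mul1r big1 ?addr0 // => g ne.
by rewrite eq_sym (negbTE ne) mul0r.
Qed.

(** Multiplying by [borel_sum] on the right makes coefficients constant on the cosets h B, so u e is
    a function on full flags. This is the bridge from the group algebra to functions with vanishing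
    panel sums. *)
Lemma mcoeff_st_e u h :
  (gmul << u >> (st_e F n R))@_h = (stfun u (fl h))%:~R.
Proof.
rewrite mcoeff_mulU /st_e -/alt_sum mcoeff_mul_borel_sum /stfun rmorph_sum /=.
rewrite (eq_bigr (fun g => \sum_(w : 'S_N)
    (-1) ^+ w * (perm_GL F w == g)%:R * (fl (u^-1 * h)%g == fl g)%:R));
      last first.
  by move=> g _; rewrite mcoeff_alt_sum mulr_suml.
rewrite exchange_big; apply: eq_bigr => w _.
rewrite (bigD1 (perm_GL F w)) //= eqxx mulr1 big1 ?addr0 => [|g ne]; last first.
  by rewrite eq_sym (negbTE ne) mulr0 mul0r.
rewrite rmorphM rmorphXn /= rmorphN1 rmorph_nat; congr (_ * _%:R).
rewrite -[in RHS](mulKVg u h) [in RHS]flM [in RHS]flM.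
by rewrite (inj_eq (inj_map (@act_inj F n u))).
Qed.

Lemma mcoeff_st_vec (a : GL -> R) h :
  (st_vec a)@_h = \sum_(u in unitri F n) a u * (stfun u (fl h))%:~R.
Proof.
rewrite /st_vec mcoeff_sum /=; apply: eq_bigr => u _.
by rewrite mcoeffZ mcoeff_st_e.
Qed.

Lemma mcoeff_st_vec_opp (a : GL -> R) u : u \in unitri F n ->
  (st_vec a)@_(u * perm_GL F (w0 n))%g = (-1) ^+ w0 n * a u.
Proof.
move=> Uu; rewrite mcoeff_st_vec -/(opp_flag u) (bigD1 u) //= stfun_opp //.
rewrite eqxx mulr1 rmorphXn rmorphN1 big1 ?addr0 1?mulrC // => v /andP[Uv ne].
by rewrite stfun_opp // (negbTE ne) mulr0 mulr0.
Qed.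

Definition stR u s : R := (stfun u s)%:~R.

Lemma stR_full u t : ~~ is_full_flag t -> stR u t = 0.
Proof.
move=> nf; rewrite /stR /stfun big1 // => w _.
case: eqP => [e|_]; last by rewrite mulr0.
by rewrite e fl_full in nf.
Qed.

(** A flag acting on (0) rebuilds itself. Evaluating at (0) therefore makes a function on flags into
    a linear functional on the path algebra with the same values on flags. *)
Lemma lact_flag0 t : is_flag t -> lact t [:: 0%VS] = (1, t).
Proof.
elim: t => [//|V [|W t] IH]; first by rewrite flag_cons => /eqP ->.
rewrite flag_cons2 lactE => /andP[c ft]; rewrite (IH ft) /lstep /=.
by rewrite c.
Qed.

Lemma ract_flag (phi : seq subsp -> R) t : is_flag t ->
  ract phi (bp R t) [:: 0%VS] = phi t.
Proof.
move=> ft; rewrite ract_bp ?flag_is_path // /pact lact_flag0 // mul1r.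
by case/and3P: ft => _ _ /eqP ->; rewrite eqxx.
Qed.

Lemma ract_eqS (phi : seq subsp -> R) (x y : path_alg F N R) : steinf phi ->
  eqS x y -> ract phi x [:: 0%VS] = ract phi y [:: 0%VS].
Proof.
move=> st e; apply/eqP; rewrite -subr_eq0 -ractB; apply/eqP.
have f0 : is_flag ([:: 0%VS] : seq subsp) by rewrite flag_cons.
exact: (ract_ideal st e f0).
Qed.

Lemma ract_submod (phi : seq subsp -> R) : steinf phi ->
  submod (fun x : path_alg F N R => ract phi x [:: 0%VS] = 0).
Proof.
move=> st; split; first exact: ract0.
  by move=> a x y ex ey; rewrite ractP ex ey mulr0 addr0.
by move=> x y e ey; rewrite (ract_eqS st e).
Qed.

(** The elements killed by the functional of phi form a submodule, and [span_opp] says that the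
    opposite flags already generate all full flags. *)
Lemma steinf_eq0 (phi : seq subsp -> R) : steinf phi ->
  (forall u, u \in unitri F n -> phi (opp_flag u) = 0) ->
  forall t, is_full_flag t -> phi t = 0.
Proof.
move=> st H t full; case/andP: (full) => ft _; rewrite -(ract_flag phi ft).
apply: (span_opp (ract_submod st) _ full) => u Uu.
by rewrite ract_flag ?H //; case/andP: (opp_flag_full u).
Qed.

(** By [stfun_opp] the two sides agree on opposite flags, the factor (-1)^w0 undoing the sign there;
    [steinf_eq0] does the rest. *)
Lemma steinf_expand (phi : seq subsp -> R) : steinf phi ->
  forall t, is_full_flag t -> phi t =
    \sum_(u in unitri F n) (-1) ^+ w0 n * phi (opp_flag u) * stR u t.
Proof.
move=> st t full; apply/eqP; rewrite -subr_eq0; apply/eqP.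
pose psi s := phi s -
  \sum_(u in unitri F n) (-1) ^+ w0 n * phi (opp_flag u) * stR u s.
rewrite -/(psi t); apply: (steinf_eq0 _ _ full) => [V|u Uu].
  have h := @stein_sum _ _ _ V _ (index_enum _) (fun u => u \in unitri F n)
    (fun u s => (-1) ^+ w0 n * phi (opp_flag u) * stR u s).
  have {}h := h (fun u _ => steinZ _ (steinf_stfun R u V)).
  apply: stein_ext (stein_linear (-1) h (st V)) => s _ _.
  by rewrite mulN1r addrC.
rewrite /psi (bigD1 u) //= big1 ?addr0 => [|v /andP[Uv ne]].
  rewrite /stR stfun_opp // eqxx mulr1 rmorphXn rmorphN1 mulrAC -signr_addb.
  by rewrite addbb mul1r subrr.
by rewrite /stR stfun_opp // (negbTE ne) mulr0 mulr0.
Qed.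

Lemma steinf_stR u : steinf (stR u).
Proof. exact: steinf_stfun. Qed.

Lemma St_st_vec (a : GL -> R) : @St F n R (st_vec a).
Proof.
exists (\sum_(u in unitri F n) a u *: << u >>); first exact: I.
apply/malgP => h; rewrite [LHS]mcoeff_gmul mcoeff_st_vec.
rewrite (eq_bigr (fun g => \sum_(u in unitri F n)
    a u * (u == g)%:R * (st_e F n R)@_(g^-1 * h)%g)); last first.
  move=> g _; rewrite mcoeff_sum mulr_suml; apply: eq_bigr => u _.
  by rewrite mcoeffZ; congr (_ * _ * _); exact: mcoeff_gen.
rewrite exchange_big; apply: eq_bigr => u _.
rewrite (bigD1 u) //= eqxx mulr1 big1 ?addr0 => [|g ne]; last first.
  by rewrite eq_sym (negbTE ne) mulr0 mul0r.
by rewrite -mcoeff_st_e mcoeff_mulU.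
Qed.

(** The vectors u e span: any element of St is a combination of the g e, hence a function with
    vanishing panel sums, and [steinf_expand] gives its coordinates. *)
Lemma StP y : @St F n R y -> exists a, y = st_vec a.
Proof.
case=> x _ <-; pose phi s := \sum_g x@_g * stR g s.
have yE h : (gmul x (st_e F n R))@_h = phi (fl h).
  rewrite mcoeff_gmul; apply: eq_bigr => g _; congr (_ * _).
  by rewrite /stR -mcoeff_st_e mcoeff_mulU.
exists (fun u => (-1) ^+ w0 n * phi (opp_flag u)); apply/malgP => h.
have st : steinf phi.
  by move=> V; apply: stein_sum => g _; apply: steinZ; apply: steinf_stR.
rewrite [RHS]mcoeff_st_vec; apply: (etrans (yE h)).
exact: (steinf_expand st (fl_full h)).
Qed.

(** The preimage x in [flag_iso] is far from unique, but the coefficients of z are determined by y,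
    so the pairing does not depend on x. *)
Lemma flag_iso_coef y z (p : flag_path F N) h : flag_iso y z -> val p = fl h ->
  z@_p = y@_h.
Proof.
case=> x -> -> e; rewrite mcoeff_mul_borel_sum mcoeff_sum /=.
rewrite -(@sum_msupp _ x (fun g c => c * (fl h == fl g)%:R)) => [|g];
  last exact: mul0r.
apply: eq_bigr => g _; rewrite mcoeffZ bpathE -/(fl g); congr (_ * _).
have ff : is_flag_path (fl g) by case/andP: (fl_full g) => /flag_is_path.
by rewrite (bpE _ ff) mcoeff_genp -val_eqE /= e eq_sym.
Qed.

Lemma flag_iso_st_vec (a : GL -> R) : exists z, flag_iso (st_vec a) z.
Proof.
have [x _ <-] := St_st_vec a.
exists (\sum_(g <- msupp (gmul x alt_sum)) (gmul x alt_sum)@_g *: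
   bpath R (map (act g) (std_flag F n))).
by exists (gmul x alt_sum); [exact: gmulA|exact: erefl].
Qed.

End GroupAlgebra.

(** * Coordinates and the pairing *)

Section Coordinates.
Variables (F : finFieldType) (n : nat) (R : comNzRingType).
Local Notation N := n.+1.
Local Notation subsp := {vspace 'cV[F]_N}.
Local Notation GL := {'GL_N[F]}.
Local Notation U := (unitri F n).
Local Notation bp := (@bp F N R).
Implicit Types (g h u v : GL) (x y z : path_alg F N R) (s t : seq subsp).

(** Pairing with the basis vector u e of the Steinberg module, extended to the whole path
    algebra. *)
Definition coord u x : R := ract (stR R u) x [:: 0%VS].

(** Opposite flags are dual to the u e only up to the sign of w0, for which the factor
    compensates. *)
Definition ofcoord (b : GL -> R) : path_alg F N R :=
  \sum_(u in U) ((-1) ^+ w0 n * b u) *: bp (opp_flag u).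

Lemma coordP a u x y : coord u (a *: x + y) = a * coord u x + coord u y.
Proof. exact: ractP. Qed.

Lemma coord_sum I (r : seq I) (P : pred I) (c : I -> R)
    (f : I -> path_alg F N R) u :
  coord u (\sum_(i <- r | P i) c i *: f i) =
  \sum_(i <- r | P i) c i * coord u (f i).
Proof.
rewrite /coord ract_sum; apply: eq_bigr => i _; exact: ractZ.
Qed.

Lemma coord_eqS u x y : eqS x y -> coord u x = coord u y.
Proof. exact: (ract_eqS (steinf_stR R u)). Qed.

Lemma flag0 : is_flag ([:: 0%VS] : seq subsp).
Proof. by rewrite flag_cons. Qed.

Lemma coord_fullv u x : coord u (smul (bp [:: fullv]) x) = coord u x.
Proof.
rewrite /coord (ract_mul _ _ _ flag0); apply: (eq_ract _ flag0) => s fs.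
rewrite ract_bp // /pact /=; case: eqP => [_|ne]; first by rewrite mul1r.
by rewrite stR_full //; apply/negP => /andP[_ /eqP h]; case: ne.
Qed.

Lemma coord_flag u t : is_flag t -> coord u (bp t) = stR R u t.
Proof. exact: ract_flag. Qed.

Lemma opp_flag_is_flag u : is_flag (opp_flag u).
Proof. by case/andP: (opp_flag_full u). Qed.

Lemma coord_opp u v : u \in U -> v \in U ->
  coord u (bp (opp_flag v)) = (-1) ^+ w0 n * (u == v)%:R.
Proof.
move=> Uu Uv; rewrite (coord_flag _ (opp_flag_is_flag v)) /stR stfun_opp //.
by rewrite rmorphM rmorphXn /= rmorphN1 rmorph_nat.
Qed.

Lemma signM1 (b : bool) (a : R) : (-1) ^+ b * ((-1) ^+ b * a) = a.
Proof. by rewrite mulrA -signr_addb addbb mul1r. Qed.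

Lemma coord_ofcoord b u : u \in U -> coord u (ofcoord b) = b u.
Proof.
move=> Uu; rewrite /ofcoord coord_sum (bigD1 u) //= coord_opp // eqxx mulr1.
rewrite mulrC signM1 big1 ?addr0 // => v /andP[Uv ne].
by rewrite coord_opp // eq_sym (negbTE ne) mulr0 mulr0.
Qed.

Lemma ofcoordP a b c : ofcoord (fun u => a * b u + c u) =
  a *: ofcoord b + ofcoord c.
Proof.
rewrite /ofcoord scaler_sumr -big_split /=; apply: eq_bigr => u _.
by rewrite scalerA -scalerDl mulrDr !mulrA (mulrC a).
Qed.

Lemma eq_ofcoord b c : {in U, b =1 c} -> ofcoord b = ofcoord c.
Proof. by move=> e; apply: eq_bigr => u Uu; rewrite e. Qed.

Lemma expand_submod : submod (fun x => eqS x (ofcoord (fun u => coord u x))).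
Proof.
split.
- rewrite /ofcoord big1 => [|u _]; first exact: eqS_refl.
  by rewrite /coord ract0 mulr0 scale0r.
- move=> a x y ex ey.
  rewrite (@eq_ofcoord _ (fun u => a * coord u x + coord u y)) => [|u _].
    by rewrite ofcoordP; apply: eqS_linear.
  exact: coordP.
- move=> x y e ey; apply: (eqS_trans e).
  by rewrite (eq_ofcoord (fun u _ => coord_eqS u e)).
Qed.

Lemma full_flag_expand t : is_full_flag t ->
  eqS (bp t) (ofcoord (fun u => coord u (bp t))).
Proof.
apply: (span_opp expand_submod) => v Uv.
rewrite /ofcoord (bigD1 v) //= coord_opp // eqxx mulr1 -signr_addb addbb.
rewrite scale1r big1 ?addr0 => [|u /andP[Uu ne]]; first exact: eqS_refl.
by rewrite coord_opp // (negbTE ne) !mulr0 scale0r.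
Qed.

Local Notation WS := (weight_space fullv (Delta F N R)).

Lemma bp_fullv_mul t : is_flag t -> smul (bp [:: fullv]) (bp t) =
  if is_full_flag t then bp t else 0.
Proof.
move=> ft; rewrite /is_full_flag ft /=; case: eqP => [h|ne].
  case: t ft h => [//|V t] ft /= h; subst V.
  by rewrite (@bp_mul _ _ _ _ [::]) //; apply: flag_is_path.
by rewrite bp_mul0 //=; apply/eqP => h; case: ne.
Qed.

(** Multiplying by (fullv) kills the flags that do not start at the full space; the others are full
    and expand in opposite flags. *)
Lemma Delta_expand y : Delta F N R y ->
  eqS (smul (bp [:: fullv]) y) (ofcoord (fun u => coord u y)).
Proof.
have [Q0 QD QE] := expand_submod => Dy.
suff h : eqS (smul (bp [:: fullv]) y)
    (ofcoord (fun u => coord u (smul (bp [:: fullv]) y))).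
  apply: (eqS_trans h).
  rewrite (eq_ofcoord (fun u _ => coord_fullv u y)); exact: eqS_refl.
move: y Dy; apply: (@Delta_ind _ _ _ (fun y => eqS (smul (bp [:: fullv]) y)
    (ofcoord (fun u => coord u (smul (bp [:: fullv]) y))))).
  split; first by rewrite smul0r; apply: Q0.
  - by move=> a x y hx hy; rewrite smulPr; apply: QD.
  - by move=> x y /(eqSMl (bp [:: fullv])) e; apply: QE.
move=> t ft; rewrite (bp_fullv_mul ft); case: ifP => [full|_].
  exact: full_flag_expand.
exact: Q0.
Qed.

Lemma weight_spaceP (X : set (path_alg F N R)) x :
  weight_space fullv X x <-> exists2 y, X y & eqS x (smul (bp [:: fullv]) y).
Proof.
split=> [[_ [y Xy <-] e]|[y Xy e]].
  by exists y => //; rewrite -pmulE -bpathE.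
by exists (smul (bp [:: fullv]) y) => //; exists y => //; rewrite pmulE bpathE.
Qed.

Lemma WS_expand x : WS x -> eqS x (ofcoord (fun u => coord u x)).
Proof.
case/weight_spaceP => y Dy e; apply: (eqS_trans e).
rewrite (eq_ofcoord (fun u _ => etrans (coord_eqS u e) (coord_fullv u y))).
exact: Delta_expand.
Qed.

Lemma ofcoord_lspan (A : set (path_alg F N R)) b :
  (forall u, u \in U -> A (bp (opp_flag u))) -> lspan A (ofcoord b).
Proof.
move=> H; rewrite /ofcoord; apply: big_ind => [|x y hx hy|u Uu].
- exact: lspan0.
- by rewrite -[x]scale1r; apply: lspan_linear.
- by rewrite -[_ *: _]addr0; apply: lspan_linear (lspan0 _); apply/lspan_gen/H.
Qed.

Lemma full_flags_ofcoord b : full_flags F N R (ofcoord b).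
Proof.
apply: ofcoord_lspan => u _; exists (opp_flag u); first exact: opp_flag_full.
exact: bpathE.
Qed.

Lemma Delta_ofcoord b : Delta F N R (ofcoord b).
Proof.
exists (ofcoord b); last exact: eqS_refl.
apply: ofcoord_lspan => u _; exists (opp_flag u); last exact: bpathE.
exact: opp_flag_is_flag.
Qed.

Lemma fullv_ofcoord b : smul (bp [:: fullv]) (ofcoord b) = ofcoord b.
Proof.
rewrite /ofcoord smul_sumr; apply: eq_bigr => u _.
by rewrite smulZr (bp_fullv_mul (opp_flag_is_flag u)) opp_flag_full.
Qed.

Lemma pdotP a x y z : pdot (a *: x + y) z = a * pdot x z + pdot y z.
Proof. exact: (lext_is_linear (V := R^o) (fun p => z@_p)). Qed.

Lemma pdot0 z : pdot 0 z = 0.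
Proof. by rewrite /pdot msupp0 big_seq_fset0. Qed.

Lemma pdot_bp t z (ft : is_flag_path t) : pdot (bp t) z = z@_(exist _ t ft).
Proof. by rewrite (bpE R ft); exact: (lextU (V := R^o) (fun p => z@_p)). Qed.

(** Both sides are linear in v, and on a full flag [fl g] both give the coefficient of [st_vec a] at
    g. *)
Lemma pdot_st_vec (a : GL -> R) (v z : path_alg F N R) : full_flags F N R v ->
  flag_iso (st_vec a) z -> pdot v z = \sum_(u in U) a u * coord u v.
Proof.
move=> fv iz; move: v fv; apply: lspan_ind => [|b x y ex ey|_ [t full <-]].
- by rewrite pdot0 big1 // => u _; rewrite /coord ract0 mulr0.
- rewrite pdotP ex ey mulr_sumr -big_split /=; apply: eq_bigr => u _.
  by rewrite coordP mulrDr mulrCA.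
have [g eg] := full_flag_fl full; case/andP: (full) => ft _.
have pt := flag_is_path ft.
rewrite bpathE (pdot_bp _ pt) (@flag_iso_coef _ _ _ _ _ _ g iz) ?eg //.
rewrite mcoeff_st_vec; apply: eq_bigr => u _.
by rewrite (coord_flag _ ft) -eg.
Qed.

End Coordinates.

Section Pairing.
Variables (F : finFieldType) (n : nat) (k : fieldType).
Local Notation N := n.+1.
Local Notation subsp := {vspace 'cV[F]_N}.
Local Notation GL := {'GL_N[F]}.
Local Notation U := (unitri F n).

(** The choice in [st_pairing] is harmless: [ofcoord] supplies a representative made of full flags,
    and any other has the same coordinates because these are invariant under [eqS]. *)
Lemma st_pairingE (x : path_alg F N k) (a : GL -> k) :
  weight_space fullv (Delta F N k) x ->
  st_pairing x (st_vec a) = \sum_(u in U) a u * coord u x.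
Proof.
move=> wx; apply: xget_unique => [|c [v [z [fv e iz ->]]]].
  have [z iz] := flag_iso_st_vec a.
  exists (ofcoord (fun u => coord u x)), z; split=> //.
  - exact: full_flags_ofcoord.
  - exact: WS_expand.
  rewrite (pdot_st_vec (full_flags_ofcoord _) iz); apply: eq_bigr => u Uu.
  by rewrite coord_ofcoord.
rewrite (pdot_st_vec fv iz); apply: eq_bigr => u _.
by rewrite (coord_eqS u e).
Qed.

Lemma reduce_st_vec (R : comNzRingType) (a : GL -> int) :
  reduce R (st_vec a) = st_vec (fun u => (a u)%:~R).
Proof.
apply/malgP => h; rewrite mcoeff_reduce !mcoeff_st_vec rmorph_sum /=.
by apply: eq_bigr => u _; rewrite rmorphM /= intz.
Qed.

Lemma st_vecP (R : comNzRingType) c (a b : GL -> R) :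
  st_vec (fun u => c * a u + b u) = c *: st_vec a + st_vec b.
Proof.
rewrite /st_vec scaler_sumr -big_split /=; apply: eq_bigr => u _.
by rewrite scalerDl scalerA.
Qed.

Lemma gow_formE (a b : GL -> int) : gow_form (st_vec a) (st_vec b) =
  \sum_(u in U) \sum_(v in U) a u * b v * (cW (u^-1 * v)%g)%:Z.
Proof.
(* Coordinates in the basis u e are unique: up to a common sign, the coefficient at u w0 is the
   coordinate at u. *)
have inj c d : st_vec c = st_vec d -> {in U, c =1 d :> (GL -> int)}.
  move=> e u Uu; have h := etrans (congr1 (mcoeff (u * perm_GL F (w0 n))%g) e)
    (mcoeff_st_vec_opp d Uu).
  have := congr1 ( *%R ((-1) ^+ w0 n)) (etrans (esym (mcoeff_st_vec_opp c Uu)) h).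
  by rewrite !signM1.
apply: xget_unique => [|c [a' [b' [ea eb ->]]]]; first by exists a, b.
apply: eq_bigr => u Uu; apply: eq_bigr => v Uv.
by rewrite (inj _ _ ea u Uu) (inj _ _ eb v Uv).
Qed.

Definition gow_dvd (ell i : nat) (a : GL -> int) := forall v, v \in U ->
  ((ell ^ i)%:Z %| \sum_(u in U) a u * (cW (u^-1 * v)%g)%:Z)%Z.

Lemma annihilatorP ell i (x : path_alg F N k) :
  annihilator (gow_fil F n ell k i) x <->
  weight_space fullv (Delta F N k) x /\
  forall a, gow_dvd ell i a -> \sum_(u in U) (a u)%:~R * coord u x = 0.
Proof.
(* By bilinearity it suffices to test divisibility against the basis vectors. *)
have E a : gow_dvd ell i a <-> @St F n int (st_vec a) /\
    forall y, @St F n int y -> ((ell ^ i)%:Z %| gow_form (st_vec a) y)%Z.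
  split=> [H|[_ H] v Uv].
    split=> [|y /StP[b ->]]; first exact: St_st_vec.
    rewrite gow_formE exchange_big /=; apply: rpred_sum => v Uv.
    rewrite (eq_bigr (fun u => b v * (a u * (cW (u^-1 * v)%g)%:Z))).
      by rewrite -mulr_sumr; apply: dvdz_mull; apply: H.
    by move=> u _; rewrite mulrA (mulrC (b v)).
  have := H _ (St_st_vec (fun u => (u == v)%:R)); rewrite gow_formE.
  congr (is_true (_ %| _)%Z); apply: eq_bigr => u _.
  rewrite (bigD1 v) //= eqxx mulr1 big1 ?addr0 // => w /andP[_ /negbTE ->].
  by rewrite mulr0 mul0r.
split=> [] [wx H]; split; [exact: wx|move=> a ga|exact: wx|move=> y].
  rewrite -(st_pairingE (fun u => (a u)%:~R) wx) -reduce_st_vec; apply: H.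
  by apply: lspan_gen; exists (st_vec a) => //; apply/E.
pose Q y := exists2 a : GL -> k, y = st_vec a &
  \sum_(u in U) a u * coord u x = 0.
suff QH : forall z, gow_fil F n ell k i z -> Q z.
  by move=> /QH[a -> <-]; apply: st_pairingE.
apply: lspan_ind => [|c _ _ [a -> ea] [b -> eb]|_ [_ [/StP[a ->] Ha] <-]].
- exists (fun=> 0); last by rewrite big1 // => u _; rewrite mul0r.
  by rewrite /st_vec big1 // => u _; rewrite scale0r.
- exists (fun u => c * a u + b u); first by rewrite st_vecP.
  rewrite (eq_bigr (fun u => c * (a u * coord u x) + b u * coord u x)).
    by rewrite big_split /= -mulr_sumr ea eb mulr0 addr0.
  by move=> u _; rewrite mulrDl mulrA.
exists (fun u => (a u)%:~R); first exact: reduce_st_vec.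
by apply: H; apply/E; split=> //; apply: St_st_vec.
Qed.

End Pairing.

(** * The Jantzen form *)

Section JantzenForm.
Variables (F : finFieldType) (n : nat).
Local Notation N := n.+1.
Local Notation subsp := {vspace 'cV[F]_N}.
Local Notation GL := {'GL_N[F]}.
Local Notation U := (unitri F n).
Local Notation bp := (@bp F N int).
Local Notation flagsN := (flags N (fullv : subsp)).
Implicit Types (u v w : GL) (x y : path_alg F N int) (s t : seq subsp).

(** A total bilinear formula which by [jformE] agrees with [jform] on Delta, so that linearity is
    available without side conditions. *)
Definition jf x y : int := ract (delta0 int) (smul (srev y) x) [:: 0%VS].

Lemma jfPr a x y z : jf x (a *: y + z) = a * jf x y + jf x z.
Proof. by rewrite /jf srevP smulPl ractP. Qed.

Lemma jf0r x : jf x 0 = 0.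
Proof. by rewrite /jf srev0 smul0l ract0. Qed.

Lemma jf_eqSr x y z : eqS y z -> jf x y = jf x z.
Proof.
move=> e; apply: (ract_eqS (@stein_delta0 F N int)).
exact/eqSMr/eqS_rev.
Qed.

Lemma jformE x y : Delta F N int x -> Delta F N int y -> jform x y = jf x y.
Proof.
move=> Dx Dy; have h := smul_srev Dx Dy; apply: xget_unique => [|c] /=.
  by rewrite pmulE preverseE bpathE.
by rewrite pmulE preverseE bpathE => /eqS_sym/eqS_trans/(_ h)/eqS_scale_inj.
Qed.

Lemma jf_flag x s : is_flag s -> jf x (bp s) = ract (tau int s) x [:: 0%VS].
Proof.
move=> fs; rewrite /jf srev_bp (ract_mul _ _ _ (flag0 F n)).
apply: (eq_ract _ (flag0 F n)) => t ft.
by rewrite ract_bp // is_flag_path_rev flag_is_path.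
Qed.

Lemma head_last_rev s : last 0%VS (rev s) = head 0%VS s :> subsp.
Proof. by case: s => [//|V s]; rewrite rev_cons last_rcons. Qed.

Lemma ract_expand (phi : seq subsp -> int) x : steinf phi ->
  (forall t, is_flag t -> ~~ is_full_flag t -> phi t = 0) ->
  ract phi x [:: 0%VS] =
  \sum_(u in U) (-1) ^+ w0 n * phi (opp_flag u) * coord u x.
Proof.
move=> st ph0.
rewrite (@eq_ract _ _ _ phi (fun s => \sum_(u in U)
    (-1) ^+ w0 n * phi (opp_flag u) * stR int u s) _ _ (flag0 F n)) => [|t ft].
  elim/malg_ind: x => [|a x y IH IH'|p].
  - by rewrite ract0 big1 // => u _; rewrite /coord ract0 mulr0.
  - rewrite ractP IH IH' mulr_sumr -big_split /=; apply: eq_bigr => u _.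
    by rewrite coordP mulrDr mulrCA.
  rewrite -bp_val ract_bp ?(valP p) //.
  rewrite [RHS](eq_bigr (fun u => (-1) ^+ w0 n * phi (opp_flag u) *
    pact (stR int u) (val p) [:: 0%VS])); last first.
    by move=> u _; rewrite /coord ract_bp ?(valP p).
  rewrite /pact; case: ifP => _; last by rewrite big1 // => u _; rewrite mulr0.
  by rewrite mulr_sumr; apply: eq_bigr => u _; rewrite mulrCA.
have [full|nf] := boolP (is_full_flag t); first exact: steinf_expand.
by rewrite ph0 // big1 // => u _; rewrite stR_full // mulr0.
Qed.

Lemma tau_full s t : is_full_flag s -> is_flag t -> ~~ is_full_flag t ->
  tau int s t = 0.
Proof.
case/andP => _ /eqP hs ft nf; rewrite /tau /pact head_last_rev hs.
by case: eqP => // e; rewrite /is_full_flag ft -e eqxx in nf.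
Qed.

Definition jgram u v : int := tau int (opp_flag u) (opp_flag v).

Lemma jf_opp x u : jf x (bp (opp_flag u)) =
  \sum_(v in U) (-1) ^+ w0 n * jgram u v * coord v x.
Proof.
rewrite (jf_flag _ (opp_flag_is_flag u)); apply: ract_expand.
  exact: (steinf_tau int (opp_flag_is_flag u)).
by move=> t ft nf; apply: (tau_full (opp_flag_full u) ft nf).
Qed.

(** As a function of its first argument, [tau] is not directly of the form covered by
    [steinf_expand]. But the Jantzen form is invariant under [eqS] in the reversed argument, so the
    formula need only be checked on opposite flags. *)
Lemma tau_expand s w : is_full_flag s -> tau int s (opp_flag w) =
  \sum_(v in U) (-1) ^+ w0 n * stfun v s * jgram v w.
Proof.
move=> full; case/andP: (full) => fs _.
pose Q y := jf (bp (opp_flag w)) y =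
  \sum_(v in U) (-1) ^+ w0 n * coord v y * jgram v w.
have sQ : submod Q.
  split.
  - by rewrite /Q jf0r big1 // => v _; rewrite /coord ract0 mulr0 mul0r.
  - move=> a x y ex ey; rewrite /Q jfPr ex ey mulr_sumr -big_split /=.
    by apply: eq_bigr => v _; rewrite coordP mulrDr mulrDl !mulrA (mulrC a).
  - move=> x y e ey; rewrite /Q (jf_eqSr _ e) ey; apply: eq_bigr => v _.
    by rewrite (coord_eqS v e).
have jt t : is_flag t -> jf (bp (opp_flag w)) (bp t) = tau int t (opp_flag w).
  by move=> ft; rewrite (jf_flag _ ft) (ract_flag _ (opp_flag_is_flag w)).
have : Q (bp s).
  apply: (span_opp sQ _ full) => u Uu.
  rewrite /Q (jt _ (opp_flag_is_flag u)) (bigD1 u) //= coord_opp // eqxx mulr1.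
  rewrite -signr_addb addbb mul1r big1 ?addr0 // => v /andP[Uv ne].
  by rewrite coord_opp // (negbTE ne) !mulr0 mul0r.
rewrite /Q (jt _ fs) => ->; apply: eq_bigr => v _.
by rewrite (coord_flag _ _ fs) /stR intz.
Qed.

(** Apply [sum_tau] to the function of u e at the flag opposite for w. Expanding [tau] in its first
    argument produces the products [stfun u s * stfun v s], whose sum over s is Gow's Gram matrix;
    the signs of w0 on the two sides cancel. *)
Lemma gram_inverse u w : u \in U -> w \in U ->
  \sum_(v in U) (cW (u^-1 * v)%g)%:Z * jgram v w = (qfact F N)%:Z *+ (u == w).
Proof.
move=> Uu Uw.
have st : stein (fullv : subsp) (stfun u).
  apply: stein_ext (steinf_stfun int u fullv) => t _ _; exact: intz.
have := sum_tau (dim_fullv F N) st (opp_flag_is_flag w)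
  (eqP (proj2 (andP (opp_flag_full w)))).
rewrite stfun_opp // big_seq (eq_bigr (fun s => \sum_(v in U)
    (-1) ^+ w0 n * (stfun u s * stfun v s) * jgram v w)); last first.
  move=> s; rewrite mem_flagsN => full; rewrite tau_expand // mulr_sumr.
  by apply: eq_bigr => v _; rewrite !mulrA (mulrC (stfun u s)).
rewrite -big_seq exchange_big /=.
rewrite (eq_bigr (fun v =>
    (-1) ^+ w0 n * ((cW (u^-1 * v)%g)%:Z * jgram v w))); last first.
  by move=> v Uv; rewrite -stfun_gram // -mulr_suml -mulr_sumr mulrA.
rewrite -mulr_sumr => /(congr1 ( *%R ((-1) ^+ w0 n))).
by rewrite signM1 mulrCA signM1 mulr_natr natz.
Qed.

End JantzenForm.

(** * Comparison of the two filtrations in coordinates *)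

Section Main.
Variables (F : finFieldType) (n : nat) (k : fieldType) (ell : nat).
Hypothesis ell_char : ell \in [pchar k].
Local Notation N := n.+1.
Local Notation subsp := {vspace 'cV[F]_N}.
Local Notation GL := {'GL_N[F]}.
Local Notation U := (unitri F n).
Local Notation m := #|U|.
Implicit Types (u v w : GL) (i e : nat).

Definition jantzen_dvd e (b : GL -> int) := forall u, u \in U ->
  ((ell ^ e)%:Z %| \sum_(v in U) jgram u v * b v)%Z.

Lemma dvd_sign (b : bool) (d x : int) : (d %| (-1) ^+ b * x)%Z = (d %| x)%Z.
Proof. by case: b; rewrite ?mul1r // expr1 mulN1r; apply: rpredN. Qed.

Lemma jf_opp_sum x u : jf x (bp int (opp_flag u)) =
  (-1) ^+ w0 n * \sum_(v in U) jgram u v * coord v x.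
Proof.
by rewrite jf_opp mulr_sumr; apply: eq_bigr => v _; rewrite mulrA.
Qed.

Lemma Delta_fil_coord e x : Delta_fil ell e x ->
  jantzen_dvd e (fun v => coord (F := F) v x).
Proof.
move=> [Dx H] u Uu; have Du := Delta_flag int (opp_flag_is_flag u).
by have := H _ Du; rewrite (jformE Dx Du) jf_opp_sum dvd_sign.
Qed.

Lemma Delta_fil_ofcoord e b : jantzen_dvd e b -> Delta_fil ell e (ofcoord b).
Proof.
move=> H; have Db := Delta_ofcoord b; split=> // y Dy; rewrite (jformE Db Dy).
pose Q y := ((ell ^ e)%:Z %| jf (ofcoord b) y)%Z.
have sQ : submod Q.
  split; first by rewrite /Q jf0r dvdz0.
  - by move=> a z t Qz Qt; rewrite /Q jfPr; apply: rpredD => //;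
    apply: dvdz_mull.
  - by move=> z t ezt; rewrite /Q (jf_eqSr _ ezt).
rewrite -/(Q y); move: y Dy; apply: (Delta_ind sQ) => t ft.
(* A flag that is not full has another weight than [ofcoord b] and pairs to zero with it; full flags
   reduce to opposite ones. *)
have [full|nf] := boolP (is_full_flag t); last first.
  rewrite /Q (jf_flag _ ft) -(fullv_ofcoord b) (ract_mul _ _ _ (flag0 F n)).
  rewrite (@eq_ract _ _ _ _ (fun=> 0) _ _ (flag0 F n)) => [|s fs].
    by rewrite ract0l dvdz0.
  rewrite ract_bp // /pact /=; case: eqP => // h; rewrite mul1r.
  rewrite /tau /pact head_last_rev; case: eqP => // h'.
  by rewrite /is_full_flag ft h' -h eqxx in nf.
apply: (span_opp sQ _ full) => u Uu; rewrite /Q jf_opp_sum dvd_sign.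
rewrite (eq_bigr (fun v => jgram u v * b v)); first exact: H.
by move=> v Uv; rewrite coord_ofcoord.
Qed.

Lemma coord_red u x : coord u (red k x) = (coord u x)%:~R.
Proof.
rewrite /coord -ract_red; apply: (eq_ract _ (flag0 F n)) => s _.
by rewrite /stR intz.
Qed.

Definition gowmx : 'M[int]_m :=
  \matrix_(i, j) (cW ((enum_val i)^-1 * enum_val j : GL)%g)%:Z.
Definition jantzenmx : 'M[int]_m :=
  \matrix_(i, j) jgram (enum_val i) (enum_val j).

Lemma mul_gow_jantzen : gowmx *m jantzenmx = (qfact F N)%:Z%:M.
Proof.
apply/matrixP => i j;
  rewrite !mxE -(inj_eq enum_val_inj) -gram_inverse ?enum_valP //.
by rewrite [RHS]big_enum_val; apply: eq_bigr => l _; rewrite !mxE.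
Qed.

Lemma qfact_gt0 d : (0 < qfact F d)%N.
Proof.
rewrite prodn_gt0 // => i; rewrite /qint big_ord_recl expn0 //.
Qed.

Definition rowU (R : Type) (a : GL -> R) : 'rV[R]_m := \row_i a (enum_val i).
Definition colU (R : Type) (a : GL -> R) : 'cV[R]_m := \col_i a (enum_val i).
(** Turns a vector indexed by the unitriangular group back into a function on G, zero elsewhere: the
    sum has at most one term. *)
Definition funU (R : nzRingType) (a : 'I_m -> R) (u : GL) : R :=
  \sum_(i | enum_val i == u) a i.

Lemma funUE (R : nzRingType) (a : 'I_m -> R) (i : 'I_m) : funU a (enum_val i) = a i.
Proof.
by rewrite /funU (big_pred1 i) // => j; rewrite (inj_eq enum_val_inj).
Qed.

Lemma gow_dvdP e a : gow_dvd ell e a <-> mxdvd ell e (rowU a *m gowmx).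
Proof.
have E v : \sum_(u in U) a u * (cW (u^-1 * v)%g)%:Z =
    \sum_(i < m) a (enum_val i) * (cW ((enum_val i)^-1 * v)%g)%:Z.
  by rewrite big_enum_val.
split=> [H i j|H v Uv].
  rewrite mxE; have := H (enum_val j) (enum_valP j); rewrite E.
  by congr (is_true (_ %| _)%Z); apply: eq_bigr => l _; rewrite !mxE.
rewrite E; have := H 0 (enum_rank_in Uv v); rewrite mxE.
congr (is_true (_ %| _)%Z); apply: eq_bigr => l _.
by rewrite !mxE enum_rankK_in.
Qed.

Lemma jantzen_dvdP e b : jantzen_dvd e b <-> mxdvd ell e (jantzenmx *m colU b).
Proof.
have E u : \sum_(v in U) jgram u v * b v =
    \sum_(i < m) jgram u (enum_val i) * b (enum_val i).
  by rewrite big_enum_val.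
split=> [H i j|H u Uu].
  rewrite mxE; have := H (enum_val i) (enum_valP i); rewrite E.
  by congr (is_true (_ %| _)%Z); apply: eq_bigr => l _; rewrite !mxE.
rewrite E; have := H (enum_rank_in Uu u) 0; rewrite mxE.
congr (is_true (_ %| _)%Z); apply: eq_bigr => l _.
by rewrite !mxE enum_rankK_in.
Qed.

Local Notation WS := (weight_space fullv (Delta F N k)).

Definition spanned_coord e (x : path_alg F N k) :=
  exists r (c : 'I_r -> k) (b : 'I_r -> GL -> int),
    (forall s, jantzen_dvd e (b s)) /\
    forall u, u \in U -> coord u x = \sum_s c s * (b s u)%:~R.

Lemma WS_Delta (X : set (path_alg F N k)) x :
  (forall y, X y -> Delta F N k y) -> weight_space fullv X x -> WS x.
Proof.
by move=> H /weight_spaceP[y /H Dy e]; apply/weight_spaceP; exists y.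
Qed.

Lemma red_ofcoord (b : GL -> int) :
  red k (ofcoord b) = ofcoord (fun u => (b u)%:~R).
Proof.
rewrite /ofcoord red_sum; apply: eq_bigr => u _.
by rewrite red_bp rmorphM rmorphXn /= rmorphN1.
Qed.

Lemma weight_fil_coord e x :
  weight_space fullv (saturate (image_tensor k (@Delta_fil F N ell e))) x <->
  WS x /\ spanned_coord e x.
Proof.
split=> [wx|[wx [r [c [b [Hb ex]]]]]].
  split.
    apply: WS_Delta wx => y; apply: submod_saturate (submod_span _) _ y.
    apply: submod_lspan (submod_span _) _ => _ [y [Dy _] <-].
    by rewrite reduceE; apply: red_Delta.
  case/weight_spaceP: wx => y [z [r [c [f [Hf ez]]]] eyz] exy.
  (* Integral preimages of the spanning elements; their integral coordinates are the required b. *)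
  have /choice[g Hg] : forall s, exists y, Delta_fil ell e y /\ red k y = f s.
    by move=> s; have [t Dt <-] := Hf s; exists t; rewrite -reduceE.
  exists r, c, (fun s u => coord u (g s)); split=> [s|u Uu].
    by apply: Delta_fil_coord; case: (Hg s).
  rewrite (coord_eqS u exy) coord_fullv (coord_eqS u eyz) ez coord_sum.
  by apply: eq_bigr => s _; rewrite -coord_red; case: (Hg s) => _ ->.
apply/weight_spaceP; exists (ofcoord (fun u => coord u x)); last first.
  by rewrite fullv_ofcoord; apply: WS_expand.
exists (ofcoord (fun u => coord u x)); last exact: eqS_refl.
rewrite (eq_ofcoord ex).
have -> : ofcoord (fun u => \sum_s c s * (b s u)%:~R) =
          \sum_s c s *: reduce k (ofcoord (b s)).
  rewrite /ofcoord; under eq_bigr => u _ do rewrite mulr_sumr scaler_suml.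
  rewrite exchange_big /=; apply: eq_bigr => s _.
  rewrite reduceE red_ofcoord /ofcoord scaler_sumr; apply: eq_bigr => u _.
  by rewrite scalerA mulrCA.
exists r, c, (fun s => reduce k (ofcoord (b s))); split=> // s.
by exists (ofcoord (b s)) => //; apply: Delta_fil_ofcoord.
Qed.

(** At exponent 0 divisibility is no condition, so this matches the convention that terms of
    negative index are the whole space. *)
Lemma spanned_coord0 x : spanned_coord 0 x.
Proof.
exists m, (fun s => coord (enum_val s) x), (fun s u => (u == enum_val s)%:R).
split=> [s u _|u Uu]; first by rewrite expn0 dvd1z.
set j := enum_rank_in Uu u; have ej : enum_val j = u := enum_rankK_in Uu Uu.
rewrite (bigD1 j) //= ej eqxx mulr1 big1 ?addr0 // => s ne.
by rewrite -ej (inj_eq enum_val_inj) eq_sym (negbTE ne) mulr0.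
Qed.

Lemma weight_Deltak_fil i x :
  weight_space fullv
    (Deltak_fil F N ell k ((kappa F n ell)%:Z + 1 - i%:Z)) x <->
  WS x /\ spanned_coord ((logn ell (qfact F N)).+1 - i) x.
Proof.
rewrite kappaE; set l := logn _ _; have [le|lt] := leqP i l.+1.
  have -> : l%:Z + 1 - i%:Z = (l.+1 - i)%N%:Z by lia.
  exact: weight_fil_coord.
(* For i > kappa + 1 the natural subtraction truncates to 0, while the integer index of the
   filtration is negative. *)
have -> : (l.+1 - i)%N = 0%N by lia.
have -> : l%:Z + 1 - i%:Z = Negz (i - l.+2) by lia.
by split=> [wx|[]//]; split=> //; apply: spanned_coord0.
Qed.

Lemma annihilator_weight i x : annihilator (gow_fil F n ell k i) x <->
  weight_space fullv
    (Deltak_fil F N ell k ((kappa F n ell)%:Z + 1 - i%:Z)) x.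
Proof.
apply: (iff_trans (annihilatorP _ _ _)); apply: iff_sym.
apply: (iff_trans (weight_Deltak_fil _ _)).
split=> [] [wx H]; split=> //.
  (* The Jantzen term annihilates I(i): each integral b pairs with each integral a to a multiple of
     ell, by [jantzen_pairing0]. *)
  case: H => r [c [b [Hb ex]]] a /gow_dvdP Ha.
  rewrite (eq_bigr (fun u => \sum_s c s * ((a u)%:~R * (b s u)%:~R)));
    last first.
    by move=> u Uu; rewrite ex // mulr_sumr; apply: eq_bigr => s _;
      rewrite mulrCA.
  rewrite exchange_big big1 //= => s _; rewrite -mulr_sumr.
  have /jantzen_dvdP Hs := Hb s.
  have := jantzen_pairing0 ell_char (qfact_gt0 N) mul_gow_jantzen Ha Hs.
  move/matrixP/(_ 0 0); rewrite mxE [RHS]mxE => e.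
  rewrite big_enum_val /= -[RHS](mulr0 (c s)); congr (_ * _).
  by rewrite -[RHS]e; apply: eq_bigr => j _; rewrite !mxE.
(* Conversely, [jantzen_duality] writes the coordinate vector of an element of the annihilator as a
   combination of reductions of integral vectors in the Jantzen term. *)
have [a Ha|w [y [Hy ey]]] := jantzen_duality (i := i)
  (b := colU (fun u => coord u x)) ell_char (qfact_gt0 N) mul_gow_jantzen.
  have ea : rowU (funU (a 0)) = a.
    by apply/matrixP => p j; rewrite mxE funUE ord1.
  have := H (funU (a 0)); rewrite gow_dvdP ea => /(_ Ha) e.
  apply/matrixP => p s; rewrite !ord1 mxE [RHS]mxE -[RHS]e [RHS]big_enum_val.
  by apply: eq_bigr => j _; rewrite !mxE funUE.
exists m, w, (fun s => funU (fun j => y s j 0)); split=> [s|u Uu].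
  apply/jantzen_dvdP; have -> : colU (funU (fun j => y s j 0)) = y s.
    by apply/matrixP => j p; rewrite mxE funUE ord1.
  exact: Hy.
set j := enum_rank_in Uu u; have ej : enum_val j = u := enum_rankK_in Uu Uu.
have := congr1 (fun M : 'cV_m => M j 0) ey.
rewrite mxE ej => ->; rewrite summxE; apply: eq_bigr => s _.
by rewrite !mxE -ej funUE.
Qed.

End Main.

Theorem theorem4p7 (F : finFieldType) (n : nat) (k : fieldType) (ell : nat)
    (ell_char : ell \in [pchar k]) (i : nat) :
  annihilator (gow_fil F n ell k i) =
  weight_space fullv
    (Deltak_fil F n.+1 ell k ((kappa F n ell)%:Z + 1 - i%:Z)).
Proof.
by apply/funext => x; apply/propext; apply: annihilator_weight.
Qed.
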